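(* There exists exactly one pair of formal series $\bar F^{(1)},\bar F^{(2)}$ (each a pair (even component, odd component)), superconformal in $(x,\varphi)$, whose components lie in $$x\,\mathbb{C}[\alpha_0^{1/2},\alpha_0^{-1/2}][x^{-1},\varphi][[\mathcal A,\mathcal B]][\mathcal M,\mathcal N]$$ for $\bar F^{(1)}$ and in $$x\,\mathbb{C}[\alpha_0^{1/2},\alpha_0^{-1/2}][x][[\mathcal A,\mathcal B]][\mathcal M,\mathcal N]\ \oplus\ \varphi\,\mathbb{C}[\alpha_0^{1/2},\alpha_0^{-1/2}][x][[\mathcal A,\mathcal B]][\mathcal M,\mathcal N]$$ for $\bar F^{(2)}$, such that the following three conditions hold. (1) (Formal boundary conditions.) $$\bar F^{(1)}(x,\varphi)\big|_{(\mathcal A,\mathcal M)=\mathbf 0}=(\alpha_0^{1/2})^{-2L_0(x,\varphi)}\cdot\exp\Big(-\sum_{j\ge1}\big(\mathcal B_jL_{-j}(x,\varphi)+\mathcal N_{j-\frac12}G_{-j+\frac12}(x,\varphi)\big)\Big)\cdot(\alpha_0^{1/2})^{2L_0(x,\varphi)}\cdot(x,\varphi),$$ $$\bar F^{(1)}(x,\varphi)\big|_{(\mathcal B,\mathcal N)=\mathbf 0}=(x,\varphi),\qquad \bar F^{(2)}(x,\varphi)\big|_{(\mathcal A,\mathcal M)=\mathbf 0}=(\alpha_0^{-1}x,\alpha_0^{-1/2}\varphi),$$ $$\bar F^{(2)}(x,\varphi)\big|_{(\mathcal B,\mathcal N)=\mathbf 0}=(\alpha_0^{1/2})^{2L_0(x,\varphi)}\cdot\exp\Big(\sum_{j\ge1}\big(\mathcal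 A_jL_j(x,\varphi)+\mathcal M_{j-\frac12}G_{j-\frac12}(x,\varphi)\big)\Big)\cdot(x,\varphi).$$ (2) (Low order terms.) $$\varphi\bar F^{(1)}(x,\varphi)=\varphi\,\bar F^{(1)}(x,\varphi)\big|_{(\mathcal A,\mathcal M)=\mathbf 0}+\varphi\,(P_0,P_1)+\varphi R^{(1)},\qquad \varphi\bar F^{(2)}(x,\varphi)=\varphi\,\bar F^{(2)}(x,\varphi)\big|_{(\mathcal B,\mathcal N)=\mathbf 0}+\varphi\,(Q_0,Q_1)+\varphi R^{(2)},$$ where, with $\partial=\partial/\partial x$ applied to the full expression in $x$ immediately following it, $$P_0=\big(\alpha_0^{-1}g_{\mathcal A}(x)\,\partial g_{\mathcal B}(\alpha_0x)-\alpha_0^{-1}g_{\mathcal B}(\alpha_0x)\,\partial g_{\mathcal A}(x)\big)^-+2\alpha_0^{-1/2}\big(g_{\mathcal M}(x)g_{\mathcal N}(\alpha_0x)\big)^-,$$ $$P_1=\alpha_0^{-1/2}\big(g_{\mathcal A}(x)\,\partial g_{\mathcal N}(\alpha_0x)-\tfrac12g_{\mathcal N}(\alpha_0x)\,\partial g_{\mathcal A}(x)\big)^-+\alpha_0^{-1}\big(\tfrac12g_{\mathcal M}(x)\,\partial g_{\mathcal B}(\alpha_0x)-g_{\mathcal B}(\alpha_0x)\,\partial g_{\mathcal M}(x)\big)^-,$$ $$Q_0=\big(g_{\mathcal B}(x)\,\partial g_{\mathcal A}(\alpha_0^{-1}x)-g_{\mathcal A}(\alpha_0^{-1}x)\,\partial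 g_{\mathcal B}(x)\big)^+-2\alpha_0^{-1/2}\big(g_{\mathcal M}(\alpha_0^{-1}x)g_{\mathcal N}(x)\big)^+,$$ $$Q_1=\alpha_0^{1/2}\big(\tfrac12g_{\mathcal N}(x)\,\partial g_{\mathcal A}(\alpha_0^{-1}x)-g_{\mathcal A}(\alpha_0^{-1}x)\,\partial g_{\mathcal N}(x)\big)^++\big(g_{\mathcal B}(x)\,\partial g_{\mathcal M}(\alpha_0^{-1}x)-\tfrac12g_{\mathcal M}(\alpha_0^{-1}x)\,\partial g_{\mathcal B}(x)\big)^+,$$ and $R^{(1)}$, $R^{(2)}$ are pairs (even, odd) with components in $\mathbb{C}[\alpha_0^{1/2},\alpha_0^{-1/2}][[\mathcal A,\mathcal B]][\mathcal M,\mathcal N][[x^{-1}]]$ and $\mathbb{C}[\alpha_0^{1/2},\alpha_0^{-1/2}][[\mathcal A,\mathcal B]][\mathcal M,\mathcal N][[x]]$ respectively, containing only terms of total degree at least one in the $\mathcal A_j$'s and $\mathcal M_{j-1/2}$'s, total degree at least one in the $\mathcal B_j$'s and $\mathcal N_{j-1/2}$'s, and total degree at least three in all of the $\mathcal A_j,\mathcal M_{j-1/2},\mathcal B_j,\mathcal N_{j-1/2}$. (3) (Formal sewing equation.) The composition $\bar F^{(2)}\circ(H^{(2)}_{\mathcal B,\mathcal N})^{-1}\circ I\circ H^{(1)}_{\alpha_0^{1/2},\mathcal A,\mathcal M}(x,\varphi)$ exists with components in $x\,\mathbb{C}[\alpha_0^{1/2},\alpha_0^{-1/2}][x^{-1},\varphi][[\mathcal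 A,\mathcal B]][\mathcal M,\mathcal N]$, and $$\bar F^{(1)}(x,\varphi)=\bar F^{(2)}\circ(H^{(2)}_{\mathcal B,\mathcal N})^{-1}\circ I\circ H^{(1)}_{\alpha_0^{1/2},\mathcal A,\mathcal M}(x,\varphi).$$
   Context: Formal variables: $x$, $\alpha_0^{1/2}$, $\mathcal A=\{\mathcal A_j\}_{j\ge1}$, $\mathcal B=\{\mathcal B_j\}_{j\ge1}$ are even (they commute with everything); $\varphi$, $\mathcal M=\{\mathcal M_{j-1/2}\}_{j\ge1}$, $\mathcal N=\{\mathcal N_{j-1/2}\}_{j\ge1}$ are odd (they anticommute with each other and with odd elements, commute with even ones, and square to zero). For a space $V$, $V[[\mathcal A,\mathcal B]][\mathcal M,\mathcal N]$ denotes all formal, possibly infinite, sums of monomials in these variables with coefficients in $V$. $(\mathcal A,\mathcal M)=\mathbf 0$ means all $\mathcal A_j$, $\mathcal M_{j-1/2}$ are set equal to $0$, similarly for $(\mathcal B,\mathcal N)=\mathbf0$. A pair $H(x,\varphi)=(f(x)+\varphi\xi(x),\psi(x)+\varphi g(x))$, with $f,g$ having even and $\xi,\psi$ odd coefficients, is (formally) superconformal in $(x,\varphi)$ if $\xi=g\psi$, $g^2=f'+\psi\psi'$ and $g+\varphi\psi'\not\equiv0$. Multiplication of a pair by $\varphi$ is componentwise, so $\varphi H=(\varphi f,\varphi\psi)$. For $j\in\mathbb Z$: $$L_j(x,\varphi)=-\Big(x^{j+1}\frac{\partial}{\partial x}+\frac{j+1}{2}\varphi x^j\frac{\partial}{\partial\varphi}\Big),\qquad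 G_{j-\frac12}(x,\varphi)=-x^j\Big(\frac{\partial}{\partial\varphi}-\varphi\frac{\partial}{\partial x}\Big).$$ For $b$ even and invertible, $b^{\mp2L_0(x,\varphi)}$ is the operator $c\,\varphi^mx^n\mapsto c\,b^{\pm(2n+m)}\varphi^mx^n$ ($m\in\{0,1\}$, $n\in\mathbb Z$). Operators act on pairs componentwise, products of operators act from right to left, and $\exp$ is the exponential series. $I(x,\varphi)=(1/x,i\varphi/x)$. $$H^{(1)}_{\alpha_0^{1/2},\mathcal A,\mathcal M}(x,\varphi)=\exp\Big(-\sum_{j\ge1}\big(\mathcal A_jL_j+\mathcal M_{j-\frac12}G_{j-\frac12}\big)\Big)\cdot(\alpha_0^{1/2})^{-2L_0}\cdot(x,\varphi),$$ $$H^{(2)}_{\mathcal B,\mathcal N}(x,\varphi)=\exp\Big(\sum_{j\ge1}\big(\mathcal B_jL_{-j}+\mathcal N_{j-\frac12}G_{-j+\frac12}\big)\Big)\cdot\Big(\frac1x,\frac{i\varphi}x\Big),$$ and $(H^{(2)}_{\mathcal B,\mathcal N})^{-1}$ is the compositional inverse, so that $(H^{(2)}_{\mathcal B,\mathcal N})^{-1}\circ I(x,\varphi)=\exp\big(-\sum_{j\ge1}(\mathcal B_jL_{-j}+\mathcal N_{j-1/2}G_{-j+1/2})\big)\cdot(x,\varphi)$. Compositions are expanded in nonnegative powers of the $\mathcal A_j,\mathcal B_j,\mathcal M_{j-1/2},\mathcal N_{j-1/2}$. $g_{\mathcal A}(x)=\sum_{j\ge1}\mathcal A_jx^{j+1}$,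 $g_{\mathcal M}(x)=\sum_{j\ge1}\mathcal M_{j-\frac12}x^j$, $g_{\mathcal B}(x)=\sum_{j\ge1}\mathcal B_jx^{-j+1}$, $g_{\mathcal N}(x)=\sum_{j\ge1}\mathcal N_{j-\frac12}x^{-j+1}$. For $p(x)\in\tilde R[[x,x^{-1}]]$ ($\tilde R$ a superalgebra), $p=p^-+p^+$ is the unique decomposition with $p^-\in\tilde R[[x^{-1}]]$ and $p^+\in x\tilde R[[x]]$. *)

(* Defs.v *)
From HB Require Import structures.
From mathcomp Require Import all_boot all_order all_algebra.
From mathcomp Require Import finmap multiset.
From mathcomp Require Import boolp classical_sets functions cardinality fsbigop.
From mathcomp Require Import reals complex.

Set Implicit Arguments.
Unset Strict Implicit.
Unset Printing Implicit Defensive.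
Import Order.TTheory GRing.Theory Num.Theory.
Local Open Scope classical_set_scope.
Local Open Scope ring_scope.

(* The indices j >= 1 are shifted to nat: in [egen], [inl i] is the even
   variable A_{i+1} and [inr i] is B_{i+1}; in [ogen], [None] is phi,
   [Some (inl i)] is M_{i+1/2} and [Some (inr i)] is N_{i+1/2}, i.e. M_{j-1/2}
   and N_{j-1/2} for j = i+1. *)
Definition egen : choiceType := (nat + nat)%type.
Definition ogen : choiceType := option (nat + nat)%type.

Definition isA (v : egen) : bool := if v is inl _ then true else false.
Definition isB (v : egen) : bool := if v is inr _ then true else false.
Definition isM (v : ogen) : bool := if v is Some (inl _) then true else false.
Definition isN (v : ogen) : bool := if v is Some (inr _) then true else false.

(* phi < M_{1/2} < M_{3/2} < ... < N_{1/2} < N_{3/2} < ... *)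
Definition olt (u v : ogen) : bool :=
  match u, v with
  | None, Some _ => true
  | Some (inl i), Some (inl j) => (i < j)%N
  | Some (inl _), Some (inr _) => true
  | Some (inr i), Some (inr j) => (i < j)%N
  | _, _ => false
  end.

(* (a, n, e, o) is the monomial alpha_0^{a/2} x^n e o, where o stands for the
   product of its elements in increasing [olt] order; in particular phi is
   always the leftmost odd factor. *)
Definition mon : choiceType := (int * int * {mset egen}%mset * {fset ogen})%type.
Definition ea (m : mon) : int := m.1.1.1.
Definition ex (m : mon) : int := m.1.1.2.
Definition ev (m : mon) : {mset egen}%mset := m.1.2.
Definition od (m : mon) : {fset ogen} := m.2.

Definition has_phi (m : mon) : bool := None \in od m.

(* the part of a monomial in the A_j, B_j, M_{j-1/2}, N_{j-1/2} *)
Definition sew (m : mon) : ({mset egen}%mset * {fset ogen})%type :=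
  (ev m, (od m `\ None)%fset).

Definition degAM (m : mon) : nat := (count isA (ev m) + count isM (od m))%N.
Definition degBN (m : mon) : nat := (count isB (ev m) + count isN (od m))%N.

Definition mmul (p q : mon) : mon :=
  (ea p + ea q, ex p + ex q, (ev p `+` ev q)%mset, (od p `|` od q)%fset).

Definition inversions (S T : {fset ogen}) : nat :=
  (\sum_(s <- S) count (fun t => olt t s) T)%N.

(* All formal C-linear combinations of monomials, with C = R[i].  The spaces of
   the theory are subsets of this one, cut out by support conditions. *)
Definition series (R : realType) := mon -> R[i].
HB.instance Definition _ (R : realType) :=
  GRing.Lmodule.copy (series R) (mon -> R[i]).
HB.instance Definition _ (R : realType) :=
  Choice.copy (series R) (mon -> R[i]).

(* A formal map: its value on (x, phi), as (even component, odd component). *)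
Definition smap (R : realType) := (series R * series R)%type.

Section Series.
Variable R : realType.
Local Notation series := (series R).
Local Notation smap := (smap R).
Implicit Types (f g : series) (F H K : smap) (m p q : mon).

(* Infinite sums are taken coefficientwise, each coefficient being a finite sum
   as soon as the family is [summable]. *)
Definition summable (I : choiceType) (u : I -> series) : Prop :=
  forall m, finite_set [set i | u i m != 0].
Definition lsum (I : choiceType) (u : I -> series) : series :=
  fun m => \sum_(i \in [set: I]) u i m.

Definition msign p q : R[i] :=
  if [disjoint od p & od q]%fset then (-1) ^+ inversions (od p) (od q) else 0.

(* All the sums below are finite when f and g are [laurent], or when one of
   them is a monomial. *)
Definition smul f g : series := fun m =>
  \sum_(p \in [set p : mon * mon | mmul p.1 p.2 = m])
     (msign p.1 p.2 * f p.1 * g p.2).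

(* C[alpha_0^{1/2}, alpha_0^{-1/2}][x, x^{-1}, phi][[A, B]][M, N], a ring *)
Definition laurent f : Prop :=
  forall s, finite_set [set m | f m != 0 /\ sew m = s].

Definition even_series f : Prop := forall m, f m != 0 -> ~~ odd #|` od m|.
Definition odd_series f : Prop := forall m, f m != 0 -> odd #|` od m|.
Definition phi_free f : Prop := forall m, f m != 0 -> ~~ has_phi m.

Definition smonom m : series := fun k => (k == m)%:R.
Definition sone : series := smonom (0, 0, mset0, fset0).
Definition alpha (a : int) : series := (* alpha_0^{a/2} *)
  smonom (a, 0, mset0, fset0).
Definition xpow (n : int) : series := smonom (0, n, mset0, fset0).
Definition evar (v : egen) : series := smonom (0, 0, [mset v]%mset, fset0).
Definition ovar (v : ogen) : series := smonom (0, 0, mset0, [fset v]%fset).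
Definition phi : series := ovar None.
Definition varA (i : nat) : series := evar (inl i).
Definition varB (i : nat) : series := evar (inr i).
Definition varM (i : nat) : series := ovar (Some (inl i)).
Definition varN (i : nat) : series := ovar (Some (inr i)).

Definition ddx f : series := fun m =>
  (ex m + 1)%:~R * f (ea m, ex m + 1, ev m, od m).
Definition ddphi f : series := fun m =>
  if has_phi m then 0 else f (ea m, ex m, ev m, (None |` od m)%fset).

Definition opL (j : int) f : series :=
  - (smul (xpow (j + 1)) (ddx f)
     + ((j + 1)%:~R / 2) *: smul phi (smul (xpow j) (ddphi f))).
(* G_{j-1/2} *)
Definition opG (j : int) f : series :=
  - smul (xpow j) (ddphi f - smul phi (ddx f)).

(* (alpha_0^{1/2})^{2 t L_0} : phi^m x^n is multiplied by
   (alpha_0^{1/2})^{-t(2n+m)} *)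
Definition pow2L0 (t : int) f : series := fun m =>
  f (ea m + t * (2 * ex m + (has_phi m)%:Z), ex m, ev m, od m).

(* f(alpha_0^t x), phi being left unchanged *)
Definition rescale (t : int) f : series := fun m =>
  f (ea m - t * (2 * ex m), ex m, ev m, od m).

(* sum_{j>=1} (A_j L_j + M_{j-1/2} G_{j-1/2}), with j = i+1 *)
Definition opAM f : series := lsum (fun i : nat =>
  smul (varA i) (opL i.+1%:Z f) + smul (varM i) (opG i.+1%:Z f)).
(* sum_{j>=1} (B_j L_{-j} + N_{j-1/2} G_{-j+1/2}), with j = i+1; note that
   -j+1/2 = k-1/2 for k = -i *)
Definition opBN f : series := lsum (fun i : nat =>
  smul (varB i) (opL (- i.+1%:Z) f) + smul (varN i) (opG (- i%:Z) f)).

Definition expop (T : series -> series) f : series :=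
  lsum (fun k : nat => (k`!%:R)^-1 *: iter k T f).

Definition both (T : series -> series) H : smap := (T H.1, T H.2).

Definition idsmap : smap := (xpow 1, phi).
Definition Imap : smap := (xpow (-1), Complex 0 1 *: smul phi (xpow (-1))).
Definition H1map : smap := both (expop (fun f => - opAM f)) (both (pow2L0 (-1)) idsmap).
Definition H2map : smap := both (expop opBN) Imap.

(* In an inverse Y of X in [laurent], the A_j, B_j, M_{j-1/2}, N_{j-1/2} occur
   with nonnegative powers only; for X even, Y is unique. *)
Definition is_inv X Y : Prop := laurent Y /\ smul X Y = sone.
Definition sinv X : series := xget 0 [set Y | is_inv X Y].
Definition spow X (n : int) : series :=
  match n with
  | Posz k => iter k (smul X) sone
  | Negz k => iter k.+1 (smul (sinv X)) sone
  end.

(* the term of f at m in which x, phi are replaced by H.1, H.2 *)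
Definition subst_term f H m : series :=
  f m *: smul (smul (if has_phi m then H.2 else sone) (spow H.1 (ex m)))
             (smonom (ea m, 0, ev m, (od m `\ None)%fset)).
Definition scomp F H : smap :=
  (lsum (subst_term F.1 H), lsum (subst_term F.2 H)).
Definition composable F H : Prop :=
  [/\ exists Y, is_inv H.1 Y,
      summable (subst_term F.1 H) & summable (subst_term F.2 H)].

Definition is_compinv H K : Prop :=
  [/\ laurent K.1 /\ even_series K.1, laurent K.2 /\ odd_series K.2,
      composable K H /\ scomp K H = idsmap & composable H K /\ scomp H K = idsmap].

Definition superconformal H : Prop :=
  exists f g xi psi : series,
  [/\ phi_free f /\ even_series f, phi_free g /\ even_series g,
      phi_free xi /\ odd_series xi & phi_free psi /\ odd_series psi] /\
  [/\ H = (f + smul phi xi, psi + smul phi g), xi = smul g psi,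
      smul g g = ddx f + smul psi (ddx psi) & g + smul phi (ddx psi) <> 0].

(* x C[alpha_0^{1/2}, alpha_0^{-1/2}][x^{-1}, phi][[A, B]][M, N] *)
Definition space1 f : Prop :=
  laurent f /\ forall m, f m != 0 -> ex m <= 1.
(* x C[alpha_0^{1/2}, alpha_0^{-1/2}][x][[A, B]][M, N]
   (+) phi C[alpha_0^{1/2}, alpha_0^{-1/2}][x][[A, B]][M, N] *)
Definition space2 f : Prop :=
  laurent f /\ forall m, f m != 0 -> (if has_phi m then 0 else 1) <= ex m.

(* C[alpha_0^{1/2}, alpha_0^{-1/2}][[A, B]][M, N][[x, x^{-1}]] *)
Definition xseries f : Prop :=
  phi_free f /\
  forall n s, finite_set [set m | [/\ f m != 0, ex m = n & sew m = s]].
Definition xneg_series f : Prop :=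
  xseries f /\ forall m, f m != 0 -> ex m <= 0.
Definition xpos_series f : Prop :=
  xseries f /\ forall m, f m != 0 -> 0 <= ex m.

Definition high_order f : Prop := forall m, f m != 0 ->
  [/\ (1 <= degAM m)%N, (1 <= degBN m)%N & (3 <= degAM m + degBN m)%N].

Definition setAM0 f : series := fun m => if degAM m == 0%N then f m else 0.
Definition setBN0 f : series := fun m => if degBN m == 0%N then f m else 0.

(* p^- keeps the constant term *)
Definition minus_part f : series := fun m => if ex m <= 0 then f m else 0.
Definition plus_part f : series := fun m => if 0 < ex m then f m else 0.

Definition gA : series := lsum (fun i : nat => smul (varA i) (xpow (i%:Z + 2))).
Definition gM : series := lsum (fun i : nat => smul (varM i) (xpow (i%:Z + 1))).
Definition gB : series := lsum (fun i : nat => smul (varB i) (xpow (- i%:Z))).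
Definition gN : series := lsum (fun i : nat => smul (varN i) (xpow (- i%:Z))).

Definition P0 : series :=
  minus_part (smul (alpha (-2)) (smul gA (ddx (rescale 1 gB)))
              - smul (alpha (-2)) (smul (rescale 1 gB) (ddx gA)))
  + 2 *: smul (alpha (-1)) (minus_part (smul gM (rescale 1 gN))).

Definition P1 : series :=
  smul (alpha (-1))
    (minus_part (smul gA (ddx (rescale 1 gN))
                 - 2^-1 *: smul (rescale 1 gN) (ddx gA)))
  + smul (alpha (-2))
    (minus_part (2^-1 *: smul gM (ddx (rescale 1 gB))
                 - smul (rescale 1 gB) (ddx gM))).

Definition Q0 : series :=
  plus_part (smul gB (ddx (rescale (-1) gA)) - smul (rescale (-1) gA) (ddx gB))
  - 2 *: smul (alpha (-1)) (plus_part (smul (rescale (-1) gM) gN)).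

Definition Q1 : series :=
  smul (alpha 1)
    (plus_part (2^-1 *: smul gN (ddx (rescale (-1) gA))
                - smul (rescale (-1) gA) (ddx gN)))
  + plus_part (smul gB (ddx (rescale (-1) gM))
               - 2^-1 *: smul (rescale (-1) gM) (ddx gB)).

Definition boundary_conditions (F1 F2 : smap) : Prop :=
  [/\ both setAM0 F1 =
        both (pow2L0 (-1)) (both (expop (fun f => - opBN f)) (both (pow2L0 1) idsmap)),
      both setBN0 F1 = idsmap,
      both setAM0 F2 = (smul (alpha (-2)) (xpow 1), smul (alpha (-1)) phi)
    & both setBN0 F2 = both (pow2L0 1) (both (expop opAM) idsmap)].

Definition low_order_terms (F1 F2 : smap) : Prop :=
  (exists R1 : smap,
    [/\ xneg_series R1.1 /\ even_series R1.1, xneg_series R1.2 /\ odd_series R1.2,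
        high_order R1.1, high_order R1.2
      & both (smul phi) F1 =
          both (smul phi) (both setAM0 F1) + both (smul phi) (P0, P1) + both (smul phi) R1])
  /\
  (exists R2 : smap,
    [/\ xpos_series R2.1 /\ even_series R2.1, xpos_series R2.2 /\ odd_series R2.2,
        high_order R2.1, high_order R2.2
      & both (smul phi) F2 =
          both (smul phi) (both setBN0 F2) + both (smul phi) (Q0, Q1) + both (smul phi) R2]).

Definition sewing_equation (F1 F2 : smap) : Prop :=
  exists H2inv : smap, is_compinv H2map H2inv /\
  let G := scomp H2inv (scomp Imap H1map) in
  [/\ composable Imap H1map, composable H2inv (scomp Imap H1map), composable F2 G,
      space1 (scomp F2 G).1 /\ space1 (scomp F2 G).2
    & F1 = scomp F2 G].

End Series.

(* Main.v *)
(* Substitution of a superconformal map is an operator on formal series: f o H^(1)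
   and f o (H^(2))^{-1} o I are given by exponentials of vector fields, so the
   sewing equation reads F^(1) = E F^(2), componentwise, for a single linear
   operator E whose leading part in the sewing variables is the dilation
   x |-> alpha_0 x, phi |-> alpha_0^{1/2} phi.  Give x weight 2 and phi weight 1.
   Asking for u of weight >= 2 with E u - x of weight <= 1, and for v of weight >= 1
   with E v - phi of weight <= 0, is a linear Wiener-Hopf problem, solved degree by
   degree in the sewing variables, with a unique solution.

   The pair (u, v) is automatically superconformal.  With D = d/dphi + phi d/dx,
   superconformality of (u, v) is the vanishing of D u - v (D v).  The operator E
   carries this defect, up to a twist E' with the same leading part, to the defect
   of (E u, E v); the former has weight >= 1 and the latter weight <= 0, and the
   uniqueness argument kills both.  The boundary conditions hold because their right
   hand sides solve the Wiener-Hopf problems with one family of variables set to 0,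
   and the low order terms come from the bidegree (1, 1) part of E, the commutator
   of the two vector fields.

   Conversely a pair satisfying the conditions solves the two problems: the low
   order terms bound the phi-free parts, the square root g of f' + psi psi' inherits
   the bound from g^2, and xi = g psi. *)

From HB Require Import structures.
Require Import Defs.
From mathcomp Require Import all_boot all_order all_algebra.
From mathcomp Require Import finmap multiset.
From mathcomp Require Import boolp classical_sets functions cardinality fsbigop.
From mathcomp Require Import reals complex.
From mathcomp Require Import zify ring.

Set Implicit Arguments.
Unset Strict Implicit.
Unset Printing Implicit Defensive.
Import Order.TTheory GRing.Theory Num.Theory.
Local Open Scope classical_set_scope.
Local Open Scope ring_scope.

(** * Monomials *)

(** The product of [series] obeys the ring laws only on [laurent] series and the exponentials are
    infinite sums, so the work takes place in the ring [lser] of Laurent series, with operators that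
    are continuous for divisibility of sewing parts: a coefficient of the result depends only on
    coefficients of the argument at monomials whose sewing part divides the given one. A sewing part
    has finitely many divisors, so infinite sums become finite at each coefficient and identities
    can be checked on monomials. Convergence of the exponentials, and of the solution by degrees,
    comes from the filtration by total sewing degree.

    The two weight conditions of a problem cut at the same place, between w - 1 and w, and the
    dilation preserves weights; hence the lowest sewing degree part of a homogeneous solution would
    have to lie on both sides of the cut. The B, N field lowers weight strictly and the A, M field
    never lowers it, which makes the boundary values solutions. The twist E' is needed because D
    commutes with a superconformal field T only up to a multiple of D: D T = T D + lambda D. *)

Definition sle (s t : {mset egen}%mset * {fset ogen}) : bool :=
  (s.1 `<=` t.1)%mset && (s.2 `<=` t.2)%fset.

Definition sdeg (m : mon) : nat := (degAM m + degBN m)%N.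

Definition mon1 : mon := (0, 0, mset0, fset0).

Lemma sle_refl s : sle s s.
Proof. by rewrite /sle msubset_refl fsubset_refl. Qed.

Lemma sle_trans : transitive sle.
Proof.
move=> t s u /andP[s1 s2] /andP[t1 t2]; apply/andP; split.
  exact: msubset_trans t1.
exact: fsubset_trans t2.
Qed.

(** Every submultiset is selected from the list of elements of B by a boolean mask, and there are
    finitely many masks. *)
Lemma finite_msubset (B : {mset egen}%mset) :
  finite_set [set A : {mset egen}%mset | (A `<=` B)%mset].
Proof.
apply: (@sub_finite_set _ _
  ((fun b : (size B).-tuple bool => seq_mset (mask b B)) @` setT)).
  move=> A /= /msubsetP AB.
  have : forall x, (count_mem x A <= count_mem x B)%N.
    by move=> x; rewrite !count_mem_mset.
  move=> /count_subseqP[s /subseqP[b sb ->] AE].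
  exists (tcast sb (in_tuple b)) => //.
  rewrite val_tcast /= -[A]seq_mset_id; apply/eq_seq_msetP.
  by rewrite perm_sym.
exact/finite_image/finite_finset.
Qed.

Lemma finite_sle s : finite_set [set t | sle t s].
Proof.
apply: (@sub_finite_set _ _ ([set A | (A `<=` s.1)%mset] `*` [set` fpowerset s.2])).
  move=> t /andP[t1 t2]; split => //=.
  by rewrite fpowersetE.
apply: finite_setX; first exact: finite_msubset.
exact: finite_fset.
Qed.

Lemma perm_fsetU (T : choiceType) (A B : {fset T}) :
  [disjoint A & B]%fset -> perm_eq (A `|` B)%fset (A ++ B).
Proof.
move=> /fdisjointP dAB; apply: uniq_perm; first exact: fset_uniq.
  rewrite cat_uniq !fset_uniq andbT /=; apply/hasPn => x xB.
  by apply/negP => /dAB; rewrite xB.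
by move=> x; rewrite mem_cat in_fsetU.
Qed.

Lemma perm_msetD (T : choiceType) (A B : {mset T}%mset) :
  perm_eq (A `+` B)%mset (A ++ B).
Proof.
apply/allP => x _ /=; apply/eqP.
by rewrite count_cat !count_mem_mset msetE2.
Qed.

Lemma mmulA p q r : mmul p (mmul q r) = mmul (mmul p q) r.
Proof. by rewrite /mmul /ea /ex /ev /od /= !addrA msetDA fsetUA. Qed.

Lemma mmulC p q : mmul p q = mmul q p.
Proof. by rewrite /mmul msetDC fsetUC addrC [ex p + _]addrC. Qed.

Lemma mmul1m p : mmul mon1 p = p.
Proof.
by case: p => -[[a n] e] o; rewrite /mmul /ea /ex /ev /od /= !add0r mset0D fset0U.
Qed.

Lemma mmulm1 p : mmul p mon1 = p.
Proof. by rewrite mmulC mmul1m. Qed.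

Lemma sle_mmul p q : sle (sew p) (sew (mmul p q)).
Proof.
apply/andP; split => /=.
  by apply/msubsetP => x; rewrite msetE2 leq_addr.
by apply: fsetSD; exact: fsubsetUl.
Qed.

Lemma sle_mmulr p q : sle (sew q) (sew (mmul p q)).
Proof. by rewrite mmulC sle_mmul. Qed.

Definition oddisj (p q : mon) := [disjoint od p & od q]%fset.

Lemma degAM_mmul p q : oddisj p q -> degAM (mmul p q) = (degAM p + degAM q)%N.
Proof.
move=> d; rewrite /degAM /mmul /= (permP (perm_msetD _ _)) count_cat.
by rewrite (permP (perm_fsetU d)) count_cat addnACA.
Qed.

Lemma degBN_mmul p q : oddisj p q -> degBN (mmul p q) = (degBN p + degBN q)%N.
Proof.
move=> d; rewrite /degBN /mmul /= (permP (perm_msetD _ _)) count_cat.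
by rewrite (permP (perm_fsetU d)) count_cat addnACA.
Qed.

Lemma sdeg_mmul p q : oddisj p q -> sdeg (mmul p q) = (sdeg p + sdeg q)%N.
Proof. by move=> d; rewrite /sdeg degAM_mmul // degBN_mmul // addnACA. Qed.

Lemma oddisjC p q : oddisj p q = oddisj q p.
Proof. by rewrite /oddisj fdisjoint_sym. Qed.

Lemma oddisj_mmull p q r : oddisj (mmul p q) r = oddisj p r && oddisj q r.
Proof. by rewrite /oddisj /mmul /= fdisjointUX. Qed.

Lemma oddisj_mmulr p q r : oddisj p (mmul q r) = oddisj p q && oddisj p r.
Proof. by rewrite /oddisj /mmul /= fdisjointXU. Qed.

Lemma card_mmul p q : oddisj p q -> #|` od (mmul p q)| = (#|` od p| + #|` od q|)%N.
Proof. by move=> d; rewrite /= (perm_size (perm_fsetU d)) size_cat. Qed.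

Lemma phi_mmul p q : has_phi (mmul p q) = has_phi p || has_phi q.
Proof. by rewrite /has_phi /mmul /= in_fsetU. Qed.

Lemma phi_disj p q : oddisj p q -> has_phi p && has_phi q = false.
Proof. by move=> /fdisjointP d; apply/negbTE/negP => /andP[/d/negP]. Qed.

Lemma inversionsUl (S1 S2 T : {fset ogen}) : [disjoint S1 & S2]%fset ->
  inversions (S1 `|` S2)%fset T = (inversions S1 T + inversions S2 T)%N.
Proof. by move=> d; rewrite /inversions (perm_big _ (perm_fsetU d)) big_cat. Qed.

Lemma inversionsUr (S T1 T2 : {fset ogen}) : [disjoint T1 & T2]%fset ->
  inversions S (T1 `|` T2)%fset = (inversions S T1 + inversions S T2)%N.
Proof.
move=> d; rewrite /inversions -big_split /=; apply: eq_bigr => s _.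
by rewrite (permP (perm_fsetU d)) count_cat.
Qed.

Lemma olt_total u v : u != v -> (olt u v + olt v u = 1)%N.
Proof.
case: u v => [[i|i]|] [[j|j]|] //= uv; rewrite ?ltnNge;
  by case: ltngtP uv => // -> /eqP[].
Qed.

(** Each pair (s, t) is counted exactly once on the left, because [olt] is total on distinct
    generators. *)
Lemma inversions_sym (S T : {fset ogen}) : [disjoint S & T]%fset ->
  (inversions S T + inversions T S = #|` S| * #|` T|)%N.
Proof.
move=> /fdisjointP d; rewrite /inversions.
under eq_bigr do rewrite -sum1_count big_mkcond.
under [X in (_ + X)%N]eq_bigr do rewrite -sum1_count big_mkcond.
rewrite exchange_big /= [X in (X + _)%N]exchange_big /= [X in (_ + X)%N]exchange_big /=.
rewrite -big_split /= -sum1_size big_distrl /=.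
apply: eq_big_seq => s sS; rewrite -big_split mul1n /= -sum1_size.
apply: eq_big_seq => t tT /=.
have st : s != t by apply: contraTneq tT => <-; exact: d.
by have := olt_total st; case: (olt s t); case: (olt t s).
Qed.

(** * Signs of products of monomials *)

Section Sign.
Variable R : realType.
Local Notation msign := (@msign R).

Lemma msignN p q : ~~ oddisj p q -> msign p q = 0.
Proof. by rewrite /oddisj /msign => /negbTE ->. Qed.

Lemma msignE p q : oddisj p q -> msign p q = (-1) ^+ inversions (od p) (od q).
Proof. by rewrite /oddisj /msign => ->. Qed.

(** The cocycle condition behind associativity: both sides vanish unless the odd parts are pairwise
    disjoint, and then inversions are additive in each argument. *)
Lemma msignA p q r :
  msign p q * msign (mmul p q) r = msign q r * msign p (mmul q r).
Proof.
have [pq|pq] := boolP (oddisj p q); last first.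
  by rewrite msignN // mul0r [X in _ * X]msignN ?mulr0 // oddisj_mmulr negb_and pq.
have [qr|qr] := boolP (oddisj q r); last first.
  by rewrite (msignN qr) mul0r [X in _ * X]msignN ?mulr0 // oddisj_mmull negb_and qr orbT.
have [pr|pr] := boolP (oddisj p r); last first.
  by rewrite ![msign _ (mmul _ _)]msignN ?[msign (mmul _ _) _]msignN ?mulr0 //
    ?oddisj_mmull ?oddisj_mmulr negb_and pr // orbT.
rewrite !msignE ?oddisj_mmull ?oddisj_mmulr ?pq ?qr ?pr //.
rewrite -!exprD /= inversionsUl // inversionsUr //; congr (_ ^+ _).
by rewrite addnA addnC.
Qed.

Lemma msignC p q :
  msign p q = (-1) ^+ (#|` od p| * #|` od q|)%N * msign q p.
Proof.
have [pq|pq] := boolP (oddisj p q); last first.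
  by rewrite !msignN ?mulr0 // oddisjC.
rewrite !msignE // 1?oddisjC // -inversions_sym // exprD -mulrA -expr2.
by rewrite sqrr_sign mulr1.
Qed.

Lemma inversions0l T : inversions fset0 T = 0%N.
Proof. by rewrite /inversions big_seq_fset0. Qed.

Lemma inversions0r S : inversions S fset0 = 0%N.
Proof. by rewrite /inversions big1 // => s _; rewrite /= (eq_in_count (a2 := pred0)) ?count_pred0. Qed.

Lemma msign1m p : msign mon1 p = 1.
Proof. by rewrite msignE /oddisj ?fdisjoint0X // inversions0l. Qed.

Lemma msignm1 p : msign p mon1 = 1.
Proof. by rewrite msignE /oddisj ?fdisjointX0 // inversions0r. Qed.

Lemma inversions_phil T : inversions [fset None]%fset T = 0%N.
Proof.
rewrite /inversions big_seq_fset1; apply/eqP; rewrite -leqn0 leqNgt -has_count.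
by apply/hasPn => -[[]|].
Qed.

End Sign.

(** * The ring of Laurent series *)

Definition laurentb (R : realType) : {pred series R} := fun f => `[< laurent f >].

Lemma laurent_le (R : realType) (f : series R) s :
  laurent f -> finite_set [set m | f m != 0 /\ sle (sew m) s].
Proof.
move=> fl; apply: (@sub_finite_set _ _
  (\bigcup_(t in [set t | sle t s]) [set m | f m != 0 /\ sew m = t])).
  by move=> m [fm ms]; exists (sew m).
by apply: bigcup_finite => // ; exact: finite_sle.
Qed.

Lemma laurentZD_closed (R : realType) : submod_closed (@laurentb R).
Proof.
split=> [|a f g].
  apply/asboolP => s; apply: (@sub_finite_set _ _ set0) => // m [].
  by rewrite eqxx.
move=> /asboolP lf /asboolP lg; apply/asboolP => s.
apply: (@sub_finite_set _ _ ([set m | f m != 0 /\ sew m = s] `|` [set m | g m != 0 /\ sew m = s])).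
  move=> m [nz ms]; case: (eqVneq (f m) 0) => [f0|]; last by left.
  right; split=> //; apply: contraNneq nz => g0.
  by have -> : (a *: f + g) m = a * f m + g m by []; rewrite f0 g0 mulr0 addr0.
by rewrite finite_setU.
Qed.

HB.instance Definition _ (R : realType) :=
  GRing.isSubmodClosed.Build R[i] (series R) (@laurentb R) (laurentZD_closed R).

(* The products of series are well behaved on Laurent series only.  The prefix l marks
   the element of [lser] lying over a series of the theory: [lphi], [lX], [lA], [lgA]. *)
Record lser (R : realType) := Lser { lval :> series R; lvalP : lval \in @laurentb R }.
HB.instance Definition _ (R : realType) := [isSub for @lval R].
HB.instance Definition _ (R : realType) := [Choice of lser R by <:].
HB.instance Definition _ (R : realType) := [SubChoice_isSubLmodule of lser R by <:].

Definition coef (R : realType) (f : lser R) (m : mon) : R[i] := lval f m.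
Coercion coef : lser >-> Funclass.
Arguments coef : simpl never.

Section Ring.
Variable R : realType.
Local Notation series := (series R).
Local Notation lser := (lser R).
Local Notation msign := (@msign R).
Implicit Types (f g h : lser) (p q m : mon).

Lemma lvalK f : laurent (lval f).
Proof. by case: f => f /= /asboolP. Qed.

Definition mkl (f : series) (lf : laurent f) : lser := Lser (asboolT lf).

Lemma lserP f g : f =1 g -> f = g.
Proof. by move=> fg; apply: val_inj; apply/funext. Qed.

Lemma coefD f g m : (f + g) m = f m + g m. Proof. by []. Qed.
Lemma coefN f m : (- f) m = - f m. Proof. by []. Qed.
Lemma coefB f g m : (f - g) m = f m - g m. Proof. by []. Qed.
Lemma coefZ a f m : (a *: f) m = a * f m. Proof. by []. Qed.
Lemma coef0 m : (0 : lser) m = 0. Proof. by []. Qed.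

Lemma coef_sum (I : Type) (r : seq I) (P : pred I) (F : I -> lser) m :
  (\sum_(i <- r | P i) F i) m = \sum_(i <- r | P i) F i m.
Proof. by elim/big_rec2: _ => // i x y _ <-. Qed.

(** Any finite set containing the relevant part of the support is allowed, so that sums for several
    series can run over one common index set. *)
Definition covers f m (X : {fset mon}) :=
  forall p, f p != 0 -> sle (sew p) (sew m) -> p \in X.

Definition below f m : {fset mon} :=
  fset_set [set p | lval f p != 0 /\ sle (sew p) (sew m)].

Lemma covers_below f m : covers f m (below f m).
Proof.
by move=> p fp pm; rewrite in_fset_set ?inE //; exact/laurent_le/lvalK.
Qed.

Lemma coversS f m X Y : (X `<=` Y)%fset -> covers f m X -> covers f m Y.
Proof. by move=> /fsubsetP XY cX p fp pm; apply/XY/cX. Qed.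

(** In a factorization of m the sewing parts of both factors divide that of m, so the terms outside
    X and Y vanish. *)
Lemma smulE f g m X Y : covers f m X -> covers g m Y ->
  smul f g m = \sum_(p <- X) \sum_(q <- Y)
    (if mmul p q == m then msign p q * f p * g q else 0).
Proof.
move=> cX cY; rewrite /smul.
pose r := [seq z <- [seq (p, q) | p <- X, q <- Y] | mmul z.1 z.2 == m].
rewrite (fsbigE r).
- rewrite big_filter_cond big_mkcond big_allpairs.
  apply: eq_bigr => p _; apply: eq_bigr => q _ /=.
  by case: eqP => //= e; rewrite mem_set.
- by rewrite filter_uniq // allpairs_uniq //; [exact: fset_uniq.. | case=> ? ? []].
- by move=> z /=; rewrite mem_filter => /andP[/eqP].
move=> [p q] /= pqm; apply: contraNeq => nz.
rewrite mem_filter /= pqm eqxx allpairs_f //; rewrite -pqm in cX cY.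
  apply: cX; last exact: sle_mmul.
  by apply: contraNneq nz => /= fp; rewrite (fp : lval f p = 0) mulr0 mul0r.
apply: cY; last exact: sle_mmulr.
by apply: contraNneq nz => /= gq; rewrite (gq : lval g q = 0) mulr0.
Qed.

Lemma smul_laurent f g : laurent (smul f g).
Proof.
move=> s; pose X := [set p | lval f p != 0 /\ sle (sew p) s].
pose Y := [set p | lval g p != 0 /\ sle (sew p) s].
apply: (@sub_finite_set _ _ ((fun z => mmul z.1 z.2) @` (X `*` Y))); last first.
  by apply/finite_image/finite_setX; exact/laurent_le/lvalK.
move=> m [nz ms]; apply: contrapT => nXY; move/negP: nz; apply; apply/eqP.
rewrite (smulE (@covers_below f m) (@covers_below g m)).
rewrite big_seq big1 // => p; rewrite in_fset_set; last exact/laurent_le/lvalK.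
rewrite inE => pX; rewrite big_seq big1 // => q.
rewrite in_fset_set; last exact/laurent_le/lvalK.
rewrite inE => qX; case: eqP => // pqm; case: nXY.
by exists (p, q) => //; split; rewrite /X /Y -ms.
Qed.

Definition lmul f g : lser := mkl (@smul_laurent f g).

Lemma lmulE f g m X Y : covers f m X -> covers g m Y ->
  lmul f g m = \sum_(p <- X) \sum_(q <- Y)
    (if mmul p q == m then msign p q * f p * g q else 0).
Proof. exact: smulE. Qed.

Lemma smonom_laurent m : laurent (smonom R m).
Proof.
move=> s; apply: (@sub_finite_set _ _ [set m]) => // k [] /=.
by rewrite /smonom; case: (k =P m) => // _; rewrite eqxx.
Qed.

Definition lmon m : lser := mkl (@smonom_laurent m).

Lemma lmonE p m : lmon p m = (m == p)%:R. Proof. by []. Qed.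

Definition vanish_le f m := forall p, sle (sew p) (sew m) -> f p = 0.

(* A local operator is continuous: its coefficients at m only depend on the coefficients
   at the monomials whose sewing part divides that of m.  Hence it is determined by its
   values on monomials ([local_ext]). *)
Definition local (F : lser -> lser) :=
  (forall a f g, F (a *: f + g) = a *: F f + F g) /\
  (forall f m, vanish_le f m -> F f m = 0).

Lemma localD F : local F -> {morph F : f g / f + g}.
Proof. by move=> [lF _] f g; rewrite -[f in LHS]scale1r lF scale1r. Qed.

Lemma local0 F : local F -> F 0 = 0.
Proof.
move=> lF; have := localD lF 0 0; rewrite addr0 => /esym/eqP.
by rewrite -subr_eq0 addrK => /eqP.
Qed.

Lemma localZ F : local F -> forall a f, F (a *: f) = a *: F f.
Proof. by move=> lF a f; rewrite -[a *: f in LHS]addr0 lF.1 (local0 lF) addr0. Qed.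

Lemma localN F : local F -> {morph F : f / - f}.
Proof. by move=> lF f; rewrite -scaleN1r localZ // scaleN1r. Qed.

Lemma localB F : local F -> {morph F : f g / f - g}.
Proof. by move=> lF f g; rewrite localD // localN. Qed.

Lemma local_sum F : local F -> forall (I : Type) (r : seq I) (P : pred I) (u : I -> lser),
  F (\sum_(i <- r | P i) u i) = \sum_(i <- r | P i) F (u i).
Proof.
by move=> lF I r P u; apply: (big_morph F (localD lF) (local0 lF)).
Qed.

Lemma local_eq_le F f g m : local F ->
  (forall p, sle (sew p) (sew m) -> f p = g p) -> F f m = F g m.
Proof.
move=> lF fg; apply/eqP; rewrite -subr_eq0 -coefB -localB // lF.2 //.
by move=> p /fg; rewrite coefB => ->; rewrite subrr.
Qed.

(** At the divisors of m, the series f agrees with the finite combination of monomials indexed by X,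
    and F at m sees nothing else. *)
Lemma local_expand F f m X : local F -> covers f m X ->
  F f m = \sum_(p <- X) f p * F (lmon p) m.
Proof.
move=> lF cX; have -> : F f m = F (\sum_(p <- X) f p *: lmon p) m.
  apply: (local_eq_le lF) => p pm; rewrite coef_sum.
  have [pX|pX] := boolP (p \in X).
    rewrite (bigD1_seq p) ?fset_uniq //= coefZ lmonE eqxx mulr1 big1 ?addr0 // => q qp.
    by rewrite coefZ lmonE eq_sym (negbTE qp) mulr0.
  rewrite big_seq big1; last first.
    move=> q qX; rewrite coefZ lmonE; case: eqP => [E|]; rewrite ?mulr0 //.
    by rewrite E qX in pX.
  by apply/eqP; apply: contraNT pX => /cX; apply.
by rewrite local_sum // coef_sum; apply: eq_bigr => p _; rewrite localZ.
Qed.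

Lemma local_ext F G : local F -> local G ->
  (forall p, F (lmon p) = G (lmon p)) -> F =1 G.
Proof.
move=> lF lG FG f; apply: lserP => m.
rewrite !(@local_expand _ f m (below f m)) //; try exact: covers_below.
by apply: eq_bigr => p _; rewrite FG.
Qed.

Lemma below_vanish f m : vanish_le f m -> covers f m fset0.
Proof. by move=> v p fp pm; rewrite v ?eqxx in fp. Qed.

Lemma local_lmull g : local (lmul g).
Proof.
split=> [a f h|f m v]; last first.
  rewrite (lmulE (@covers_below g m) (below_vanish v)).
  by rewrite big1 // => p _; rewrite big_seq_fset0.
apply: lserP => m; rewrite coefD coefZ; pose X := (below f m `|` below h m)%fset.
have cf : covers f m X by apply: coversS (@covers_below f m); exact: fsubsetUl.
have ch : covers h m X by apply: coversS (@covers_below h m); exact: fsubsetUr.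
have cfh : covers (a *: f + h) m X.
  move=> p; rewrite coefD coefZ; have [/eqP f0|fn] := boolP (f p == 0).
    by rewrite f0 mulr0 add0r; exact: ch.
  by move=> _; exact: cf.
rewrite !(lmulE (@covers_below g m) (Y := X)) // big_distrr -big_split /=.
apply: eq_bigr => p _; rewrite big_distrr -big_split /=; apply: eq_bigr => q _.
case: eqP => _; last by rewrite mulr0 addr0.
by rewrite coefD coefZ mulrDr mulrCA.
Qed.

Lemma local_lmulr g : local (lmul^~ g).
Proof.
split=> [a f h|f m v]; last first.
  rewrite (lmulE (below_vanish v) (@covers_below g m)).
  by rewrite big_seq_fset0.
apply: lserP => m; rewrite coefD coefZ; pose X := (below f m `|` below h m)%fset.
have cf : covers f m X by apply: coversS (@covers_below f m); exact: fsubsetUl.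
have ch : covers h m X by apply: coversS (@covers_below h m); exact: fsubsetUr.
have cfh : covers (a *: f + h) m X.
  move=> p; rewrite coefD coefZ; have [/eqP f0|fn] := boolP (f p == 0).
    by rewrite f0 mulr0 add0r; exact: ch.
  by move=> _; exact: cf.
rewrite !(lmulE (X := X) _ (@covers_below g m)) // big_distrr -big_split /=.
apply: eq_bigr => p _; rewrite big_distrr -big_split /=; apply: eq_bigr => q _.
case: eqP => _; last by rewrite mulr0 addr0.
by rewrite coefD coefZ; ring.
Qed.

Lemma local_comp F G : local F -> local G -> local (F \o G).
Proof.
move=> [lF vF] lG; split=> [a f g|f m v] /=; first by rewrite lG.1 lF.
by apply: vF => p pm; apply: lG.2 => q qp; apply: v; exact: sle_trans qp pm.
Qed.

Lemma local_add F G : local F -> local G -> local (fun f => F f + G f).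
Proof.
move=> lF lG; split=> [a f g|f m v] /=.
  by rewrite lF.1 lG.1 scalerDr addrACA.
by rewrite coefD lF.2 // lG.2 // addr0.
Qed.

Lemma local_scale a F : local F -> local (fun f => a *: F f).
Proof.
move=> lF; split=> [b f g|f m v] /=; last by rewrite coefZ lF.2 // mulr0.
by rewrite lF.1 scalerDr !scalerA mulrC.
Qed.

Lemma local_opp F : local F -> local (fun f => - F f).
Proof.
move=> lF; split=> [b f g|f m v] /=; last by rewrite coefN lF.2 // oppr0.
by rewrite lF.1 opprD scalerN.
Qed.

Lemma local_id : local id.
Proof. by split=> // f m; apply; exact: sle_refl. Qed.

Lemma lmul_mon p q : lmul (lmon p) (lmon q) = msign p q *: lmon (mmul p q).
Proof.
apply: lserP => m; have cv r : covers (lmon r) m [fset r]%fset.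
  by move=> k; rewrite lmonE inE; case: (k == r) => //; rewrite eqxx.
rewrite (lmulE (@cv p) (@cv q)) !big_seq_fset1 !lmonE !eqxx coefZ lmonE eq_sym.
by case: eqP => _; rewrite ?mulr1 // mulr0.
Qed.

Lemma lmulA : associative lmul.
Proof.
move=> f g h.
apply: (local_ext (F := fun f => lmul f (lmul g h)) (G := fun f => lmul (lmul f g) h)).
- exact: local_lmulr.
- exact: (local_comp (local_lmulr h) (local_lmulr g)).
move=> p.
apply: (local_ext (F := fun g => lmul (lmon p) (lmul g h)) (G := fun g => lmul (lmul (lmon p) g) h)).
- exact: (local_comp (local_lmull (lmon p)) (local_lmulr h)).
- exact: (local_comp (local_lmulr h) (local_lmull (lmon p))).
move=> q.
apply: (local_ext (F := fun h => lmul (lmon p) (lmul (lmon q) h)) (G := fun h => lmul (lmul (lmon p) (lmon q)) h)).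
- exact: (local_comp (local_lmull (lmon p)) (local_lmull _)).
- exact: local_lmull.
move=> r; rewrite !lmul_mon (localZ (local_lmull _)) (localZ (local_lmulr _)).
by rewrite !lmul_mon !scalerA mmulA msignA.
Qed.

Lemma lmul1f : left_id (lmon mon1) lmul.
Proof.
move=> f; apply: (local_ext (G := id)); [exact: local_lmull|exact: local_id|].
by move=> p; rewrite lmul_mon msign1m scale1r mmul1m.
Qed.

Lemma lmulf1 : right_id (lmon mon1) lmul.
Proof.
move=> f; apply: (local_ext (F := lmul^~ _) (G := id)); [exact: local_lmulr|exact: local_id|].
by move=> p; rewrite lmul_mon msignm1 scale1r mmulm1.
Qed.

Lemma lmulDl : left_distributive lmul +%R.
Proof. by move=> f g h; exact: (localD (local_lmulr h)). Qed.

Lemma lmulDr : right_distributive lmul +%R.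
Proof. by move=> f g h; exact: (localD (local_lmull f)). Qed.

Lemma lone_neq0 : lmon mon1 != 0.
Proof.
apply/eqP => /(congr1 (fun f : lser => f mon1)); rewrite lmonE eqxx coef0 => /eqP.
by rewrite oner_eq0.
Qed.

HB.instance Definition _ :=
  GRing.Zmodule_isNzRing.Build lser lmulA lmul1f lmulf1 lmulDl lmulDr lone_neq0.

Lemma lscaleAl a f g : a *: (f * g) = (a *: f) * g.
Proof. by rewrite [RHS](localZ (local_lmulr g)). Qed.

Lemma lscaleAr a f g : a *: (f * g) = f * (a *: g).
Proof. by rewrite [RHS](localZ (local_lmull f)). Qed.

HB.instance Definition _ := GRing.Lmodule_isLalgebra.Build R[i] lser lscaleAl.
HB.instance Definition _ := GRing.Lalgebra_isAlgebra.Build R[i] lser lscaleAr.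

Lemma lmonM p q : lmon p * lmon q = msign p q *: lmon (mmul p q).
Proof. exact: lmul_mon. Qed.

Lemma lone : 1 = lmon mon1. Proof. by []. Qed.

Lemma local_mull g : local ( *%R g). Proof. exact: local_lmull. Qed.
Lemma local_mulr g : local (fun f => f * g). Proof. exact: local_lmulr. Qed.

End Ring.

(** * Derivations *)

Definition shx (n : int) (p : mon) : mon := (ea p, ex p + n, ev p, od p).
Definition addphi (p : mon) : mon := (ea p, ex p, ev p, (None |` od p)%fset).
Definition rmphi (p : mon) : mon := (ea p, ex p, ev p, (od p `\ None)%fset).
Definition mphi : mon := (0, 0, mset0, [fset None]%fset).

Lemma mmul_shxl n p q : mmul (shx n p) q = shx n (mmul p q).
Proof. by rewrite /mmul /shx /ex /= addrAC. Qed.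

Lemma mmul_shxr n p q : mmul p (shx n q) = shx n (mmul p q).
Proof. by rewrite /mmul /shx /ex /= addrA. Qed.

Lemma shxK n m : shx n (shx (- n) m) = m.
Proof. by case: m => -[[a k] e] o; rewrite /shx /ex /= subrK. Qed.

Lemma rmphiK p : has_phi p -> mmul mphi (rmphi p) = p.
Proof.
case: p => -[[a k] e] o; rewrite /mmul /has_phi /ex /ea /ev /od /= => oN.
by rewrite !add0r mset0D fsetD1K.
Qed.

Lemma has_phi_rmphi p : has_phi (rmphi p) = false.
Proof. by rewrite /has_phi /rmphi /= !inE eqxx. Qed.

Lemma rmphi_mphi p : ~~ has_phi p -> rmphi (mmul mphi p) = p.
Proof.
case: p => -[[a k] e] o; rewrite /mmul /has_phi /rmphi /ex /ea /ev /od /= => oN.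
by rewrite !add0r mset0D fsetU1K.
Qed.

Lemma rmphi_id p : ~~ has_phi p -> rmphi p = p.
Proof.
case: p => -[[a k] e] o; rewrite /has_phi /rmphi /ex /ea /ev /od /= => oN.
by rewrite mem_fsetD1.
Qed.

Lemma addphiE p : addphi p = mmul mphi p.
Proof. by rewrite /addphi /mmul /= !add0r mset0D. Qed.

Lemma has_phi_mphi p : has_phi (mmul mphi p).
Proof. by rewrite phi_mmul /has_phi /= inE eqxx. Qed.

Lemma sew_addphi p : sew (addphi p) = sew p.
Proof.
rewrite /sew /= fsetDUl; congr (_, _).
by rewrite fsetDv fset0U.
Qed.

Lemma card_mphi p : ~~ has_phi p -> #|` od (mmul mphi p)| = (#|` od p|).+1.
Proof. by move=> pN; rewrite card_mmul ?cardfs1 // /oddisj fdisjoint1X. Qed.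

Section Ops.
Variable R : realType.
Local Notation lser := (lser R).
Local Notation msign := (@msign R).
Local Notation lmon := (@lmon R).
Implicit Types (f g h : lser) (p q m : mon).

Lemma msign_phi q : msign mphi q = (~~ has_phi q)%:R.
Proof.
have dq : oddisj mphi q = ~~ has_phi q by rewrite /oddisj fdisjoint1X.
have [qN|qN] := boolP (has_phi q); first by rewrite msignN ?dq ?qN.
by rewrite msignE ?dq // [od mphi]/= inversions_phil.
Qed.

Lemma msign_phil p q : ~~ has_phi p ->
  msign (mmul mphi p) q = (~~ has_phi q)%:R * msign p q.
Proof.
move=> pN; have := msignA R mphi p q.
rewrite !msign_phi pN mul1r phi_mmul (negbTE pN) /= => ->.
by rewrite mulrC.
Qed.

Lemma msign_phir p q : ~~ has_phi p -> ~~ has_phi q ->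
  msign p (mmul mphi q) = (-1) ^+ #|` od p| * msign p q.
Proof.
move=> pN qN; have := msignA R p mphi q.
rewrite [msign p mphi]msignC !msign_phi pN qN mul1r mulr1 [#|` od mphi|]cardfs1 muln1 => <-.
by rewrite mmulC msign_phil // qN mul1r.
Qed.

(** One format for d/dx, d/dphi, parity, projections, dilations and the inversion: move the
    coefficient along [ts] and multiply it by [tc]. Injectivity is asked only where [tc] is nonzero,
    as d/dphi requires: adding phi identifies a monomial without phi with its multiple by phi. *)
Record twist := Twist {
  tc : mon -> R[i];
  ts : mon -> mon;
  tsew : forall m, sew (ts m) = sew m;
  tinj : forall m k, tc m != 0 -> tc k != 0 -> ts m = ts k -> m = k }.

Lemma tw_laurent t f : laurent (fun m => tc t m * lval f (ts t m)).
Proof.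
move=> s; apply: (@sub_finite_set _ _
  ([set m | tc t m != 0] `&` ts t @^-1` [set m | lval f m != 0 /\ sew m = s])).
  move=> m [nz ms]; split; first by apply: contraNneq nz => ->; rewrite mul0r.
  split=> /=; last by rewrite tsew.
  by apply: contraNneq nz => ->; rewrite mulr0.
have fin := lvalK f s.
(* A left inverse of [ts t] where [tc t] is nonzero; it carries the finite support of f onto a set
   containing the new support. *)
have [g gP] : exists g : mon -> mon, forall m, tc t m != 0 -> g (ts t m) = m.
  pose g k := xget mon1 [set m | tc t m != 0 /\ ts t m = k].
  exists g => m cm; rewrite /g; case: xgetP => [k _ [ck e]|/(_ m)[]//].
  exact: tinj e.
apply: (@sub_finite_set _ _ (g @` [set m | lval f m != 0 /\ sew m = s])).
  by move=> m [cm fm]; exists (ts t m) => //; exact: gP.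
exact: finite_image.
Qed.

Definition tw t f : lser := mkl (@tw_laurent t f).

Lemma twE t f m : tw t f m = tc t m * f (ts t m). Proof. by []. Qed.

Lemma local_tw t : local (tw t).
Proof.
split=> [a f g|f m v]; last by rewrite twE v ?mulr0 // tsew sle_refl.
by apply: lserP => m; rewrite coefD coefZ !twE coefD coefZ; ring.
Qed.

Lemma tw_mon t p q (c : R[i]) : ts t q = p -> (forall m, tc t m != 0 -> ts t m = p -> m = q) ->
  tc t q = c -> tw t (lmon p) = c *: lmon q.
Proof.
move=> pq pu <-; apply: lserP => m; rewrite twE coefZ !lmonE.
have [-> | mq] := eqVneq m q; first by rewrite pq eqxx.
rewrite mulr0; case: (ts t m =P p) => [e|_]; last by rewrite mulr0.
case: (eqVneq (tc t m) 0) => [->|/pu/(_ e) E]; first by rewrite mul0r.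
by rewrite E eqxx in mq.
Qed.

Lemma tw_mon0 t p : (forall m, tc t m != 0 -> ts t m <> p) -> tw t (lmon p) = 0.
Proof.
move=> pu; apply: lserP => m; rewrite twE lmonE coef0.
case: (eqVneq (tc t m) 0) => [->|/pu e]; first by rewrite mul0r.
by case: eqP => //; rewrite mulr0.
Qed.

Lemma shx1_inj m k : shx 1 m = shx 1 k -> m = k.
Proof. by move=> /(congr1 (shx (- 1))); rewrite -{1 3}[1]opprK !shxK. Qed.

Definition dx := tw (@Twist (fun m => (ex m + 1)%:~R) (shx 1) (fun=> erefl)
  (fun m k _ _ => @shx1_inj m k)).

Lemma addphi_inj m k : (~~ has_phi m)%:R != 0 :> R[i] ->
  (~~ has_phi k)%:R != 0 :> R[i] -> addphi m = addphi k -> m = k.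
Proof.
rewrite !pnatr_eq0 !eqb0 !negbK => mN kN.
by rewrite !addphiE => /(congr1 rmphi); rewrite !rmphi_mphi.
Qed.

Definition dphi := tw (@Twist (fun m => (~~ has_phi m)%:R) addphi sew_addphi addphi_inj).

Definition diag (c : mon -> R[i]) : twist :=
  @Twist c id (fun _ => erefl) (fun _ _ _ _ e => e).

(** The parity involution. It carries the signs of the super Leibniz rules, and even and odd series
    are its eigenspaces. *)
Definition tau := tw (diag (fun m => (-1) ^+ #|` od m|)).

Lemma diag_mon c p : tw (diag c) (lmon p) = c p *: lmon p.
Proof. by apply: tw_mon. Qed.

Lemma tauE f m : tau f m = (-1) ^+ #|` od m| * f m. Proof. by []. Qed.
Lemma tau_mon p : tau (lmon p) = (-1) ^+ #|` od p| *: lmon p.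
Proof. exact: diag_mon. Qed.

Lemma dx_mon p : dx (lmon p) = (ex p)%:~R *: lmon (shx (-1) p).
Proof.
apply: tw_mon => /=; first exact: shxK.
  by move=> m _ <-; rewrite -{2}[1]opprK shxK.
by rewrite /ex /= subrK.
Qed.

Lemma dphi_mon p : dphi (lmon p) = (has_phi p)%:R *: lmon (rmphi p).
Proof.
have [pN|pN] := boolP (has_phi p).
  apply: tw_mon; rewrite /= ?has_phi_rmphi // ?addphiE ?rmphiK //.
  move=> m nz; rewrite addphiE => <-; rewrite rmphi_mphi //.
  by move: nz; case: has_phi => //; rewrite eqxx.
rewrite scale0r; apply: tw_mon0 => m _ /= E.
by move: pN; rewrite -E addphiE has_phi_mphi.
Qed.

Lemma local_dx : local dx. Proof. exact: local_tw. Qed.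
Lemma local_dphi : local dphi. Proof. exact: local_tw. Qed.
Lemma local_tau : local tau. Proof. exact: local_tw. Qed.

Lemma local_mullE g F : local F -> local (fun f => g * F f).
Proof. exact: local_comp (local_mull g). Qed.
Lemma local_mulrE g F : local F -> local (fun f => F f * g).
Proof. exact: local_comp (local_mulr g). Qed.
Lemma local_dxE F : local F -> local (fun f => dx (F f)).
Proof. exact: local_comp local_dx. Qed.
Lemma local_dphiE F : local F -> local (fun f => dphi (F f)).
Proof. exact: local_comp local_dphi. Qed.
Lemma local_tauE F : local F -> local (fun f => tau (F f)).
Proof. exact: local_comp local_tau. Qed.
Lemma local_twE t F : local F -> local (fun f => tw t (F f)).
Proof. exact: local_comp (local_tw t). Qed.

End Ops.

Arguments local_dx {R}.
Arguments local_dphi {R}.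
Arguments local_tau {R}.

Ltac loc := cbv beta; lazymatch goal with
  | |- local (fun f => f) => exact: local_id
  | |- local (fun f => @?F f + @?G f) => apply: (@local_add _ F G); loc
  | |- local (fun f => - @?F f) => apply: (@local_opp _ F); loc
  | |- local (fun f => ?a *: @?F f) => apply: (@local_scale _ a F); loc
  | |- local (fun f => dx (@?F f)) => apply: (@local_dxE _ F); loc
  | |- local (fun f => dphi (@?F f)) => apply: (@local_dphiE _ F); loc
  | |- local (fun f => tau (@?F f)) => apply: (@local_tauE _ F); loc
  | |- local (fun f => tw ?t (@?F f)) => apply: (@local_twE _ t F); loc
  | |- local (fun f => @?G f * @?F f) => lazymatch G with
    | (fun _ => ?g) => apply: (@local_mullE _ g F); loc
    | _ => lazymatch F with (fun _ => ?g) => apply: (@local_mulrE _ g G); loc end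
    end
  | |- _ => idtac
  end.

(** * Leibniz rules and supercommutativity *)

Section Leibniz.
Variable R : realType.
Local Notation lser := (lser R).
Local Notation lmon := (@lmon R).
Implicit Types (f g h : lser) (p q m : mon).

Lemma local_ext2 (F G : lser -> lser -> lser) :
  (forall f, local (F f)) -> (forall f, local (G f)) ->
  (forall g, local (F^~ g)) -> (forall g, local (G^~ g)) ->
  (forall p q, F (lmon p) (lmon q) = G (lmon p) (lmon q)) ->
  forall f g, F f g = G f g.
Proof.
move=> F1 G1 F2 G2 FG f g; apply: (local_ext (F2 g) (G2 g)) => p /=.
by apply: local_ext => // q; rewrite FG.
Qed.

Lemma dxM f g : dx (f * g) = dx f * g + f * dx g.
Proof.
apply: (local_ext2 (F := fun f g => dx (f * g)) (G := fun f g => dx f * g + f * dx g));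
  try by move=> ?; loc.
move=> p q; rewrite lmonM (localZ local_dx) !dx_mon -scalerAl -scalerAr !lmonM.
rewrite mmul_shxl mmul_shxr !scalerA -scalerDl; congr (_ *: _).
by rewrite [ex (mmul _ _)]/(ex p + ex q) intrD mulrC mulrDl.
Qed.

Lemma rmphi_mmul p q : rmphi (mmul p q) = mmul (rmphi p) (rmphi q).
Proof. by rewrite /mmul /rmphi /= fsetDUl. Qed.

Lemma dphiM f g : dphi (f * g) = dphi f * g + tau f * dphi g.
Proof.
apply: (local_ext2 (F := fun f g => dphi (f * g)) (G := fun f g => dphi f * g + tau f * dphi g));
  try by move=> ?; loc.
move=> p q; rewrite lmonM (localZ local_dphi) !dphi_mon tau_mon -!scalerAl -!scalerAr.
rewrite !lmonM phi_mmul rmphi_mmul.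
have [pN|pN] := boolP (has_phi p); have [qN|qN] := boolP (has_phi q); rewrite /=
  ?scale0r ?scaler0 ?add0r ?addr0 ?scale1r //; last first.
- rewrite (rmphi_id pN) !scalerA; congr (_ *: _).
  rewrite -{1}(rmphiK qN) msign_phir ?has_phi_rmphi //.
- rewrite (rmphi_id qN); congr (_ *: _).
  by rewrite -{1}(rmphiK pN) msign_phil ?has_phi_rmphi // qN mul1r.
(* When both factors contain phi their product vanishes, and the two terms on the right cancel
   through the sign that [tau] puts on the second. *)
have := rmphiK qN; have := rmphiK pN; move: {pN qN}(rmphi p) (rmphi q) (has_phi_rmphi p) (has_phi_rmphi q).
move=> p' q' /negbT pN /negbT qN <- <-.
rewrite !msign_phil // has_phi_mphi mul0r scale0r qN mul1r msign_phir //.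
rewrite card_mphi // exprS scalerA mulN1r mulNr scaleNr.
by rewrite !mmulA [mmul p' mphi]mmulC subrr.
Qed.

Lemma tauM f g : tau (f * g) = tau f * tau g.
Proof.
apply: (local_ext2 (F := fun f g => tau (f * g)) (G := fun f g => tau f * tau g));
  try by move=> ?; loc.
move=> p q; rewrite lmonM (localZ local_tau) !tau_mon -!scalerAl -!scalerAr lmonM.
rewrite !scalerA; have [d|d] := boolP (oddisj p q); last by rewrite msignN // mulr0 mul0r.
by rewrite card_mmul // exprD mulrC.
Qed.

Lemma tauK : involutive (@tau R).
Proof. by move=> f; apply: lserP => m; rewrite !tauE mulrA -expr2 sqrr_sign mul1r. Qed.

Lemma dx_tau f : dx (tau f) = tau (dx f).
Proof. by apply: lserP => m; rewrite !(tauE, twE) /=; ring. Qed.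

Lemma dphi_tau f : dphi (tau f) = - tau (dphi f).
Proof.
apply: lserP => m; rewrite coefN !(tauE, twE) /=.
have [mN|mN] := boolP (has_phi m); first by rewrite !mul0r mulr0 oppr0.
by rewrite addphiE card_mphi // exprS !mul1r mulN1r mulNr.
Qed.

Lemma dx_dphi f : dx (dphi f) = dphi (dx f).
Proof. by apply: lserP => m; rewrite !twE /=; ring. Qed.

Lemma dphi_dphi f : dphi (dphi f) = 0.
Proof.
apply: lserP => m; rewrite !twE /= addphiE has_phi_mphi /=; ring.
Qed.

Lemma double_inj (f g : lser) : f + f = g + g -> f = g.
Proof.
move=> fg; apply: lserP => m; have := congr1 (fun h : lser => h m) fg.
by rewrite !coefD -!mulr2n => /eqP; rewrite eqrMn2r => /eqP.
Qed.

(** Twice the even part and twice the odd part of an arbitrary g are g + tau g and g - tau g. In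
    this form both rules are bilinear in g and f, hence can be checked on monomials. *)
Lemma even_odd_comm g f :
  ((g + tau g) * f = f * (g + tau g)) * ((g - tau g) * f = tau f * (g - tau g)).
Proof.
split; [apply: (local_ext2 (F := fun g f => (g + tau g) * f) (G := fun g f => f * (g + tau g)))
       |apply: (local_ext2 (F := fun g f => (g - tau g) * f) (G := fun g f => tau f * (g - tau g)))];
  try (by move=> ?; loc); move=> p q; rewrite !tau_mon !(mulrDl, mulrDr, mulrN, mulNr);
  rewrite -!scalerAl -!scalerAr !lmonM (msignC _ p q) mmulC;
  rewrite exprM -!(signr_odd _ #|` od p|); case: (odd _);
  rewrite /= ?(expr0, expr1, expr1n, scaleN1r, mul1r, scale1r, subrr, addrN) //.
by rewrite scalerN scalerA.
Qed.

Definition even f := tau f = f.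
Definition odds f := tau f = - f.

Lemma even_comm g f : even g -> g * f = f * g.
Proof.
move=> ge; have := (even_odd_comm g f).1; rewrite ge mulrDl mulrDr.
exact: double_inj.
Qed.

Lemma odd_comm g f : odds g -> g * f = tau f * g.
Proof.
move=> ge; have := (even_odd_comm g f).2; rewrite ge opprK mulrDl mulrDr.
exact: double_inj.
Qed.

End Leibniz.

(** * Superconformal vector fields *)

Section VectorFields.
Variable R : realType.
Local Notation lser := (lser R).
Local Notation lmon := (@lmon R).
Implicit Types (f g h u v : lser) (p q m : mon).

Definition lphi : lser := lmon mphi.

Lemma phiphi : lphi * lphi = 0.
Proof. by rewrite lmonM msign_phi /has_phi /= inE eqxx scale0r. Qed.

Lemma odd_phi : odds lphi.
Proof. by rewrite /odds /lphi tau_mon cardfs1 expr1 scaleN1r. Qed.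

Lemma dphi_phi : dphi lphi = 1.
Proof.
rewrite /lphi dphi_mon /has_phi /= inE eqxx scale1r; congr lmon.
by rewrite /rmphi /= fsetDv.
Qed.

Lemma dx_phi : dx lphi = 0.
Proof. by rewrite /lphi dx_mon scale0r. Qed.

Lemma phiC f : lphi * f = tau f * lphi.
Proof. exact: odd_comm odd_phi. Qed.

Lemma tau_phi : tau lphi = - lphi. Proof. exact: odd_phi. Qed.

Lemma dxD : {morph @dx R : f g / f + g}. Proof. exact: localD (@local_dx R). Qed.
Lemma dxN : {morph @dx R : f / - f}. Proof. exact: localN (@local_dx R). Qed.
Lemma dphiD : {morph @dphi R : f g / f + g}. Proof. exact: localD (@local_dphi R). Qed.
Lemma dphiN : {morph @dphi R : f / - f}. Proof. exact: localN (@local_dphi R). Qed.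
Lemma dphiZ a f : dphi (a *: f) = a *: dphi f. Proof. exact: localZ (@local_dphi R) _ _. Qed.
Lemma tauD : {morph @tau R : f g / f + g}. Proof. exact: localD (@local_tau R). Qed.
Lemma tauN : {morph @tau R : f / - f}. Proof. exact: localN (@local_tau R). Qed.
Lemma tauZ a f : tau (a *: f) = a *: tau f. Proof. exact: localZ (@local_tau R) _ _. Qed.
Lemma dx0 : dx (0 : lser) = 0. Proof. exact: local0 (@local_dx R). Qed.
Lemma dphi0 : dphi (0 : lser) = 0. Proof. exact: local0 (@local_dphi R). Qed.

(* [vT g h] is sum_j (A_j L_j + M_{j-1/2} G_{j-1/2}) for g = g_A and h = g_M, and the
   corresponding sum in B, N for g = g_B and h = g_N.  [vD] is the superderivation D of
   the header, and [vU] is what [vT] becomes when [vD] is moved past it ([vD_vT]). *)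
Definition vQ f := dphi f - lphi * dx f.
Definition vD f := dphi f + lphi * dx f.
Definition vT g h f := - (g * dx f + 2^-1 *: (lphi * dx g * dphi f) + h * vQ f).
Definition lam g h := - (2^-1 *: dx g + lphi * dx h).
Definition vU g h f := vT g h f + lam g h * f.

Lemma local_vQ : local vQ. Proof. rewrite /vQ; loc. Qed.
Lemma local_vD : local vD. Proof. rewrite /vD; loc. Qed.
Lemma local_vT g h : local (vT g h). Proof. rewrite /vT /vQ; loc. Qed.
Lemma local_vU g h : local (vU g h). Proof. rewrite /vU /vT /vQ; loc. Qed.

Lemma vQM f g : vQ (f * g) = vQ f * g + tau f * vQ g.
Proof.
rewrite /vQ dphiM dxM mulrDr mulrDl mulrBr mulrA [lphi * (f * _)]mulrA (phiC f).
by rewrite mulNr opprD addrACA mulrA.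
Qed.

(** The field is an even derivation: in h Q the sign from moving the odd Q past u is undone by
    moving the odd h past it, and similarly for phi g' d/dphi. *)
Lemma vTM g h u v : even g -> odds h -> vT g h (u * v) = vT g h u * v + u * vT g h v.
Proof.
move=> ge ho; rewrite /vT vQM dxM dphiM (mulrDr g) (mulrDr (lphi * dx g)) (mulrDr h).
have E1 : g * (u * dx v) = u * (g * dx v) by rewrite !mulrA (even_comm _ ge).
have E3 : h * (tau u * vQ v) = u * (h * vQ v) by rewrite !mulrA (odd_comm _ ho) tauK.
have dgE : even (dx g) by rewrite /even -dx_tau ge.
have E2 : lphi * dx g * (tau u * dphi v) = u * (lphi * dx g * dphi v).
  rewrite -!mulrA [dx g * _]mulrA (even_comm _ dgE) 2!mulrA phiC tauK.
  by rewrite !mulrA.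
rewrite E1 E2 E3 mulNr mulrN -opprD; congr (- _).
move: (vQ u) (vQ v) => qu qv; rewrite !mulrDl -!scalerAl !mulrDr -!scalerAr -!mulrA.
by rewrite [RHS]addrACA [in RHS](addrACA (_ * _)) scalerDr.
Qed.

Lemma dphi_phiM f : dphi (lphi * f) = f - lphi * dphi f.
Proof. by rewrite dphiM dphi_phi mul1r tau_phi mulNr. Qed.

Lemma dx_phiM f : dx (lphi * f) = lphi * dx f.
Proof. by rewrite dxM dx_phi mul0r add0r. Qed.

Lemma phiphiM f : lphi * (lphi * f) = 0.
Proof. by rewrite mulrA phiphi mul0r. Qed.

Lemma vD_vQ f : vD (vQ f) = - vQ (vD f).
Proof.
rewrite /vD /vQ !(dxD, dxN, dphiD, dphiN) !dphi_dphi !dphi_phiM !dx_phiM.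
by rewrite !mulrDr !mulrN !phiphiM !dx_dphi oppr0 !add0r !addr0 !opprD !opprK.
Qed.

Lemma dx_vD f : dx (vD f) = vD (dx f).
Proof. by rewrite /vD dxD dxM dx_phi mul0r add0r dx_dphi. Qed.

Definition pfree f := dphi f = 0.

Lemma vDM f g : vD (f * g) = vD f * g + tau f * vD g.
Proof.
rewrite /vD dphiM dxM !mulrDr mulrDl !mulrA (phiC f).
by rewrite addrACA.
Qed.

(** D anticommutes with Q and commutes with d/dx, so only derivatives of the coefficients survive;
    the factor 1/2 in front of phi g' d/dphi is what makes them combine into a multiple of D f. *)
Lemma vD_vT g h f : even g -> pfree g -> odds h -> pfree h ->
  vD (vT g h f) = vU g h (vD f).
Proof.
move=> ge gp ho hp; have dgE : even (dx g) by rewrite /even -dx_tau ge.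
have dgp : dphi (dx g) = 0 by rewrite -dx_dphi gp dx0.
have dhO : odds (dx h) by rewrite /odds -dx_tau ho dxN.
have dD k : vD (g * k) = lphi * dx g * k + g * vD k.
  by rewrite vDM {1}/vD gp add0r ge.
have hD k : vD (h * k) = lphi * dx h * k - h * vD k.
  by rewrite vDM {1}/vD hp add0r ho mulNr.
have pD : vD (lphi * dx g * dphi f) = dx g * dphi f - lphi * dx g * vD (dphi f).
  have E : vD (lphi * dx g) = dx g.
    by rewrite /vD dphi_phiM dx_phiM phiphiM dgp mulr0 addr0 subr0.
  by rewrite vDM E tauM tau_phi dgE !mulNr.
have phid k : lphi * dx g * (lphi * k) = 0.
  by rewrite mulrA -(mulrA lphi) (even_comm _ dgE) mulrA phiphi !mul0r.
rewrite /vU /vT (localN local_vD) !(localD local_vD) (localZ local_vD).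
rewrite dD hD pD dx_vD vD_vQ /lam.
have -> : dphi (vD f) = dx f - lphi * dphi (dx f).
  by rewrite /vD dphiD dphi_dphi dphiM dphi_phi tau_phi mul1r mulNr add0r.
rewrite (mulrBr (lphi * dx g)) phid subr0.
have -> : lphi * dx g * vD (dphi f) = 0.
  by rewrite /vD dphi_dphi add0r phid.
have -> : lphi * dx h * vQ f = lphi * dx h * dphi f.
  rewrite /vQ mulrBr !mulrA -(mulrA lphi (dx h) lphi) (odd_comm lphi dhO) tau_phi mulNr.
  by rewrite mulrN mulrA phiphi !mul0r oppr0 mul0r subr0.
have -> : - (2^-1 *: dx g + lphi * dx h) * vD f =
    - (2^-1 *: (dx g * dphi f) + 2^-1 *: (lphi * dx g * dx f) + lphi * dx h * dphi f).
  rewrite mulNr mulrDl -scalerAl -scalerDr; congr (- (_ *: _ + _)).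
    by rewrite /vD mulrDr mulrA (even_comm lphi dgE).
  rewrite /vD mulrDr mulrA -(mulrA lphi (dx h) lphi) (odd_comm lphi dhO) tau_phi.
  by rewrite mulNr mulrN mulrA phiphi !mul0r oppr0 mul0r addr0.
rewrite subr0 mulrN opprK.
move: (lphi * dx g * dx f) (g * vD (dx f)) (dx g * dphi f) (lphi * dx h * dphi f) (h * vQ (vD f)).
move=> X Y Z W V; apply: lserP => m.
by rewrite !(coefD, coefN, coefZ); field; rewrite ?pnatr_eq0.
Qed.

Lemma lam_even g h : even g -> odds h -> even (lam g h).
Proof.
by move=> ge ho; rewrite /even /lam tauN tauD tauZ tauM tau_phi -!dx_tau ge ho dxN mulrNN.
Qed.

Lemma vUM g h u v : even g -> odds h -> vU g h (u * v) = vT g h u * v + u * vU g h v.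
Proof.
move=> ge ho; rewrite /vU vTM // mulrA (even_comm u (lam_even ge ho)).
by rewrite mulrDr mulrA addrA.
Qed.

Lemma tau_vT g h u : even g -> odds h -> tau (vT g h u) = vT g h (tau u).
Proof.
move=> ge ho; rewrite /vT tauN !tauD tauZ !tauM tau_phi -!dx_tau ge ho.
rewrite /vQ tauD tauN tauM tau_phi -dx_tau dphi_tau; congr (- (_ + _ *: _ + _)).
  by rewrite !mulNr mulrN.
by rewrite mulNr -mulrN opprD mulNr !opprK.
Qed.

End VectorFields.

(** * Exponentials of operators raising the sewing degree *)

Definition sewdeg (s : {mset egen}%mset * {fset ogen}) : nat :=
  (count isA s.1 + count isM s.2 + (count isB s.1 + count isN s.2))%N.

Lemma count_rmphi (a : pred ogen) (o : {fset ogen}) : ~~ a None ->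
  count a (o `\ None)%fset = count a o.
Proof.
move=> aN; have [oN|oN] := boolP (None \in o); last by rewrite mem_fsetD1.
rewrite -{2}(fsetD1K oN) (permP (perm_fsetU _)) ?count_cat.
  by rewrite -[count a [fset None]%fset]sum1_count big_mkcond big_seq_fset1 (negbTE aN).
by rewrite fdisjoint1X !inE eqxx.
Qed.

Lemma sdegE m : sdeg m = sewdeg (sew m).
Proof. by rewrite /sdeg /degAM /degBN /sewdeg /= !count_rmphi. Qed.

Lemma leq_count_mset (a : pred egen) (A B : {mset egen}%mset) :
  (A `<=` B)%mset -> (count a A <= count a B)%N.
Proof.
by move=> /msetBDKC <-; rewrite (permP (perm_msetD _ _)) count_cat leq_addr.
Qed.

Lemma leq_count_fset (a : pred ogen) (A B : {fset ogen}) :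
  (A `<=` B)%fset -> (count a A <= count a B)%N.
Proof.
move=> AB; rewrite -(fsetID A B) (fsetIidPr AB) (permP (perm_fsetU _)) ?count_cat ?leq_addr //.
by apply/fdisjointP => x xA; rewrite !inE xA.
Qed.

Lemma sewdeg_le s t : sle s t -> (sewdeg s <= sewdeg t)%N.
Proof.
by move=> /andP[s1 s2]; rewrite /sewdeg !leq_add // ?leq_count_mset ?leq_count_fset.
Qed.

Lemma sdeg_sle p q : sle (sew p) (sew q) -> (sdeg p <= sdeg q)%N.
Proof. by rewrite !sdegE; exact: sewdeg_le. Qed.

Section Supp.
Variable R : realType.
Local Notation lser := (lser R).
Implicit Types (f g h : lser) (p q m : mon) (A B C : mon -> Prop)
  (F T U V W : lser -> lser).

Definition supp A f := forall m, f m != 0 -> A m.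

Lemma suppP A f m : supp A f -> ~ A m -> f m = 0.
Proof. by move=> fA nA; apply/eqP; apply: contrapT => /negP /fA. Qed.

Lemma sub_supp A B f : (forall m, A m -> B m) -> supp A f -> supp B f.
Proof. by move=> AB fA m /fA/AB. Qed.

Lemma supp0 A : supp A 0.
Proof. by move=> m; rewrite coef0 eqxx. Qed.

Lemma suppD A f g : supp A f -> supp A g -> supp A (f + g).
Proof.
move=> fA gA m; rewrite coefD; case: (eqVneq (f m) 0) => [->|/fA//].
by rewrite add0r => /gA.
Qed.

Lemma suppN A f : supp A f -> supp A (- f).
Proof. by move=> fA m; rewrite coefN oppr_eq0 => /fA. Qed.

Lemma suppB A f g : supp A f -> supp A g -> supp A (f - g).
Proof. by move=> fA gA; apply: suppD => //; exact: suppN. Qed.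

Lemma suppZ A a f : supp A f -> supp A (a *: f).
Proof. by move=> fA m; rewrite coefZ mulf_eq0 negb_or => /andP[_ /fA]. Qed.

Lemma suppM A B C f g : supp A f -> supp B g ->
  (forall p q, oddisj p q -> A p -> B q -> C (mmul p q)) -> supp C (f * g).
Proof.
move=> fA gB ABC m nz; apply: contrapT => nC; move/negP: nz; apply; apply/eqP.
rewrite [LHS](lmulE (@covers_below _ f m) (@covers_below _ g m)).
rewrite big1 // => p _; rewrite big1 // => q _; case: (mmul p q =P m) => // e.
have [d|d] := boolP (oddisj p q); last by rewrite msignN ?mul0r.
have [->|/fA Ap] := eqVneq (f p) 0; first by rewrite mulr0 mul0r.
have [->|/gB Bq] := eqVneq (g q) 0; first by rewrite mulr0.
by case: nC; rewrite -e; exact: ABC.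
Qed.

Lemma supp_tw A B t f : supp A f -> (forall m, tc t m != 0 -> A (ts t m) -> B m) ->
  supp B (tw t f).
Proof.
move=> fA AB m; rewrite twE mulf_eq0 negb_or => /andP[nz /fA]; exact: AB.
Qed.

Definition ordge d := supp (fun m => d <= sdeg m)%N.

Lemma ordge0 f : ordge 0 f. Proof. by move=> m. Qed.

Definition eqdeg n f g := forall m, (sdeg m < n)%N -> f m = g m.

Lemma eqdeg_ordge n f g : eqdeg n f g <-> ordge n (f - g).
Proof.
split=> [fg m|fg m mn].
  by rewrite coefB subr_eq0 leqNgt => nz; apply/negP => /fg/eqP; apply/negP.
apply/eqP; rewrite -subr_eq0 -coefB; apply/eqP/(suppP fg).
by rewrite leqNgt mn.
Qed.

Lemma eqdeg_local n F f g : local F -> eqdeg n f g -> eqdeg n (F f) (F g).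
Proof.
move=> lF fg m mn; apply: local_eq_le => // p pm; apply: fg.
exact: leq_ltn_trans (sdeg_sle pm) mn.
Qed.

Lemma ordge_local n F f : local F -> ordge n f -> ordge n (F f).
Proof.
move=> lF fn; rewrite -[F f]subr0; apply/eqdeg_ordge.
rewrite -(local0 lF); apply: eqdeg_local => //.
by apply/eqdeg_ordge; rewrite subr0.
Qed.

Lemma ordgeM a b f g : ordge a f -> ordge b g -> ordge (a + b) (f * g).
Proof.
by move=> fa gb; apply: (suppM fa gb) => p q d pa qb; rewrite sdeg_mmul // leq_add.
Qed.

Lemma ordge_eq0 f : (forall d, ordge d f -> ordge d.+1 f) -> f = 0.
Proof.
move=> fS; have fd d : ordge d f by elim: d => [|d /fS//]; exact: ordge0.
apply: lserP => m; rewrite coef0; apply: (suppP (fd (sdeg m).+1)).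
by rewrite ltnn.
Qed.

Definition raises (T : lser -> lser) := forall d f, ordge d f -> ordge d.+1 (T f).

Lemma ordge_iter T k d f : raises T -> ordge d f -> ordge (k + d) (iter k T f).
Proof. by move=> rT fd; elim: k => [|k IH] //=; exact: rT. Qed.

Lemma dlim_laurent (u : nat -> lser) : laurent (fun m => lval (u (sdeg m)) m).
Proof.
move=> s; apply: sub_finite_set (lvalK (u (sewdeg s)) s) => m [nz ms].
by split=> //; rewrite -ms -sdegE.
Qed.

(** The coefficient at m is read off from the term of index [sdeg m]; this is the limit as soon as
    each term u n is already final in sewing degrees up to n. *)
Definition dlim (u : nat -> lser) : lser := mkl (@dlim_laurent u).

Lemma dlimE u m : dlim u m = u (sdeg m) m. Proof. by []. Qed.

(** In sewing degree n the series is cut after the n-th power, which loses nothing when T raises the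
    degree: higher powers vanish there. *)
Definition lexp T f := dlim (fun n => \sum_(k < n.+1) (k`!%:R)^-1 *: iter k T f).

Lemma local_iter T k : local T -> local (iter k T).
Proof.
move=> lT; elim: k => [|k IH]; first exact: local_id.
exact: local_comp lT IH.
Qed.

Section Exp.
Variables (T : lser -> lser).
Hypotheses (lT : local T) (rT : raises T).

Lemma iter_vanish k f m : (sdeg m < k)%N -> iter k T f m = 0.
Proof.
move=> mk; have := @ordge_iter T k 0 f rT (@ordge0 f); rewrite addn0 => /suppP; apply.
by rewrite leqNgt mk.
Qed.

Lemma lexpE N f m : (sdeg m < N)%N ->
  lexp T f m = \sum_(k < N) (k`!%:R)^-1 * iter k T f m.
Proof.
move=> mN; rewrite dlimE coef_sum.
rewrite (big_ord_widen _ (fun k => ((k`!%:R)^-1 *: iter k T f) m) mN).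
rewrite big_mkcond; apply: eq_bigr => k _; case: ifP => [_|]; first by rewrite coefZ.
by rewrite ltnS leqNgt => /negbFE mk; rewrite iter_vanish ?mulr0.
Qed.

Lemma lexp_eqdeg N f : eqdeg N (lexp T f) (\sum_(k < N) (k`!%:R)^-1 *: iter k T f).
Proof.
by move=> m mN; rewrite (lexpE f mN) coef_sum; apply: eq_bigr => k _; rewrite coefZ.
Qed.

Lemma local_lexp : local (lexp T).
Proof.
split=> [a f g|f m v]; last first.
  rewrite (lexpE _ (ltnSn _)) big1 // => k _.
  by rewrite (local_iter k lT).2 ?mulr0.
apply: lserP => m; rewrite coefD coefZ !(lexpE _ (ltnSn (sdeg m))).
rewrite big_distrr -big_split /=; apply: eq_bigr => k _.
by rewrite (local_iter k lT).1 coefD coefZ; ring.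
Qed.

Lemma lexp_lead d f : ordge d f -> ordge d.+1 (lexp T f - f).
Proof.
move=> fd m; rewrite coefB (lexpE _ (ltnSn _)) big_ord_recl /= fact0 invr1 mul1r.
rewrite addrC addKr => nz; rewrite ltnNge; apply/negP => md; move/negP: nz; apply.
apply/eqP; rewrite big1 // => k _; rewrite [coef _ _](_ : _ = 0) ?mulr0 //.
apply: (suppP (@ordge_iter T (bump 0 k) _ _ rT fd)); apply/negP.
by rewrite -ltnNge /bump /= add1n ltnS (leq_trans md) ?leq_addl.
Qed.

Lemma lexp_supp A f : (forall k, supp A (iter k T f)) -> supp A (lexp T f).
Proof.
move=> fA m nz; apply: contrapT => nA; move/negP: nz; apply; apply/eqP.
rewrite (lexpE _ (ltnSn _)) big1 // => k _.
by rewrite (suppP (fA k) nA) mulr0.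
Qed.

Lemma lexp_fix f : T f = 0 -> lexp T f = f.
Proof.
move=> Tf; apply: lserP => m; rewrite (lexpE _ (ltnSn _)) big_ord_recl.
rewrite fact0 invr1 mul1r big1 ?addr0 // => k _.
by rewrite lift0 iterSr Tf (local0 (local_iter k lT)) coef0 mulr0.
Qed.

End Exp.

(** The relation P T = U P passes to powers, and locality of P lets it pass to the limit. It is used
    with P the superderivation, parity and the projections to a fixed degree. *)
Lemma lexp_intertwine T U (P : lser -> lser) : local T -> raises T -> raises U -> local P ->
  (forall f, P (T f) = U (P f)) -> forall f, P (lexp T f) = lexp U (P f).
Proof.
move=> lT rT rU lP PT f; apply: lserP => m.
rewrite (eqdeg_local lP (@lexp_eqdeg _ rT (sdeg m).+1 f)) //.
rewrite (lexpE rU _ (ltnSn _)) (local_sum lP) coef_sum; apply: eq_bigr => k _.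
rewrite (localZ lP) coefZ; congr (_ * coef _ _).
by elim: (k : nat) => //= n <-; rewrite PT.
Qed.

(** Reindexing for Cauchy products: the part of the N by N square beyond the antidiagonal
    contributes zero. *)
Lemma big_triangle (V : nmodType) (F : nat -> nat -> V) N :
  (forall i j, (N <= i + j)%N -> F i j = 0) ->
  \sum_(n < N) \sum_(i < n.+1) F i (n - i)%N = \sum_(i < N) \sum_(j < N) F i j.
Proof.
move=> F0; rewrite -(big_mkord xpredT (fun n => \sum_(i < n.+1) F i (n - i)%N)).
transitivity (\sum_(0 <= n < N) \sum_(0 <= i < N | (i <= n)%N) F i (n - i)%N).
  apply: eq_big_nat => n /andP[_ nN].
  rewrite -(big_mkord xpredT (fun i => F i (n - i)%N)) (big_nat_widen _ _ _ _ _ nN).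
  by apply: eq_bigl => i; rewrite ltnS.
rewrite (exchange_big_dep_nat xpredT) //= big_mkord; apply: eq_bigr => i _.
rewrite -(big_mkord xpredT (F i)) [RHS](@big_cat_nat _ _ _ (N - i)) ?leq_subr //=.
rewrite [X in _ + X]big_nat_cond [X in _ + X]big1 ?addr0; last first.
  by move=> j /andP[/andP[ij _] _]; apply: F0; lia.
rewrite (@big_cat_nat _ _ _ i) ?(ltnW (ltn_ord i)) //=.
rewrite big_nat_cond big1 ?add0r; last by move=> n /andP[/andP[_ ni]]; lia.
rewrite -{1}[nat_of_ord i]add0n big_addn big_nat_cond [RHS]big_nat_cond.
apply: eq_big => [j|j _]; last by rewrite addnK.
by rewrite leq_addl !andbT.
Qed.

Lemma leibniz_iter (U V W : lser -> lser) : local U ->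
  (forall f g, U (f * g) = V f * g + f * W g) ->
  forall n f g, iter n U (f * g) =
    \sum_(i < n.+1) 'C(n, i)%:R *: (iter i V f * iter (n - i) W g).
Proof.
move=> lU UM n f g; elim: n => [|n IH].
  by rewrite big_ord1 /= bin0 scale1r.
rewrite iterS IH (local_sum lU).
under eq_bigr => i _ do rewrite (localZ lU) UM -!iterS scalerDr.
rewrite big_split /= [RHS]big_ord_recl /= bin0.
under [X in _ = _ + X]eq_bigr => i _ do
  rewrite /bump /= add1n binS natrD scalerDl subSS.
rewrite big_split /= addrA addrC [X in _ = X + _]addrC; congr (_ + _).
rewrite [LHS]big_ord_recl /= bin0 subn0 [RHS]addrC; congr (_ + _).
rewrite [RHS]big_ord_recr /= bin_small // scale0r addr0.
by apply: eq_bigr => i _; rewrite /bump /= add1n -(subnSK (ltn_ord i)).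
Qed.

(** With U = V = W a derivation this is the multiplicativity of its exponential; with U = W the
    twisted field and V the plain one it is half of the rule E'(f g) = E(f) E'(g). *)
Lemma lexpM (U V W : lser -> lser) : local U -> local V -> local W ->
  raises U -> raises V -> raises W ->
  (forall f g, U (f * g) = V f * g + f * W g) ->
  forall f g, lexp U (f * g) = lexp V f * lexp W g.
Proof.
move=> lU lV lW rU rV rW UM f g; apply: lserP => m; pose N := (sdeg m).+1.
rewrite (lexpE rU (N := N)) //.
have -> : (lexp V f * lexp W g) m =
   ((\sum_(k < N) (k`!%:R)^-1 *: iter k V f) * (\sum_(k < N) (k`!%:R)^-1 *: iter k W g)) m.
  rewrite (eqdeg_local (local_mulr _) (@lexp_eqdeg _ rV N f)) //.
  by rewrite (eqdeg_local (local_mull _) (@lexp_eqdeg _ rW N g)).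
rewrite mulr_suml coef_sum.
under eq_bigr => k _ do rewrite (leibniz_iter lU UM) coef_sum big_distrr /=.
under [RHS]eq_bigr => k _ do rewrite mulr_sumr coef_sum.
pose F i j := (i`!%:R)^-1 * (j`!%:R)^-1 * (iter i V f * iter j W g) m.
transitivity (\sum_(n < N) \sum_(i < n.+1) F i (n - i)%N).
  apply: eq_bigr => n _; apply: eq_bigr => i _; rewrite coefZ /F mulrA; congr (_ * _).
  have /(congr1 (fun k : nat => k%:R : R[i])) := bin_fact (ltnSE (ltn_ord i)).
  rewrite !natrM => <-.
  have n0 k : (k`!%:R : R[i]) != 0 by rewrite pnatr_eq0 -lt0n fact_gt0.
  have c0 : ('C(n, i)%:R : R[i]) != 0 by rewrite pnatr_eq0 -lt0n bin_gt0 -ltnS ltn_ord.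
  by field; rewrite ?n0 ?c0.
rewrite big_triangle; last first.
  move=> i j Nij; rewrite /F [coef _ _](_ : _ = 0) ?mulr0 //.
  have := ordgeM (@ordge_iter V i 0 f rV (@ordge0 f)) (@ordge_iter W j 0 g rW (@ordge0 g)).
  by rewrite !addn0 => /suppP; apply; apply/negP; rewrite -ltnNge; exact: Nij.
apply: eq_bigr => i _; apply: eq_bigr => j _.
by rewrite -scalerAl -scalerAr !coefZ mulrA.
Qed.

(** In the Cauchy product of the two exponentials the coefficient of the k-th power of T is (1 -
    1)^k / k!, which is zero for k > 0. *)
Lemma lexpK T : local T -> raises T ->
  forall f, lexp T (lexp (fun f => - T f) f) = f.
Proof.
move=> lT rT f; apply: lserP => m; pose N := (sdeg m).+1.
have rN : raises (fun f => - T f) by move=> d g gd; exact: suppN (rT _ _ gd).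
rewrite (eqdeg_local (local_lexp lT rT) (@lexp_eqdeg _ rN N f)) //.
rewrite (lexpE rT (N := N)) //.
under eq_bigr => k _ do rewrite (local_sum (local_iter k lT)) coef_sum big_distrr /=.
pose F i j := (i`!%:R)^-1 * (j`!%:R)^-1 * (-1) ^+ j * iter (i + j) T f m.
have iN k g : iter k (fun f => - T f) g = (-1) ^+ k *: iter k T g.
  elim: k => [|k IH]; first by rewrite scale1r.
  by rewrite iterS IH (localZ lT) exprS -scalerA scaleN1r.
transitivity (\sum_(i < N) \sum_(j < N) F i j).
  apply: eq_bigr => i _; apply: eq_bigr => j _.
  by rewrite (localZ (local_iter i lT)) iN (localZ (local_iter i lT)) !coefZ /F iterD !mulrA.
rewrite -big_triangle; last first.
  by move=> i j Nij; rewrite /F iter_vanish ?mulr0.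
rewrite big_ord_recl big_ord1 /F /= fact0 invr1 !mul1r big1 ?addr0 // => n _.
set k := (bump 0 n).
transitivity (\sum_(i < k.+1) ((1 ^+ (k - i) * (-1) ^+ i) *+ 'C(k, i)) * ((k`!%:R)^-1 * iter k T f m)).
  rewrite (reindex_inj rev_ord_inj) /=; apply: eq_bigr => i _.
  rewrite subSS; have ik : (i <= k)%N by rewrite -ltnS.
  rewrite subKn // subnK // expr1n mul1r -mulr_natr.
  have /(congr1 (fun k : nat => k%:R : R[i])) := bin_fact ik.
  rewrite !natrM => <-.
  have n0 j : (j`!%:R : R[i]) != 0 by rewrite pnatr_eq0 -lt0n fact_gt0.
  have c0 : ('C(k, i)%:R : R[i]) != 0 by rewrite pnatr_eq0 -lt0n bin_gt0.
  by field; rewrite ?n0 ?c0.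
by rewrite -big_distrl /= -exprDn subrr /k /bump /= add1n exprS !mul0r.
Qed.

End Supp.

(** * Substitution as an operator *)

Section Substitution.
Variable R : realType.
Local Notation lser := (lser R).
Local Notation lmon := (@lmon R).
Local Notation lphi := (@lphi R).
Implicit Types (f g h : lser) (p q m : mon) (C : lser -> lser).

Definition mX (n : int) : mon := (0, n, mset0, fset0).
Definition lX n := lmon (mX n).
(** Monomials without x and phi are the constants that every substitution fixes. *)
Definition coefmon (m : mon) : bool := (ex m == 0) && ~~ has_phi m.
Definition coef_part (m : mon) : mon := (ea m, 0, ev m, (od m `\ None)%fset).

Lemma lXD (a b : int) : lX a * lX b = lX (a + b).
Proof.
rewrite lmonM msignE /oddisj ?fdisjoint0X // inversions0l scale1r.
by rewrite /lX /mX /mmul /= msetD0 fsetU0 addr0.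
Qed.

Lemma lmon_phil p : ~~ has_phi p -> lphi * lmon p = lmon (mmul mphi p).
Proof. by move=> pN; rewrite lmonM msign_phi pN scale1r. Qed.

Lemma lmon_Xl n p : lX n * lmon p = lmon (shx n p).
Proof.
rewrite lmonM msignE /oddisj ?fdisjoint0X // inversions0l scale1r.
by rewrite /mmul /shx /= mset0D fset0U add0r addrC.
Qed.

Lemma lmon_split m :
  lmon m = (if has_phi m then lphi else 1) * lX (ex m) * lmon (coef_part m).
Proof.
rewrite -mulrA lmon_Xl.
have -> : shx (ex m) (coef_part m) = rmphi m by rewrite /shx /rmphi /ex /= add0r.
case: ifP => mN; last by rewrite mul1r rmphi_id ?mN.
by rewrite lmon_phil ?has_phi_rmphi // rmphiK.
Qed.

Lemma coefmon_coef_part m : coefmon (coef_part m).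
Proof. by rewrite /coefmon -[has_phi _]/(has_phi (rmphi m)) has_phi_rmphi. Qed.

(** The abstract form of f |-> f o H: a continuous algebra endomorphism fixing the constants. It is
    determined by the images of x and phi, that is by H, which [image_pair] recovers. *)
Definition subst_op C := [/\ local C, C 1 = 1, (forall f g, C (f * g) = C f * C g)
  & forall m, coefmon m -> C (lmon m) = lmon m].

Lemma subst_op_comp C C' : subst_op C -> subst_op C' -> subst_op (C \o C').
Proof.
move=> [lC C1 CM Cc] [lC' C1' CM' Cc']; split.
- exact: local_comp.
- by rewrite /= C1'.
- by move=> f g; rewrite /= CM' CM.
- by move=> m cm; rewrite /= Cc' // Cc.
Qed.

Lemma subst_op_lexp T : local T -> raises T ->
  (forall f g, T (f * g) = T f * g + f * T g) ->
  (forall m, coefmon m -> T (lmon m) = 0) -> subst_op (lexp T).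
Proof.
move=> lT rT TM Tc; split.
- exact: local_lexp.
- by rewrite lexp_fix //; exact: Tc.
- by move=> f g; exact: lexpM.
- by move=> m cm; rewrite lexp_fix // Tc.
Qed.

Lemma subst_op_tw t (s : mon -> mon) (c : mon -> R[i]) :
  (forall p, tw t (lmon p) = c p *: lmon (s p)) ->
  (forall p q, oddisj p q -> s (mmul p q) = mmul (s p) (s q)) ->
  (forall p q, oddisj p q -> c (mmul p q) = c p * c q) ->
  (forall p, od (s p) = od p) ->
  (forall p, coefmon p -> c p = 1 /\ s p = p) -> subst_op (tw t).
Proof.
move=> tE sM cM sod sc; split; first exact: local_tw.
- by rewrite lone tE; have [-> ->] := @sc mon1 isT; rewrite scale1r.
- apply: (local_ext2 (F := fun f g => tw t (f * g)) (G := fun f g => tw t f * tw t g));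
    try by move=> ?; loc.
  move=> p q; rewrite lmonM (localZ (local_tw t)) !tE -scalerAl -scalerAr lmonM.
  have [d|d] := boolP (oddisj p q); last by rewrite !msignN ?scale0r ?scaler0 // /oddisj !sod.
  by rewrite !scalerA cM // sM // /msign !sod mulrC.
by move=> m cm; rewrite tE; have [-> ->] := sc m cm; rewrite scale1r.
Qed.

Definition image_pair C : smap R := (lval (C (lX 1)), lval (C lphi)).

Lemma is_inv_lval f g : f * g = 1 -> is_inv (lval f) (lval g).
Proof. by move=> fg; split; [exact: lvalK | rewrite -[smul _ _]/(lval (f * g)) fg]. Qed.

Lemma sinv_lval f g : f * g = 1 -> g * f = 1 -> sinv (lval f) = lval g.
Proof.
move=> fg gf; rewrite /sinv; apply: xget_unique; first exact: is_inv_lval.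
move=> Y [lY fY]; rewrite -[Y]/(lval (mkl lY)); congr lval.
have {}fY : f * mkl lY = 1 by apply: val_inj.
by rewrite -[mkl lY]mul1r -gf -mulrA fY mulr1.
Qed.

Lemma iter_lmul f g k : iter k (smul (lval f)) (lval g) = lval (f ^+ k * g).
Proof.
elim: k => [|k IH]; first by rewrite mul1r.
by rewrite iterS IH exprS -mulrA.
Qed.

Lemma lX_exp n k : lX n ^+ k = lX (n * k%:Z).
Proof.
elim: k => [|k IH]; first by rewrite mulr0.
by rewrite exprS IH lXD; congr lX; rewrite intS mulrDr mulr1.
Qed.

Lemma subst_opX C f k : subst_op C -> C (f ^+ k) = C f ^+ k.
Proof.
by move=> [_ C1 CM _]; elim: k => [|k IH]; rewrite ?expr0 ?C1 // !exprS CM IH.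
Qed.

(** Since x^{-1} lies in the ring, the inverse of C x is C (x^{-1}), so negative powers are handled
    without expanding a geometric series. *)
Lemma spow_subst C n : subst_op C -> spow (lval (C (lX 1))) n = lval (C (lX n)).
Proof.
move=> sC; have [_ C1 CM _] := sC; case: n => n /=.
  rewrite -[sone R]/(lval 1) iter_lmul mulr1 -subst_opX // lX_exp.
  by rewrite mul1r.
rewrite (@sinv_lval _ (C (lX (-1)))); last first.
- by rewrite -CM lXD C1.
- by rewrite -CM lXD C1.
rewrite -[sone R]/(lval 1) -[smul _ _]/(iter n.+1 (smul (lval (C (lX (-1))))) (lval 1)).
rewrite iter_lmul mulr1 -subst_opX // lX_exp mulN1r.
by rewrite NegzE.
Qed.

Lemma subst_termE C f m : subst_op C ->
  subst_term (lval f) (image_pair C) m = lval (f m *: C (lmon m)).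
Proof.
move=> sC; have [lC C1 CM Cc] := sC; rewrite /subst_term /= spow_subst //.
rewrite [in RHS]lmon_split !CM (Cc _ (coefmon_coef_part m)).
by case: (has_phi m); rewrite ?C1.
Qed.

Lemma subst_summable C f : subst_op C -> summable (subst_term (lval f) (image_pair C)).
Proof.
move=> sC k; apply: sub_finite_set (laurent_le (sew k) (lvalK f)) => m /=.
rewrite subst_termE // -[lval _ k]/((f m *: C (lmon m)) k) coefZ mulf_eq0 negb_or.
move=> /andP[fm nz]; split=> //; apply: contraNT nz => mk; apply/eqP.
case: sC => lC _ _ _; apply: lC.2 => p pk; rewrite lmonE.
by case: eqP => // pm; rewrite -pm pk in mk.
Qed.

(** At a monomial k only terms of f whose sewing part divides that of k contribute, by locality;
    this makes the coefficientwise infinite sum finite and equal to the expansion of C f. *)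
Lemma subst_lsum C f : subst_op C -> lsum (subst_term (lval f) (image_pair C)) = lval (C f).
Proof.
move=> sC; apply/funext => k; rewrite /lsum.
have [lC _ _ _] := sC.
rewrite (@fsbigTE _ _ _ _ (below f k)); last first.
  move=> m mf; rewrite subst_termE // -[lval _ k]/((f m *: C (lmon m)) k) coefZ.
  have [->|fm] := eqVneq (f m) 0; first by rewrite mul0r.
  rewrite lC.2 ?mulr0 // => p pk; rewrite lmonE; case: (p =P m) => // pm.
  by rewrite pm in pk; rewrite (@covers_below _ f k m fm pk) in mf.
rewrite -[RHS]/(C f k) (local_expand lC (@covers_below _ f k)); apply: eq_bigr => m _.
by rewrite subst_termE // -[lval _ k]/((f m *: C (lmon m)) k) coefZ.
Qed.

Lemma scompE C f g : subst_op C ->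
  scomp (lval f, lval g) (image_pair C) = (lval (C f), lval (C g)).
Proof. by move=> sC; rewrite /scomp /= !subst_lsum. Qed.

Lemma composable_image_pair C f g : subst_op C -> composable (lval f, lval g) (image_pair C).
Proof.
move=> sC; split; [|exact: subst_summable..].
exists (lval (C (lX (-1)))); apply: is_inv_lval.
by have [_ C1 CM _] := sC; rewrite -CM lXD C1.
Qed.

End Substitution.

(** * The generating functions of the sewing variables *)

Section Families.
Variable R : realType.
Local Notation lser := (lser R).
Local Notation lmon := (@lmon R).
Local Notation lphi := (@lphi R).
Implicit Types (f g h : lser) (p q m : mon) (F G T : lser -> lser).

(** Stronger than coefficientwise summability: almost all terms vanish at every divisor of m, so
    local operators can be exchanged with the infinite sum. *)
Definition summ (u : nat -> lser) :=
  forall m, exists I : {fset nat}, forall i, i \notin I -> vanish_le (u i) m.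

Lemma lsum_fsetE (u : nat -> lser) m (I : {fset nat}) : (forall i, i \notin I -> u i m = 0) ->
  lsum (fun i => lval (u i)) m = \sum_(i <- I) u i m.
Proof. by move=> I0; rewrite /lsum (@fsbigTE _ _ _ _ I). Qed.

Lemma lsum_laurent u : summ u -> laurent (lsum (fun i => lval (u i))).
Proof.
move=> su s; have [[m0 m0s]|none] := pselect (exists m0, sew m0 = s); last first.
  by apply: (@sub_finite_set _ _ set0) => // m [_ ms]; apply: none; exists m.
have [I I0] := su m0.
apply: sub_finite_set (lvalK (\sum_(i <- I) u i) s) => m [nz ms]; split=> //.
rewrite -[lval _ m]/((\sum_(i <- I) u i) m) coef_sum -lsum_fsetE // => i iI.
by apply: (I0 _ iI); rewrite ms m0s sle_refl.
Qed.

Definition lsumL u (su : summ u) : lser := mkl (lsum_laurent su).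

Lemma local_lsumE F u (su : summ u) m (I : {fset nat}) : local F ->
  (forall i, i \notin I -> vanish_le (u i) m) ->
  F (lsumL su) m = \sum_(i <- I) F (u i) m.
Proof.
move=> lF I0; rewrite -coef_sum -(local_sum lF); apply: local_eq_le => // p pm.
rewrite coef_sum -[LHS]/(lsum (fun i => lval (u i)) p) (@lsum_fsetE _ _ I) //.
by move=> i /I0; apply.
Qed.

Lemma local_lsum2 F G u v (su : summ u) (sv : summ v) : local F -> local G ->
  lsum (fun i => lval (F (u i) + G (v i))) = lval (F (lsumL su) + G (lsumL sv)).
Proof.
move=> lF lG; apply/funext => m; have [I I0] := su m; have [J J0] := sv m.
have IJ0 i : i \notin (I `|` J)%fset -> vanish_le (u i) m /\ vanish_le (v i) m.
  by rewrite inE negb_or => /andP[/I0 ? /J0].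
rewrite (@lsum_fsetE (fun i => F (u i) + G (v i)) m (I `|` J)%fset); last first.
  by move=> i /IJ0[iu iv]; rewrite coefD lF.2 // lG.2 // addr0.
rewrite -[RHS]/((F (lsumL su) + G (lsumL sv)) m) coefD.
rewrite (@local_lsumE F _ su m (I `|` J)%fset) //; last by move=> i /IJ0[].
rewrite (@local_lsumE G _ sv m (I `|` J)%fset) //; last by move=> i /IJ0[].
by rewrite -big_split.
Qed.

Lemma lsumL_supp A u (su : summ u) : (forall i, supp A (u i)) -> supp A (lsumL su).
Proof.
move=> uA m nz; apply: contrapT => nA; move/negP: nz; apply; apply/eqP.
by apply: fsbig1 => i _; exact: (suppP (@uA i) nA).
Qed.

Definition egenm (v : egen) (n : int) : mon := (0, n, [mset v]%mset, fset0).
Definition ogenm (w : ogen) (n : int) : mon := (0, n, mset0, [fset w]%fset).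

Lemma evar_xpow v n : smul (evar R v) (xpow R n) = lval (lmon (egenm v n)).
Proof.
rewrite -[LHS]/(lval (lmon (egenm v 0) * lX R n)); congr lval.
rewrite lmonM msignE /oddisj ?fdisjoint0X // inversions0l scale1r.
by rewrite /mmul /egenm /= msetD0 fsetU0 !add0r.
Qed.

Lemma ovar_xpow w n : smul (ovar R w) (xpow R n) = lval (lmon (ogenm w n)).
Proof.
rewrite -[LHS]/(lval (lmon (ogenm w 0) * lX R n)); congr lval.
rewrite lmonM msignE /oddisj ?fdisjointX0 // inversions0r scale1r.
by rewrite /mmul /ogenm /= msetD0 fsetU0 !add0r.
Qed.

Lemma vanish_lmon p m : ~~ sle (sew p) (sew m) -> vanish_le (lmon p) m.
Proof.
by move=> pm k km; rewrite lmonE; case: eqP => // e; rewrite -e km in pm.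
Qed.

Lemma summ_egen (c : nat -> egen) (n : nat -> int) : injective c ->
  summ (fun i => lmon (egenm (c i) (n i))).
Proof.
move=> cI m; have fin : finite_set (c @^-1` [set` finsupp (ev m)]).
  by apply: finite_preimage => // i j _ _; exact: cI.
exists (fset_set (c @^-1` [set` finsupp (ev m)])) => i; rewrite in_fset_set // => iI.
apply: vanish_lmon; apply: contra iI => /andP[/= /msubset_subset s _].
rewrite in_setE /= msuppE; apply: s.
by rewrite mset11.
Qed.

Lemma summ_ogen (c : nat -> (nat + nat)%type) (n : nat -> int) : injective c ->
  summ (fun i => lmon (ogenm (Some (c i)) (n i))).
Proof.
move=> cI m; pose d i : ogen := Some (c i).
have fin : finite_set (d @^-1` [set` od m]).
  by apply: finite_preimage => // i j _ _ [/cI].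
exists (fset_set (d @^-1` [set` od m])) => i; rewrite in_fset_set // => iI.
apply: vanish_lmon; apply: contra iI => /andP[_ /= /fsubsetP s].
rewrite in_setE /=; have /s : d i \in ([fset Some (c i)] `\ None)%fset by rewrite !inE eqxx.
by rewrite inE => /andP[].
Qed.

Lemma ddphiE f : ddphi (lval f) = lval (dphi f).
Proof.
apply/funext => m; rewrite -[RHS]/(dphi f m) twE /ddphi /=.
by case: (has_phi m); rewrite ?mul0r ?mul1r.
Qed.

Definition oL (j : int) f : lser :=
  - (lX R (j + 1) * dx f + ((j + 1)%:~R / 2) *: (lphi * (lX R j * dphi f))).
Definition oG (j : int) f : lser := - (lX R j * vQ f).

Lemma opLE j f : opL j (lval f) = lval (oL j f).
Proof. by rewrite /opL ddphiE. Qed.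

Lemma opGE j f : opG j (lval f) = lval (oG j f).
Proof. by rewrite /opG ddphiE. Qed.

Lemma vT_split g h f : vT g h f = vT g 0 f + vT 0 h f.
Proof.
by rewrite /vT !mul0r dx0 !mulr0 !mul0r scaler0 !add0r addr0 -opprD.
Qed.

(** For fixed f the field depends locally on its coefficient g, which moves the sum over j from the
    modes L_j into the generating function. *)
Lemma local_vT1 f : local (fun g => vT g 0 f).
Proof.
rewrite (_ : (fun g => vT g 0 f) = fun g => - (g * dx f + 2^-1 *: (lphi * dx g * dphi f))).
  by loc.
by apply/funext => g; rewrite /vT mul0r addr0.
Qed.

Lemma local_vT2 f : local (fun h => vT 0 h f).
Proof.
rewrite (_ : (fun g => vT 0 g f) = fun g => - (g * vQ f)).
  by loc.
by apply/funext => g; rewrite /vT mul0r dx0 mulr0 mul0r scaler0 !add0r.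
Qed.

Lemma egen_even v n : even (lmon (egenm v n)).
Proof. by rewrite /even tau_mon cardfs0 scale1r. Qed.

Lemma evar_opL v j f :
  smul (evar R v) (opL j (lval f)) = lval (vT (lmon (egenm v (j + 1))) 0 f).
Proof.
have E n : lmon (egenm v 0) * lX R n = lmon (egenm v n).
  by apply: val_inj; exact: evar_xpow.
rewrite opLE -[LHS]/(lval (lmon (egenm v 0) * oL j f)); congr lval.
rewrite /oL /vT mul0r addr0 mulrN mulrDr (mulrA (lmon (egenm v 0)) (lX R _)) E; congr (- (_ + _)).
have -> : dx (lmon (egenm v (j + 1))) = (j + 1)%:~R *: lmon (egenm v j).
  by rewrite dx_mon /shx /egenm /ex /= addrK.
rewrite -(E j) -!scalerAr -scalerAl scalerA [_ / 2]mulrC (mulrA (lmon (egenm v 0)) lphi).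
by rewrite (even_comm lphi (egen_even v 0)) !mulrA.
Qed.

Lemma ovar_opG w j f :
  smul (ovar R w) (opG j (lval f)) = lval (vT 0 (lmon (ogenm w j)) f).
Proof.
have E n : lmon (ogenm w 0) * lX R n = lmon (ogenm w n).
  by apply: val_inj; exact: ovar_xpow.
rewrite opGE -[LHS]/(lval (lmon (ogenm w 0) * oG j f)); congr lval.
by rewrite /oG /vT mul0r dx0 mulr0 mul0r scaler0 !add0r mulrN mulrA E.
Qed.

Definition lgA := lsumL (@summ_egen inl (fun i => i%:Z + 2) (@inl_inj _ _)).
Definition lgB := lsumL (@summ_egen inr (fun i => - i%:Z) (@inr_inj _ _)).
Definition lgM := lsumL (@summ_ogen inl (fun i => i%:Z + 1) (@inl_inj _ _)).
Definition lgN := lsumL (@summ_ogen inr (fun i => - i%:Z) (@inr_inj _ _)).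

Lemma gAE : gA R = lval lgA.
Proof. by congr lsum; apply/funext => i; rewrite evar_xpow. Qed.
Lemma gBE : gB R = lval lgB.
Proof. by congr lsum; apply/funext => i; rewrite evar_xpow. Qed.
Lemma gME : gM R = lval lgM.
Proof. by congr lsum; apply/funext => i; rewrite ovar_xpow. Qed.
Lemma gNE : gN R = lval lgN.
Proof. by congr lsum; apply/funext => i; rewrite ovar_xpow. Qed.

Definition TA := vT lgA lgM.
Definition TB := vT lgB lgN.

Lemma opAME f : opAM (lval f) = lval (TA f).
Proof.
rewrite /TA vT_split -(local_lsum2 _ _ (local_vT1 f) (local_vT2 f)).
congr lsum; apply/funext => i; rewrite evar_opL ovar_opG.
have -> : i.+1%:Z = i%:Z + 1 by rewrite -addn1 PoszD.
by rewrite -addrA.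
Qed.

Lemma opBNE f : opBN (lval f) = lval (TB f).
Proof.
rewrite /TB vT_split -(local_lsum2 _ _ (local_vT1 f) (local_vT2 f)).
congr lsum; apply/funext => i; rewrite evar_opL ovar_opG.
have -> : - i.+1%:Z + 1 = - i%:Z by rewrite -addn1 PoszD opprD subrK.
by [].
Qed.

Lemma expopE (op : series R -> series R) T f : raises T ->
  (forall g, op (lval g) = lval (T g)) -> expop op (lval f) = lval (lexp T f).
Proof.
move=> rT opT; apply/funext => m; rewrite -[RHS]/(lexp T f m).
rewrite (lexpE rT f (ltnSn _)) /expop.
have iE k : iter k op (lval f) = lval (iter k T f).
  by elim: k => // k IH; rewrite iterS IH opT.
have -> : (fun k : nat => (k`!%:R)^-1 *: iter k op (lval f)) =
    fun k => lval ((k`!%:R)^-1 *: iter k T f).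
  by apply/funext => k; rewrite iE.
pose N := (sdeg m).+1.
rewrite (@lsum_fsetE _ m [fset i in iota 0 N]%fset); last first.
  by move=> i; rewrite in_fset (mem_iota 0 N) add0n /= -leqNgt => Ni; rewrite coefZ iter_vanish ?mulr0.
rewrite (perm_big (iota 0 N)); last first.
  apply: uniq_perm; rewrite ?fset_uniq ?iota_uniq // => i.
  by rewrite in_fset.
rewrite -[iota 0 N]/(index_iota 0 N) big_mkord; apply: eq_bigr => k _.
by rewrite coefZ.
Qed.

End Families.

(** * Weights and gradings *)

(** The eigenvalue of -2 L_0 on the monomial, which is why powers of alpha_0^{-2 L_0} preserve
    it. *)
Definition wt (m : mon) : int := 2 * ex m + (has_phi m)%:Z.

Lemma wt_mmul p q : oddisj p q -> wt (mmul p q) = wt p + wt q.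
Proof.
move=> d; rewrite /wt [ex _]/(ex p + ex q) phi_mmul; have := phi_disj d.
by case: (has_phi p); case: (has_phi q) => //= _; lia.
Qed.

Lemma wt_shx n m : wt (shx n m) = wt m + 2 * n.
Proof. by rewrite /wt [ex (shx n m)]/(ex m + n) [has_phi (shx n m)]/(has_phi m) mulrDr addrAC. Qed.

Lemma wt_addphi m : ~~ has_phi m -> wt (addphi m) = wt m + 1.
Proof.
move=> mN; rewrite /wt; have -> : ex (addphi m) = ex m by [].
by rewrite addphiE has_phi_mphi (negbTE mN); lia.
Qed.

Lemma count_addphi (a : pred ogen) (o : {fset ogen}) : ~~ a None ->
  count a (None |` o)%fset = count a o.
Proof.
move=> aN; have [oN|oN] := boolP (None \in o).
  by rewrite mem_fset1U.
by rewrite -(@count_rmphi a (None |` o)%fset) // fsetU1K.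
Qed.

Section Supports.
Variable R : realType.
Local Notation lser := (lser R).
Local Notation lmon := (@lmon R).
Local Notation lphi := (@lphi R).
Local Notation lgA := (lgA R).
Local Notation lgB := (lgB R).
Local Notation lgM := (lgM R).
Local Notation lgN := (lgN R).
Implicit Types (f g h : lser) (p q m : mon) (F G T : lser -> lser).

Definition wge w : lser -> Prop := supp (fun m => w <= wt m).
Definition wle w : lser -> Prop := supp (fun m => wt m <= w).

Lemma wgeM a b f g : wge a f -> wge b g -> wge (a + b) (f * g).
Proof. by move=> fa gb; apply: (suppM fa gb) => p q d pa qb; rewrite wt_mmul // lerD. Qed.

Lemma wleM a b f g : wle a f -> wle b g -> wle (a + b) (f * g).
Proof. by move=> fa gb; apply: (suppM fa gb) => p q d pa qb; rewrite wt_mmul // lerD. Qed.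

Lemma wgeW a b f : b <= a -> wge a f -> wge b f.
Proof. by move=> ab; apply: sub_supp => m; apply: le_trans. Qed.

Lemma wleW a b f : a <= b -> wle a f -> wle b f.
Proof. by move=> ab; apply: sub_supp => m /le_trans; apply. Qed.

Lemma supp_lmon (A : mon -> Prop) p : A p -> supp A (lmon p).
Proof. by move=> Ap m; rewrite lmonE; case: (m =P p) => [->//|_]; rewrite eqxx. Qed.

Lemma wge_dx w f : wge w f -> wge (w - 2) (dx f).
Proof. by move=> fw; apply: supp_tw fw _ => m _ /=; rewrite wt_shx; lia. Qed.

Lemma wle_dx w f : wle w f -> wle (w - 2) (dx f).
Proof. by move=> fw; apply: supp_tw fw _ => m _ /=; rewrite wt_shx; lia. Qed.

Lemma wge_dphi w f : wge w f -> wge (w - 1) (dphi f).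
Proof.
move=> fw; apply: supp_tw fw _ => m /= nz; rewrite wt_addphi; first by lia.
by move: nz; rewrite pnatr_eq0 eqb0 negbK.
Qed.

Lemma wle_dphi w f : wle w f -> wle (w - 1) (dphi f).
Proof.
move=> fw; apply: supp_tw fw _ => m /= nz; rewrite wt_addphi; first by lia.
by move: nz; rewrite pnatr_eq0 eqb0 negbK.
Qed.

Lemma wt_mphi : wt mphi = 1.
Proof. by rewrite /wt /has_phi /= inE eqxx. Qed.

Lemma wge_phi : wge 1 lphi. Proof. by apply: supp_lmon; rewrite wt_mphi. Qed.
Lemma wle_phi : wle 1 lphi. Proof. by apply: supp_lmon; rewrite wt_mphi. Qed.

Lemma wge_phiM w f : wge w f -> wge (w + 1) (lphi * f).
Proof. by move=> fw; rewrite addrC; apply: wgeM => //; exact: wge_phi. Qed.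

Lemma wle_phiM w f : wle w f -> wle (w + 1) (lphi * f).
Proof. by move=> fw; rewrite addrC; apply: wleM => //; exact: wle_phi. Qed.

Lemma wge_vQ w f : wge w f -> wge (w - 1) (vQ f).
Proof.
move=> fw; apply: suppB; first exact: wge_dphi.
by apply: wgeW (wge_phiM (wge_dx fw)); lia.
Qed.

Lemma wle_vQ w f : wle w f -> wle (w - 1) (vQ f).
Proof.
move=> fw; apply: suppB; first exact: wle_dphi.
by apply: wleW (wle_phiM (wle_dx fw)); lia.
Qed.

Lemma wge_vD w f : wge w f -> wge (w - 1) (vD f).
Proof.
move=> fw; apply: suppD; first exact: wge_dphi.
by apply: wgeW (wge_phiM (wge_dx fw)); lia.
Qed.

Lemma wle_vD w f : wle w f -> wle (w - 1) (vD f).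
Proof.
move=> fw; apply: suppD; first exact: wle_dphi.
by apply: wleW (wle_phiM (wle_dx fw)); lia.
Qed.

Lemma wge_vT g h w f : wge 2 g -> wge 1 h -> wge w f -> wge w (vT g h f).
Proof.
move=> g2 h1 fw; apply: suppN; apply: suppD; first apply: suppD.
- by apply: wgeW (wgeM g2 (wge_dx fw)); lia.
- apply: suppZ; apply: wgeW (wgeM (wge_phiM (wge_dx g2)) (wge_dphi fw)); lia.
by apply: wgeW (wgeM h1 (wge_vQ fw)); lia.
Qed.

(** The drop is strict because d/dx has weight -2, Q has weight -1 and the coefficients have weight
    at most 0. The strictness puts exp(-T) f - f on the low side of the cut. *)
Lemma wle_vT g h w f : wle 0 g -> wle 0 h -> wle w f -> wle (w - 1) (vT g h f).
Proof.
move=> g2 h1 fw; apply: suppN; apply: suppD; first apply: suppD.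
- by apply: wleW (wleM g2 (wle_dx fw)); lia.
- apply: suppZ; apply: wleW (wleM (wle_phiM (wle_dx g2)) (wle_dphi fw)); lia.
by apply: wleW (wleM h1 (wle_vQ fw)); lia.
Qed.

Lemma evenP f : even f <-> supp (fun m => ~~ odd #|` od m|) f.
Proof.
split=> [fe m fm|fe].
  apply/negP => mo; have := congr1 (fun g : lser => g m) fe.
  rewrite tauE -signr_odd mo expr1 mulN1r => /eqP; rewrite eq_sym -addr_eq0 -mulr2n.
  by rewrite mulrn_eq0 (negbTE fm).
apply: lserP => m; rewrite tauE; have [->|/fe] := eqVneq (f m) 0; first by rewrite mulr0.
by rewrite -signr_odd => /negbTE ->; rewrite mul1r.
Qed.

Lemma oddsP f : odds f <-> supp (fun m => odd #|` od m|) f.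
Proof.
split=> [fe m fm|fe].
  apply/negPn/negP => /negbTE mo; have := congr1 (fun g : lser => g m) fe.
  rewrite tauE -signr_odd mo expr0 mul1r coefN => /eqP; rewrite -addr_eq0 -mulr2n.
  by rewrite mulrn_eq0 (negbTE fm).
apply: lserP => m; rewrite tauE coefN; have [->|/fe] := eqVneq (f m) 0.
  by rewrite mulr0 oppr0.
by rewrite -signr_odd => ->; rewrite expr1 mulN1r.
Qed.

Lemma pfreeP f : pfree f <-> supp (fun m => ~~ has_phi m) f.
Proof.
split=> [fp m fm|fp].
  apply/negP => image_pair; have := congr1 (fun g : lser => g (rmphi m)) fp.
  rewrite twE coef0 /= addphiE rmphiK // has_phi_rmphi mul1r => fm0.
  by rewrite fm0 eqxx in fm.
apply: lserP => m; rewrite twE coef0 /=; rewrite (suppP fp) ?mulr0 //.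
by rewrite addphiE has_phi_mphi.
Qed.

Lemma enum_mset1 (T : choiceType) (x : T) : [mset x]%mset = [:: x] :> seq T.
Proof. exact: enum_msetn. Qed.

Lemma count_fset1 (T : choiceType) (a : pred T) x : count a [fset x]%fset = a x.
Proof. by rewrite -sum1_count big_mkcond big_seq_fset1; case: (a x). Qed.

Lemma lgA_supp :
  supp (fun m => [/\ degAM m = 1%N, degBN m = 0%N, od m = fset0 & 2 <= ex m]) lgA.
Proof.
apply: lsumL_supp => i; apply: supp_lmon.
rewrite /degAM /degBN /= enum_mset1; split=> //.
by rewrite /ex /=; lia.
Qed.

Lemma lgB_supp :
  supp (fun m => [/\ degAM m = 0%N, degBN m = 1%N, od m = fset0 & ex m <= 0]) lgB.
Proof.
apply: lsumL_supp => i; apply: supp_lmon.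
rewrite /degAM /degBN /= enum_mset1; split=> //.
by rewrite /ex /=; lia.
Qed.

Lemma lgM_supp :
  supp (fun m => [/\ degAM m = 1%N, degBN m = 0%N, #|` od m| = 1%N /\ ~~ has_phi m & 1 <= ex m]) lgM.
Proof.
apply: lsumL_supp => i; apply: supp_lmon.
rewrite /degAM /degBN /= enum_mset0 !count_fset1 /has_phi /= inE cardfs1; split=> //.
by rewrite /ex /=; lia.
Qed.

Lemma lgN_supp :
  supp (fun m => [/\ degAM m = 0%N, degBN m = 1%N, #|` od m| = 1%N /\ ~~ has_phi m & ex m <= 0]) lgN.
Proof.
apply: lsumL_supp => i; apply: supp_lmon.
rewrite /degAM /degBN /= enum_mset0 !count_fset1 /has_phi /= inE cardfs1; split=> //.
by rewrite /ex /=; lia.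
Qed.

Lemma lgA_even : even lgA.
Proof. by apply/evenP; apply: sub_supp lgA_supp => m [_ _ -> _]; rewrite cardfs0. Qed.
Lemma lgB_even : even lgB.
Proof. by apply/evenP; apply: sub_supp lgB_supp => m [_ _ -> _]; rewrite cardfs0. Qed.
Lemma lgM_odd : odds lgM.
Proof. by apply/oddsP; apply: sub_supp lgM_supp => m [_ _ [-> _] _]. Qed.
Lemma lgN_odd : odds lgN.
Proof. by apply/oddsP; apply: sub_supp lgN_supp => m [_ _ [-> _] _]. Qed.
Lemma lgA_pfree : pfree lgA.
Proof. by apply/pfreeP; apply: sub_supp lgA_supp => m [_ _ o _]; rewrite /has_phi o. Qed.
Lemma lgB_pfree : pfree lgB.
Proof. by apply/pfreeP; apply: sub_supp lgB_supp => m [_ _ o _]; rewrite /has_phi o. Qed.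
Lemma lgM_pfree : pfree lgM.
Proof. by apply/pfreeP; apply: sub_supp lgM_supp => m [_ _ [_ ->]]. Qed.
Lemma lgN_pfree : pfree lgN.
Proof. by apply/pfreeP; apply: sub_supp lgN_supp => m [_ _ [_ ->]]. Qed.

Lemma wge_lgA : wge 2 lgA.
Proof. by apply: sub_supp lgA_supp => m [_ _ _ m2]; rewrite /wt; lia. Qed.
Lemma wge_lgM : wge 1 lgM.
Proof. by apply: sub_supp lgM_supp => m [_ _ _ m2]; rewrite /wt; lia. Qed.
Lemma wle_lgB : wle 0 lgB.
Proof. by apply: sub_supp lgB_supp => m [_ _ o m2]; rewrite /wt /has_phi o /=; lia. Qed.
Lemma wle_lgN : wle 0 lgN.
Proof. by apply: sub_supp lgN_supp => m [_ _ [_ /negbTE o] m2]; rewrite /wt o /=; lia. Qed.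

Lemma raises_vT g h : ordge 1 g -> ordge 1 h -> raises (vT g h).
Proof.
move=> g1 h1 d f fd; rewrite -[d.+1]add1n; apply: suppN; apply: suppD; first apply: suppD.
- exact: ordgeM g1 (ordge_local (@local_dx R) fd).
- apply: suppZ; apply: ordgeM (ordge_local (@local_dphi R) fd).
  rewrite -[1%N]add0n; apply: ordgeM (ordge_local (@local_dx R) g1).
  exact: ordge0.
exact: ordgeM h1 (ordge_local (@local_vQ R) fd).
Qed.

Lemma raises_vU g h : ordge 1 g -> ordge 1 h -> raises (vU g h).
Proof.
move=> g1 h1 d f fd; apply: suppD; first exact: raises_vT.
rewrite -[d.+1]add1n; apply: ordgeM fd; apply: suppN; apply: suppD.
  by apply: suppZ; apply: (ordge_local (@local_dx R)).
rewrite -[1%N]add0n; apply: ordgeM; first exact: ordge0.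
exact: (ordge_local (@local_dx R)).
Qed.

Lemma ordge_lgA : ordge 1 lgA.
Proof. by apply: sub_supp lgA_supp => m [a b _ _]; rewrite /sdeg a b. Qed.
Lemma ordge_lgB : ordge 1 lgB.
Proof. by apply: sub_supp lgB_supp => m [a b _ _]; rewrite /sdeg a b. Qed.
Lemma ordge_lgM : ordge 1 lgM.
Proof. by apply: sub_supp lgM_supp => m [a b _ _]; rewrite /sdeg a b. Qed.
Lemma ordge_lgN : ordge 1 lgN.
Proof. by apply: sub_supp lgN_supp => m [a b _ _]; rewrite /sdeg a b. Qed.

Lemma vT_coef g h m : coefmon m -> vT g h (lmon m) = 0.
Proof.
move=> /andP[/eqP m0 /negbTE mN].
by rewrite /vT /vQ dphi_mon dx_mon m0 mN !scale0r !mulr0 subr0 scaler0 mulr0 !addr0 oppr0.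
Qed.

(* d is degAM or degBN *)
Section Grading.
Variable d : mon -> nat.
Hypothesis dM : forall p q, oddisj p q -> d (mmul p q) = (d p + d q)%N.
Hypothesis d_shx : forall n m, d (shx n m) = d m.
Hypothesis d_addphi : forall m, d (addphi m) = d m.
Hypothesis d_phi : d mphi = 0%N.

Definition pr (k : nat) : lser -> lser := tw (diag (fun m => (d m == k)%:R)).

Lemma prE k f m : pr k f m = (d m == k)%:R * f m. Proof. by []. Qed.

Lemma local_pr k : local (pr k). Proof. exact: local_tw. Qed.

Lemma pr_id k f : supp (fun m => d m = k) f -> pr k f = f.
Proof.
move=> fk; apply: lserP => m; rewrite prE; have [->|/fk ->] := eqVneq (f m) 0.
  by rewrite mulr0.
by rewrite eqxx mul1r.
Qed.

Lemma pr_eq0 k f : supp (fun m => d m <> k) f -> pr k f = 0.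
Proof.
move=> fk; apply: lserP => m; rewrite prE coef0.
by case: (d m =P k) => [e|_]; rewrite ?mul0r // (suppP fk) ?mulr0 //.
Qed.

Lemma pr_supp k f : supp (fun m => d m = k) (pr k f).
Proof.
move=> m; rewrite prE; case: (d m =P k) => // _.
by rewrite mul0r eqxx.
Qed.

Lemma supp_pr A k f : supp A f -> supp A (pr k f).
Proof. by move=> fA; apply: supp_tw fA _ => m. Qed.

Lemma prM a k g f : supp (fun m => d m = a) g -> pr (a + k) (g * f) = g * pr k f.
Proof.
move=> ga; rewrite -{1}[f](subrK (pr k f)) mulrDr (localD (@local_pr _)).
rewrite [X in X + _]pr_eq0 ?add0r; last first.
  have fk : supp (fun m => d m <> k) (f - pr k f).
    move=> m; rewrite coefB prE; case: (d m =P k) => // _.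
    by rewrite mul1r subrr eqxx.
  by apply: (suppM ga fk) => p q pq /= pa qk; rewrite dM // pa; lia.
apply: pr_id; apply: (suppM ga (@pr_supp k f)) => p q pq /= pa qk.
by rewrite dM // pa qk.
Qed.

Lemma prM0 a k g f : (k < a)%N -> supp (fun m => d m = a) g -> pr k (g * f) = 0.
Proof.
move=> ka ga; apply: pr_eq0; apply: (suppM (B := fun=> True) ga) => // p q pq.
by move=> /= pa _; rewrite dM // pa; lia.
Qed.

Lemma dxE f m : dx f m = (ex m + 1)%:~R * f (shx 1 m). Proof. by []. Qed.
Lemma dphiE f m : dphi f m = (~~ has_phi m)%:R * f (addphi m). Proof. by []. Qed.

Lemma pr_dx k f : pr k (dx f) = dx (pr k f).
Proof.
by apply: lserP => m; rewrite prE !dxE prE d_shx mulrCA.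
Qed.

Lemma pr_dphi k f : pr k (dphi f) = dphi (pr k f).
Proof.
by apply: lserP => m; rewrite prE !dphiE prE d_addphi mulrCA.
Qed.

Lemma pr_phi k f : pr k (lphi * f) = lphi * pr k f.
Proof. by apply: (prM (a := 0)); apply: supp_lmon. Qed.

Lemma pr_vQ k f : pr k (vQ f) = vQ (pr k f).
Proof. by rewrite /vQ (localB (@local_pr _)) pr_phi pr_dx pr_dphi. Qed.

Lemma supp_dx_d a g : supp (fun m => d m = a) g -> supp (fun m => d m = a) (dx g).
Proof. by move=> ga; apply: supp_tw ga _ => m _ /=; rewrite d_shx. Qed.

Lemma pr_vT a k g h f : supp (fun m => d m = a) g -> supp (fun m => d m = a) h ->
  pr (a + k) (vT g h f) = vT g h (pr k f).
Proof.
move=> ga ha; have l := localD (local_pr (a + k)).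
rewrite /vT (localN (@local_pr _)) !l (localZ (@local_pr _)) !prM //.
  by rewrite pr_vQ pr_dx pr_dphi.
have pg := supp_dx_d ga.
apply: (suppM (A := fun m => d m = 0%N) (B := fun m => d m = a)) => //.
  by apply: supp_lmon.
by move=> p q pq dp dq; rewrite dM // dp dq.
Qed.

Lemma pr_vT0 a k g h f : (k < a)%N -> supp (fun m => d m = a) g ->
  supp (fun m => d m = a) h -> pr k (vT g h f) = 0.
Proof.
move=> ka ga ha; have l := localD (local_pr k).
rewrite /vT (localN (@local_pr _)) !l (localZ (@local_pr _)).
rewrite (prM0 _ ka ga) (prM0 _ ka ha) (prM0 (a := a)) ?scaler0 ?addr0 ?oppr0 //.
have pg := supp_dx_d ga.
apply: (suppM (A := fun m => d m = 0%N) (B := fun m => d m = a)) => //.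
  by apply: supp_lmon.
by move=> p q pq dp dq; rewrite dM // dp dq.
Qed.

End Grading.

Lemma degAM_shx n m : degAM (shx n m) = degAM m. Proof. by []. Qed.
Lemma degBN_shx n m : degBN (shx n m) = degBN m. Proof. by []. Qed.
Lemma degAM_addphi m : degAM (addphi m) = degAM m.
Proof. by rewrite /degAM /= count_addphi. Qed.
Lemma degBN_addphi m : degBN (addphi m) = degBN m.
Proof. by rewrite /degBN /= count_addphi. Qed.
Lemma degAM_phi : degAM mphi = 0%N.
Proof. by rewrite /degAM /= enum_mset0 count_fset1. Qed.
Lemma degBN_phi : degBN mphi = 0%N.
Proof. by rewrite /degBN /= enum_mset0 count_fset1. Qed.

Local Notation prA := (pr degAM).
Local Notation prB := (pr degBN).

Lemma prA_TA k f : prA k.+1 (TA f) = TA (prA k f).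
Proof.
apply: (pr_vT degAM_mmul degAM_shx degAM_addphi degAM_phi (a := 1)).
  by apply: sub_supp lgA_supp => m [].
by apply: sub_supp lgM_supp => m [].
Qed.

Lemma prA_TA0 f : prA 0 (TA f) = 0.
Proof.
apply: (pr_vT0 degAM_mmul degAM_shx degAM_phi (a := 1)) => //.
  by apply: sub_supp lgA_supp => m [].
by apply: sub_supp lgM_supp => m [].
Qed.

Lemma prA_TB k f : prA k (TB f) = TB (prA k f).
Proof.
apply: (pr_vT degAM_mmul degAM_shx degAM_addphi degAM_phi (a := 0)).
  by apply: sub_supp lgB_supp => m [].
by apply: sub_supp lgN_supp => m [].
Qed.

Lemma prB_TB k f : prB k.+1 (TB f) = TB (prB k f).
Proof.
apply: (pr_vT degBN_mmul degBN_shx degBN_addphi degBN_phi (a := 1)).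
  by apply: sub_supp lgB_supp => m [].
by apply: sub_supp lgN_supp => m [].
Qed.

Lemma prB_TB0 f : prB 0 (TB f) = 0.
Proof.
apply: (pr_vT0 degBN_mmul degBN_shx degBN_phi (a := 1)) => //.
  by apply: sub_supp lgB_supp => m [].
by apply: sub_supp lgN_supp => m [].
Qed.

Lemma prB_TA k f : prB k (TA f) = TA (prB k f).
Proof.
apply: (pr_vT degBN_mmul degBN_shx degBN_addphi degBN_phi (a := 0)).
  by apply: sub_supp lgA_supp => m [].
by apply: sub_supp lgM_supp => m [].
Qed.

End Supports.

(** * The sewing operator and its Wiener-Hopf problems *)

Section Operators.
Variable R : realType.
Local Notation lser := (lser R).
Local Notation lmon := (@lmon R).
Implicit Types (f g h : lser) (p q m : mon) (F G T : lser -> lser).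

(* Through [dil t s] below, multiplication by alpha_0^{-t(w+s)/2} on the part of weight w. *)
Definition pwm (t s : int) (m : mon) : mon := (ea m + t * (wt m + s), ex m, ev m, od m).

Lemma pwmK t s m : pwm t s (pwm (- t) s m) = m.
Proof.
case: m => -[[a n] e] o; rewrite /pwm /ea /ex /ev /od /= mulNr.
by rewrite subrK.
Qed.

Lemma pwm_inj t s m k : pwm t s m = pwm t s k -> m = k.
Proof. by move=> /(congr1 (pwm (- t) s)); rewrite -{2 4}[t]opprK !pwmK. Qed.

Definition pwt t s : twist R := @Twist R (fun=> 1) (pwm t s) (fun=> erefl)
  (fun m k _ _ => @pwm_inj t s m k).

Definition dil t s : lser -> lser := tw (pwt t s).

Lemma dilE t s f m : dil t s f m = f (pwm t s m).
Proof. by rewrite /dil twE mul1r. Qed.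

Lemma local_dil t s : local (dil t s). Proof. exact: local_tw. Qed.

Lemma dil_mon t s p : dil t s (lmon p) = lmon (pwm (- t) s p).
Proof.
rewrite -[RHS]scale1r; apply: tw_mon => //; first exact: pwmK.
by move=> m _ /= <-; have := pwmK (- t) s m; rewrite opprK.
Qed.

Lemma dilK t s f : dil t s (dil (- t) s f) = f.
Proof. by apply: lserP => m; rewrite !dilE; have := pwmK (- t) s m; rewrite opprK => ->. Qed.

Lemma dil_supp (A : mon -> Prop) t s f :
  (forall m, A (pwm t s m) -> A m) -> supp A f -> supp A (dil t s f).
Proof. by move=> At fA; apply: supp_tw fA _ => m _; exact: At. Qed.

Lemma wt_pwm t s m : wt (pwm t s m) = wt m. Proof. by []. Qed.

Lemma wge_dil w t s f : wge w f -> wge w (dil t s f).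
Proof. exact: dil_supp. Qed.

Lemma wle_dil w t s f : wle w f -> wle w (dil t s f).
Proof. exact: dil_supp. Qed.

Lemma pr_dil d k t s f : (forall m, d (pwm t s m) = d m) ->
  pr d k (dil t s f) = dil t s (pr d k f).
Proof. by move=> dS; apply: lserP => m; rewrite prE !dilE prE dS. Qed.

Lemma tau_dil t s f : tau (dil t s f) = dil t s (tau f).
Proof. by apply: lserP => m; rewrite tauE !dilE tauE. Qed.

Lemma pwmM t s s' p q : oddisj p q -> pwm t (s + s') (mmul p q) = mmul (pwm t s p) (pwm t s' q).
Proof.
move=> d; rewrite /pwm wt_mmul // /mmul /ea /ex /ev /od /=; congr (_, _, _, _); ring.
Qed.

Lemma dilM t s s' f g : dil t (s + s') (f * g) = dil t s f * dil t s' g.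
Proof.
apply: (local_ext2 (F := fun f g => dil t (s + s') (f * g)) (G := fun f g => dil t s f * dil t s' g));
  try by move=> ?; rewrite /dil; loc.
move=> p q; rewrite lmonM (localZ (@local_dil _ _)) !dil_mon lmonM.
have [pq|pq] := boolP (oddisj p q); last by rewrite !msignN ?scale0r.
by rewrite pwmM.
Qed.

Lemma pwm_fix t m : wt m = 0 -> pwm t 0 m = m.
Proof. by rewrite /pwm => ->; rewrite addr0 mulr0 addr0; case: m => -[[a n] e] o. Qed.

Lemma wt_coefmon m : coefmon m -> wt m = 0.
Proof. by move=> /andP[/eqP m0 /negbTE mN]; rewrite /wt m0 mN. Qed.

Lemma subst_op_dil t : subst_op (dil t 0).
Proof.
apply: (subst_op_tw (s := pwm (- t) 0) (c := fun=> 1)) => //.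
- by move=> p; rewrite scale1r -/(dil t 0 _) dil_mon.
- by move=> p q pq; rewrite -[0 in LHS]addr0 pwmM.
- by move=> p q _; rewrite mulr1.
by move=> p /wt_coefmon p0; rewrite pwm_fix.
Qed.

Lemma vD_mon p : vD (lmon p) =
  (has_phi p)%:R *: lmon (rmphi p) + (ex p)%:~R *: (msign R mphi p *: lmon (mmul mphi (shx (-1) p))).
Proof. by rewrite /vD dphi_mon dx_mon -scalerAr lmonM. Qed.

(** D has weight -1, so the dilation applied after D acts on a weight lower by one; the shift from 0
    to 1 compensates for it. *)
Lemma vD_dil t f : vD (dil t 0 f) = dil t 1 (vD f).
Proof.
apply: (local_ext (F := fun f => vD (dil t 0 f)) (G := fun f => dil t 1 (vD f))).
- exact: local_comp (@local_vD R) (local_dil t 0).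
- exact: local_comp (local_dil t 1) (@local_vD R).
move=> p; rewrite dil_mon !vD_mon (localD (local_dil t 1)) !(localZ (local_dil t 1)) !dil_mon.
have [pN|pN] := boolP (has_phi p); last first.
  rewrite [has_phi _](negbTE pN) !scale0r !add0r; congr (_ *: (_ *: lmon _)).
  rewrite /pwm wt_mmul ?wt_shx ?wt_mphi /oddisj ?fdisjoint1X //.
  by rewrite /mmul /shx /ea /ex /ev /od /= !add0r; congr (_, _, _, _); ring.
rewrite [has_phi (pwm _ _ _)]pN !scale1r.
rewrite !msign_phi pN [has_phi (pwm _ _ _)]pN !scale0r !scaler0 !addr0.
have -> : pwm (- t) 1 (rmphi p) = rmphi (pwm (- t) 0 p) => //.
rewrite /pwm {1}/rmphi /rmphi; congr (_ + _ * _, _, _, _).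
rewrite /wt pN -[has_phi _]/(has_phi (rmphi p)) has_phi_rmphi.
by have -> : ex (ea p, ex p, ev p, (od p `\ None)%fset) = ex p by []; lia.
Qed.

(* Through [CI c] below, the substitution of (1/x, c phi/x) for (x, phi). *)
Definition invm (m : mon) : mon := (ea m, - ex m - (has_phi m)%:Z, ev m, od m).

Lemma invmK m : invm (invm m) = m.
Proof.
case: m => -[[a n] e] o; rewrite /invm /ex /ev /ea /has_phi /od /=; congr (_, _, _, _).
by case: (None \in o); lia.
Qed.

Lemma invm_inj (c : mon -> R[i]) m k : c m != 0 -> c k != 0 -> invm m = invm k -> m = k.
Proof. by move=> _ _ /(congr1 invm); rewrite !invmK. Qed.

Definition ctw (c : R[i]) : twist R := @Twist R (fun m => c ^+ has_phi m) invm (fun=> erefl)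
  (@invm_inj (fun m => c ^+ has_phi m)).
Definition CI (c : R[i]) : lser -> lser := tw (ctw c).

Lemma CIE c f m : CI c f m = c ^+ has_phi m * f (invm m). Proof. by []. Qed.

Lemma CI_mon c p : CI c (lmon p) = c ^+ has_phi p *: lmon (invm p).
Proof.
apply: tw_mon => //; first by rewrite /= invmK.
by move=> m _ <-; rewrite /= invmK.
Qed.

Lemma CIK c c' f : c * c' = 1 -> CI c (CI c' f) = f.
Proof.
move=> cc; apply: lserP => m; rewrite !CIE invmK mulrA.
by rewrite [has_phi (invm m)]/(has_phi m) -exprMn cc expr1n mul1r.
Qed.

Lemma subst_op_CI c : subst_op (CI c).
Proof.
apply: (subst_op_tw (s := invm) (c := fun p => c ^+ has_phi p)) => //.
- exact: CI_mon.
- move=> p q d; rewrite /invm phi_mmul; have := phi_disj d.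
  rewrite /mmul /ea /ex /ev /od /= => pq; congr (_, _, _, _).
  by case: (has_phi p) (has_phi q) pq => [] [] //= _; lia.
- move=> p q d; rewrite phi_mmul; have := phi_disj d.
  by case: (has_phi p); case: (has_phi q); rewrite //= ?mulr1 ?mul1r.
move=> p /andP[/eqP p0 /negbTE pN]; rewrite pN; split=> //.
rewrite /invm p0 pN subr0 oppr0.
by rewrite -{1}p0; case: p {p0 pN} => -[[a n] e] o.
Qed.

Local Notation TA := (@TA R).
Local Notation TB := (@TB R).
Definition nTA f := - TA f.
Definition nTB f := - TB f.
Definition UA := vU (lgA R) (lgM R).
Definition UB := vU (lgB R) (lgN R).
Definition nUA f := - UA f.
Definition nUB f := - UB f.

Lemma local_TA : local TA. Proof. exact: local_vT. Qed.
Lemma local_TB : local TB. Proof. exact: local_vT. Qed.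
Lemma local_nTA : local nTA. Proof. exact/local_opp/local_TA. Qed.
Lemma local_nTB : local nTB. Proof. exact/local_opp/local_TB. Qed.
Lemma local_nUA : local nUA. Proof. exact/local_opp/local_vU. Qed.
Lemma local_nUB : local nUB. Proof. exact/local_opp/local_vU. Qed.

Lemma raisesN T : raises T -> raises (fun f => - T f).
Proof. by move=> rT d f fd; exact: suppN (rT _ _ fd). Qed.

Lemma raises_TA : raises TA.
Proof. exact: raises_vT (@ordge_lgA R) (@ordge_lgM R). Qed.
Lemma raises_TB : raises TB.
Proof. exact: raises_vT (@ordge_lgB R) (@ordge_lgN R). Qed.
Lemma raises_nTA : raises nTA. Proof. exact: raisesN raises_TA. Qed.
Lemma raises_nTB : raises nTB. Proof. exact: raisesN raises_TB. Qed.
Lemma raises_nUA : raises nUA.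
Proof. exact: raisesN (raises_vU (@ordge_lgA R) (@ordge_lgM R)). Qed.
Lemma raises_nUB : raises nUB.
Proof. exact: raisesN (raises_vU (@ordge_lgB R) (@ordge_lgN R)). Qed.

Lemma TAM f g : TA (f * g) = TA f * g + f * TA g.
Proof. exact: vTM (@lgA_even R) (@lgM_odd R). Qed.
Lemma TBM f g : TB (f * g) = TB f * g + f * TB g.
Proof. exact: vTM (@lgB_even R) (@lgN_odd R). Qed.
Lemma opp_leibniz (a b f g : lser) : - (a * g + f * b) = - a * g + f * - b.
Proof. by rewrite opprD mulNr mulrN. Qed.

Lemma nTAM f g : nTA (f * g) = nTA f * g + f * nTA g.
Proof. by rewrite /nTA TAM opp_leibniz. Qed.
Lemma nTBM f g : nTB (f * g) = nTB f * g + f * nTB g.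
Proof. by rewrite /nTB TBM opp_leibniz. Qed.
Lemma nUAM f g : nUA (f * g) = nTA f * g + f * nUA g.
Proof. by rewrite /nUA /nTA /UA (vUM _ _ (@lgA_even R) (@lgM_odd R)) opp_leibniz. Qed.
Lemma nUBM f g : nUB (f * g) = nTB f * g + f * nUB g.
Proof. by rewrite /nUB /nTB /UB (vUM _ _ (@lgB_even R) (@lgN_odd R)) opp_leibniz. Qed.

Lemma subst_op_TB : subst_op (lexp TB).
Proof. exact: subst_op_lexp local_TB raises_TB TBM (fun m => @vT_coef _ _ _ m). Qed.
Lemma subst_op_nTA : subst_op (lexp nTA).
Proof.
apply: subst_op_lexp local_nTA raises_nTA nTAM _ => m cm.
by rewrite /nTA /TA vT_coef // oppr0.
Qed.
Lemma subst_op_nTB : subst_op (lexp nTB).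
Proof.
apply: subst_op_lexp local_nTB raises_nTB nTBM _ => m cm.
by rewrite /nTB /TB vT_coef // oppr0.
Qed.

(* [H1op] is f |-> f o H^(1), [sewop] is f |-> f o (H^(2))^{-1} o I o H^(1), and [sewop1]
   is what [sewop] becomes when [vD] is moved past it. *)
Definition H1op f := lexp nTA (dil (-1) 0 f).
Definition sewop f := H1op (lexp nTB f).
Definition sewop1 f := lexp nUA (dil (-1) 1 (lexp nUB f)).

Lemma subst_op_H1op : subst_op H1op.
Proof. exact: subst_op_comp subst_op_nTA (subst_op_dil (-1)). Qed.

Lemma subst_op_sewop : subst_op sewop.
Proof. exact: subst_op_comp subst_op_H1op subst_op_nTB. Qed.

Lemma local_sewop : local sewop. Proof. by have [] := subst_op_sewop. Qed.
Lemma local_H1op : local H1op. Proof. by have [] := subst_op_H1op. Qed.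

Lemma local_lexp_nUA : local (lexp nUA). Proof. exact: local_lexp local_nUA raises_nUA. Qed.
Lemma local_lexp_nUB : local (lexp nUB). Proof. exact: local_lexp local_nUB raises_nUB. Qed.

Lemma local_sewop1 : local sewop1.
Proof. exact: local_comp local_lexp_nUA (local_comp (local_dil _ _) local_lexp_nUB). Qed.

Lemma vD_sewop f : vD (sewop f) = sewop1 (vD f).
Proof.
have hA g : vD (nTA g) = nUA (vD g).
  rewrite /nTA /nUA (localN (@local_vD R)) /UA /TA vD_vT //.
  - exact: lgA_even. - exact: lgA_pfree. - exact: lgM_odd. - exact: lgM_pfree.
have hB g : vD (nTB g) = nUB (vD g).
  rewrite /nTB /nUB (localN (@local_vD R)) /UB /TB vD_vT //.
  - exact: lgB_even. - exact: lgB_pfree. - exact: lgN_odd. - exact: lgN_pfree.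
rewrite /sewop /H1op /sewop1 (lexp_intertwine local_nTA raises_nTA raises_nUA (@local_vD R) hA).
by rewrite vD_dil (lexp_intertwine local_nTB raises_nTB raises_nUB (@local_vD R) hB).
Qed.

Lemma sewop1M f g : sewop1 (f * g) = sewop f * sewop1 g.
Proof.
rewrite /sewop1 (lexpM local_nUB local_nTB local_nUB raises_nUB raises_nTB raises_nUB nUBM).
(* The shift is split as 1 = 0 + 1: the first factor is dilated plainly and the second carries the
   twist. *)
rewrite -[1]add0r dilM add0r.
by rewrite (lexpM local_nUA local_nTA local_nUA raises_nUA raises_nTA raises_nUA nUAM).
Qed.

Lemma tau_TA f : tau (TA f) = TA (tau f).
Proof. exact: tau_vT (@lgA_even R) (@lgM_odd R). Qed.
Lemma tau_TB f : tau (TB f) = TB (tau f).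
Proof. exact: tau_vT (@lgB_even R) (@lgN_odd R). Qed.

Lemma tau_lexp T : local T -> raises T -> (forall f, tau (T f) = T (tau f)) ->
  forall f, tau (lexp T f) = lexp T (tau f).
Proof. by move=> lT rT tT f; apply: lexp_intertwine => //; exact: local_tau. Qed.

Lemma tau_sewop f : tau (sewop f) = sewop (tau f).
Proof.
rewrite /sewop /H1op tau_lexp //; [|exact: local_nTA|exact: raises_nTA|]; last first.
  by move=> g; rewrite /nTA tauN tau_TA.
rewrite tau_dil tau_lexp //; [exact: local_nTB|exact: raises_nTB|].
by move=> g; rewrite /nTB tauN tau_TB.
Qed.

Definition leads F G := forall d f, ordge d f -> ordge d.+1 (F f - G f).

Lemma leads_lexp T : raises T -> leads (lexp T) id.
Proof. by move=> rT d f; exact: lexp_lead. Qed.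

Lemma leads_dil t s : leads (dil t s) (dil t s).
Proof. by move=> d f _; rewrite subrr; exact: supp0. Qed.

Lemma ordge_leads F G d f : leads F G -> local G -> ordge d f -> ordge d (F f).
Proof.
move=> FG lG fd; rewrite -[F f](subrK (G f)); apply: suppD; last exact: ordge_local.
by apply: sub_supp (FG _ _ fd) => m; exact: ltnW.
Qed.

Lemma leads_comp F F' G G' : leads F G -> leads F' G' -> local G -> local G' ->
  leads (fun f => F (F' f)) (fun f => G (G' f)).
Proof.
move=> FG FG' lG lG' d f fd; rewrite -[F (F' f)](subrK (G (F' f))) -addrA; apply: suppD.
  by apply: FG; exact: ordge_leads FG' lG' fd.
by rewrite -(localB lG); apply: ordge_local => //; exact: FG'.
Qed.

Lemma leads_H1op : leads H1op (dil (-1) 0).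
Proof.
exact: leads_comp (leads_lexp raises_nTA) (@leads_dil (-1) 0) (local_id R) (local_dil _ _).
Qed.

Lemma leads_sewop : leads sewop (dil (-1) 0).
Proof.
exact: leads_comp leads_H1op (leads_lexp raises_nTB) (local_dil _ _) (local_id R).
Qed.

Lemma leads_dil_nTB : leads (fun f => dil (-1) 0 (lexp nTB f)) (dil (-1) 0).
Proof.
exact: leads_comp (@leads_dil (-1) 0) (leads_lexp raises_nTB) (local_dil _ _) (local_id R).
Qed.

Lemma leads_sewop1 : leads sewop1 (dil (-1) 1).
Proof.
apply: (leads_comp (leads_lexp raises_nUA) _ (local_id R) (local_dil _ _)).
exact: leads_comp (@leads_dil (-1) 1) (leads_lexp raises_nUB) (local_dil _ _) (local_id R).
Qed.

(** Let m be a monomial of f of least sewing degree. In that degree F is an injective dilation, so a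
    monomial of the same weight occurs in F f, although weights of f are at least w and those of F f
    at most w - 1. *)
Lemma WH_unique F t s w f : leads F (dil t s) -> wge w f -> wle (w - 1) (F f) -> f = 0.
Proof.
move=> FS fw Fw; apply: ordge_eq0 => d fd m fm; have dm := fd _ fm.
rewrite ltn_neqAle dm andbT; apply/eqP => md.
pose m' := pwm (- t) s m.
have fm' : dil t s f m' = f m by rewrite dilE pwmK.
have F0 : F f m' = 0.
  by apply: (suppP Fw); rewrite wt_pwm; have := fw _ fm; lia.
have := FS _ _ fd; move=> /suppP/(_ (_ : ~ _)); have nm : ~ (d.+1 <= sdeg m')%N.
  by rewrite -[sdeg m']/(sdeg m) -md ltnn.
move=> /(_ m' nm); rewrite coefB F0 fm' sub0r => /eqP.
by rewrite oppr_eq0; apply/negP.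
Qed.

(** The map f |-> c - K f is contracting for the degree filtration, so its iterates from 0 stabilize
    in each degree. *)
Lemma raises_fixpoint (K : lser -> lser) (c : lser) :
  (forall f g, K (f - g) = K f - K g) -> raises K ->
  exists f, f = c - K f.
Proof.
move=> KB rK; pose P f := c - K f.
have Pn n f g : eqdeg n f g -> eqdeg n.+1 (P f) (P g).
  move=> /eqdeg_ordge fg; apply/eqdeg_ordge.
  by rewrite /P opprB addrC addrA subrK -KB; apply: rK; rewrite -opprB; exact: suppN.
have Pit n k : eqdeg n (iter n P 0) (iter (n + k) P 0).
  elim: n => [|n IH]; first by move=> m.
  by rewrite addSn !iterS; exact: Pn.
(* The iterate of index n is exact only in degrees below n, and [dlim] reads degree n from the term
   of index n; hence [n.+1]. *)
pose u := dlim (fun n => iter n.+1 P 0).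
have un n : eqdeg n.+1 u (iter n.+1 P 0).
  move=> m mn; rewrite dlimE; have -> : n.+1 = ((sdeg m).+1 + (n - sdeg m))%N by lia.
  exact: Pit.
exists u; rewrite -[RHS]/(P u); apply: lserP => m.
rewrite (un (sdeg m)) // (Pn _ _ _ (un (sdeg m))) // -iterS.
by have := @Pit (sdeg m).+1 1; rewrite addn1; apply.
Qed.

(** With E = dil (-1) 0 composed with 1 + K, where K raises the degree, the part of weight at least
    w of (1 + K) u = dil 1 0 f0 is the fixed point equation u = dil 1 0 f0 - Pw (K u). What it
    leaves over is the part of K u of weight below w. *)
Lemma WH_exist w f0 : wge w f0 -> exists u, wge w u /\ wle (w - 1) (sewop u - f0).
Proof.
move=> f0w; pose Pw := tw (diag (R := R) (fun m => (w <= wt m)%R%:R)).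
have PwE g m : Pw g m = (w <= wt m)%R%:R * g m by [].
have lPw : local Pw by exact: local_tw.
pose K g := dil 1 0 (sewop g) - g.
have lK : local K.
  exact: local_add (local_comp (local_dil 1 0) local_sewop) (local_opp (local_id R)).
have rK : raises K.
  move=> d g gd; rewrite /K -{2}[g](dilK 1 0) -(localB (local_dil 1 0)).
  by apply: (ordge_local (local_dil 1 0)); exact: leads_sewop.
have [u uE] : exists u, u = dil 1 0 f0 - Pw (K u).
  apply: raises_fixpoint => [f g|d g gd]; first by rewrite !(localB lK) (localB lPw).
  by apply: (ordge_local lPw); exact: rK.
have uw : wge w u.
  rewrite uE; apply: suppB; first exact: wge_dil.
  by move=> m; rewrite PwE; case: (w <= wt m) => //; rewrite mul0r eqxx.
exists u; split=> //.
rewrite -[sewop u - f0](dilK (-1) 0) opprK (localB (local_dil 1 0)); apply: wle_dil.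
have -> : dil 1 0 (sewop u) = K u + u by rewrite subrK.
rewrite {2}uE addrAC addrA subrK addrC => m; rewrite coefD coefN PwE.
have [_|mw] := boolP (w <= wt m); first by rewrite mul1r addNr eqxx.
by rewrite -ltNge in mw; lia.
Qed.

End Operators.

(** * Existence *)

Section Sewing.
Variable R : realType.
Local Notation lser := (lser R).
Local Notation lmon := (@lmon R).
Local Notation lphi := (@lphi R).
Local Notation lX := (lX R).
Local Notation sewop := (@sewop R).
Local Notation H1op := (@H1op R).
Local Notation TA := (@TA R).
Local Notation TB := (@TB R).
Local Notation nTA := (@nTA R).
Local Notation nTB := (@nTB R).
Local Notation iR := (Complex 0 1 : R[i]).
Implicit Types (f g h u v : lser) (p q m : mon) (F G T : lser -> lser).

Lemma iRN : iR * - iR = 1.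
Proof. by rewrite mulrN -expr2 sqr_i opprK. Qed.

Lemma pow2L0E t f : pow2L0 t (lval f) = lval (dil t 0 f).
Proof. by apply/funext => m; rewrite -[RHS]/(dil t 0 f m) dilE /pwm addr0. Qed.

Lemma nTAE f : - opAM (lval f) = lval (nTA f).
Proof. by rewrite opAME. Qed.

Lemma nTBE f : - opBN (lval f) = lval (nTB f).
Proof. by rewrite opBNE. Qed.

Lemma H1mapE : H1map R = image_pair H1op.
Proof.
have e f := @expopE R (fun g : series R => - opAM g) nTA f (@raises_nTA R) nTAE.
by rewrite /H1map /image_pair /H1op /both /= -[xpow R 1]/(lval (lX 1)) -[phi R]/(lval lphi) !pow2L0E !e.
Qed.

Lemma ImapE : Imap R = image_pair (CI iR).
Proof.
rewrite /Imap /image_pair !CI_mon /has_phi /= !inE /= expr0 scale1r expr1; congr (_, _).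
rewrite -[smul _ _]/(lval (lphi * lX (-1))) lmonM msign_phi scale1r.
rewrite -[_ *: lval _]/(lval (iR *: lmon (mmul mphi (mX (-1))))).
by rewrite /mmul /invm /has_phi /= inE /ex /ev /ea /= mset0D fsetU0 !add0r.
Qed.

Lemma H2mapE : H2map R = image_pair (lexp TB \o CI iR).
Proof.
have e f := @expopE R (@opBN R) TB f (@raises_TB R) (@opBNE R).
rewrite /H2map ImapE.
by rewrite -[LHS]/(expop (@opBN R) (lval (CI iR (lX 1))), expop (@opBN R) (lval (CI iR lphi))) !e.
Qed.

Definition H2op : lser -> lser := lexp TB \o CI iR.
(** I composed with itself sends phi to -phi, so the inverse of I has -i in place of i. The order of
    the operators is reversed with respect to the maps. *)
Definition H2invop : lser -> lser := CI (- iR) \o lexp nTB.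

Lemma subst_op_H2op : subst_op H2op.
Proof. exact: subst_op_comp (subst_op_TB R) (subst_op_CI iR). Qed.

Lemma subst_op_H2invop : subst_op H2invop.
Proof. exact: subst_op_comp (subst_op_CI (- iR)) (subst_op_nTB R). Qed.

Lemma local_H2invop : local H2invop. Proof. by have [] := subst_op_H2invop. Qed.

Lemma TBK f : lexp nTB (lexp TB f) = f.
Proof.
have {1}-> : TB = fun f => - nTB f by apply/funext => g; rewrite /nTB opprK.
exact: lexpK (@local_nTB R) (@raises_nTB R) f.
Qed.

Lemma nTBK f : lexp TB (lexp nTB f) = f.
Proof. exact: lexpK (@local_TB R) (@raises_TB R) f. Qed.

Lemma TAK f : lexp nTA (lexp TA f) = f.
Proof.
have {1}-> : TA = fun f => - nTA f by apply/funext => g; rewrite /nTA opprK.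
exact: lexpK (@local_nTA R) (@raises_nTA R) f.
Qed.

Lemma H2opK f : H2invop (H2op f) = f.
Proof. by rewrite /H2invop /H2op /= TBK CIK // mulrC iRN. Qed.

Lemma H2invopK f : H2op (H2invop f) = f.
Proof. by rewrite /H2invop /H2op /= CIK ?iRN // nTBK. Qed.

Lemma tau_CI c f : tau (CI c f) = CI c (tau f).
Proof. by apply: lserP => m; rewrite tauE !CIE tauE mulrCA. Qed.

Lemma tau_X n : tau (lX n) = lX n.
Proof. by rewrite tau_mon cardfs0 scale1r. Qed.

Lemma tau_H2invop f : tau (H2invop f) = H2invop (tau f).
Proof.
rewrite /H2invop /= tau_CI (tau_lexp (@local_nTB R) (@raises_nTB R)) // => g.
by rewrite /nTB tauN tau_TB.
Qed.

Lemma image_pair_comp (C C' : lser -> lser) : subst_op C -> scomp (image_pair C') (image_pair C) = image_pair (C \o C').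
Proof. by move=> sC; rewrite /image_pair scompE. Qed.

Lemma even_series_lval f : even_series (lval f) <-> even f.
Proof. by split=> [h|/evenP//]; apply/evenP. Qed.
Lemma odd_series_lval f : odd_series (lval f) <-> odds f.
Proof. by split=> [h|/oddsP//]; apply/oddsP. Qed.
Lemma phi_free_lval f : phi_free (lval f) <-> pfree f.
Proof. by split=> [h|/pfreeP//]; apply/pfreeP. Qed.

Lemma image_pair_id F : (forall f, F f = f) -> image_pair F = idsmap R.
Proof. by move=> Fid; rewrite /image_pair !Fid. Qed.

Lemma compinv_H2invop : is_compinv (H2map R) (image_pair H2invop).
Proof.
rewrite H2mapE -/H2op; split.
- split; first exact: lvalK.
  by apply/even_series_lval; rewrite /even tau_H2invop tau_X.
- split; first exact: lvalK.
  by apply/odd_series_lval; rewrite /odds tau_H2invop tau_phi (localN local_H2invop).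
- split; first exact: composable_image_pair subst_op_H2op.
  by rewrite (image_pair_comp _ subst_op_H2op); exact: image_pair_id H2invopK.
split; first exact: composable_image_pair subst_op_H2invop.
by rewrite (image_pair_comp _ subst_op_H2invop); exact: image_pair_id H2opK.
Qed.

(** Applying [H2invop] to K o H^(2) = id determines K, so the inverse chosen in [sewing_equation] is
    the expected one. *)
Lemma compinv_unique K : is_compinv (H2map R) K -> K = image_pair H2invop.
Proof.
case: K => k1 k2 [[/= l1 _] [l2 _] [_ e] _].
rewrite H2mapE -/H2op -[k1]/(lval (mkl l1)) -[k2]/(lval (mkl l2)) (scompE _ _ subst_op_H2op) in e.
have e1 : H2op (mkl l1) = lX 1 by apply: val_inj; exact: (congr1 fst e).
have e2 : H2op (mkl l2) = lphi by apply: val_inj; exact: (congr1 snd e).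
by rewrite /image_pair -e1 -e2 !H2opK.
Qed.

(** The inversion contained in (H^(2))^{-1} cancels against I and leaves [sewop]; composability
    holds for every substitution operator, so what remains is the space condition and the
    equation. *)
Lemma sewing_equationP (F1 : smap R) u v :
  sewing_equation F1 (lval u, lval v) <->
  (space1 (lval (sewop u)) /\ space1 (lval (sewop v))) /\ F1 = (lval (sewop u), lval (sewop v)).
Proof.
have sEH := subst_op_H1op R; have sE := subst_op_sewop R.
have sEC : subst_op (H1op \o CI iR) by exact: subst_op_comp sEH (subst_op_CI iR).
have IH : scomp (Imap R) (H1map R) = image_pair (H1op \o CI iR).
  by rewrite ImapE H1mapE; rewrite /image_pair (scompE _ _ sEH).
have GE : scomp (image_pair H2invop) (image_pair (H1op \o CI iR)) = image_pair sewop.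
  by rewrite /image_pair (scompE _ _ sEC) /H2invop /= !CIK ?iRN.
split.
  move=> [K [/compinv_unique ->]]; cbv zeta; rewrite IH GE (scompE _ _ sE).
  by case=> _ _ _ s e; split.
move=> [s e]; exists (image_pair H2invop); split; first exact: compinv_H2invop.
cbv zeta; rewrite IH GE (scompE _ _ sE); split=> //.
- by rewrite ImapE H1mapE; exact: composable_image_pair.
- exact: composable_image_pair.
exact: composable_image_pair.
Qed.

Definition sol u v := [/\ wge 2 u, wle 1 (sewop u - lX 1), wge 1 v & wle 0 (sewop v - lphi)].

Lemma sol_exists : exists u v, sol u v.
Proof.
have [u [u1 u2]] : exists u, wge 2 u /\ wle (2 - 1) (sewop u - lX 1).
  by apply: WH_exist; apply: supp_lmon.
have [v [v1 v2]] : exists v, wge 1 v /\ wle (1 - 1) (sewop v - lphi).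
  by apply: WH_exist; exact: wge_phi.
by exists u, v.
Qed.

Lemma WH_unique_sewop w f : wge w f -> wle (w - 1) (sewop f) -> f = 0.
Proof. exact: WH_unique (@leads_sewop R). Qed.

Lemma WH_eq w f0 f g : wge w f -> wge w g -> wle (w - 1) (sewop f - f0) ->
  wle (w - 1) (sewop g - f0) -> f = g.
Proof.
move=> fw gw fE gE; apply/eqP; rewrite -subr_eq0; apply/eqP.
apply: (@WH_unique_sewop w); first exact: suppB.
rewrite (localB (@local_sewop R)).
have -> : sewop f - sewop g = (sewop f - f0) - (sewop g - f0) by rewrite opprB addrA subrK.
exact: suppB.
Qed.

Lemma sol_unique u v u' v' : sol u v -> sol u' v' -> u = u' /\ v = v'.
Proof.
move=> [u1 u2 v1 v2] [u1' u2' v1' v2']; split.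
  exact: (WH_eq u1 u1' (f0 := lX 1)).
exact: (WH_eq v1 v1' (f0 := lphi)).
Qed.

Lemma supp_tau A f : supp A f -> supp A (tau f).
Proof. by move=> fA; apply: supp_tw fA _ => m. Qed.

(** Parity commutes with E and preserves weights. Thus tau u solves the problem of u, while tau v
    and -v both solve the one with right hand side -phi. *)
Lemma sol_even u v : sol u v -> even u /\ odds v.
Proof.
move=> [u1 u2 v1 v2]; split.
  apply: (WH_eq (supp_tau u1) u1 _ u2); rewrite -tau_sewop -[lX 1]tau_X -(localB (@local_tau R)).
  exact: supp_tau.
apply: (WH_eq (w := 1) (f0 := - lphi)); [exact: supp_tau|exact: suppN| |].
  rewrite -tau_sewop -tau_phi -(localB (@local_tau R)); exact: supp_tau.
by rewrite (localN (@local_sewop R)) -opprD; apply: suppN.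
Qed.

(** The pair (x, phi) has no defect, D x = phi = phi D phi. Expanding E u and E v around it, the
    terms phi cancel and all others have weight at most 0. *)
Lemma sol_Omega u v : sol u v -> vD u = v * vD v.
Proof.
move=> [u1 u2 v1 v2]; apply/eqP; rewrite -subr_eq0; apply/eqP.
apply: (WH_unique (w := 1) (@leads_sewop1 R)).
  apply: suppB; first exact: (wge_vD u1).
  by apply: wgeW (wgeM v1 (wge_vD v1)).
rewrite (localB (@local_sewop1 R)) sewop1M -!vD_sewop.
have -> : sewop u = lX 1 + (sewop u - lX 1) by rewrite addrC subrK.
have -> : sewop v = lphi + (sewop v - lphi) by rewrite addrC subrK.
move: (sewop u - lX 1) (sewop v - lphi) u2 v2 => r s r1 s0.
rewrite !(localD (@local_vD R)).
have -> : vD (lX 1) = lphi.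
  by rewrite /vD dphi_mon dx_mon scale0r add0r scale1r; exact: mulr1.
have -> : vD lphi = 1 by rewrite /vD dphi_phi dx_phi mulr0 addr0.
have r0 := wle_vD r1; have s1 := wle_vD s0; move: (vD r) (vD s) r0 s1 => Dr Ds r0 s1.
have -> : (lphi + s) * (1 + Ds) = lphi + (lphi * Ds + (s + s * Ds)).
  by rewrite mulrDl !mulrDr !mulr1 -addrA.
rewrite opprD addrACA (subrr lphi) add0r.
apply: suppB; first exact: wleW r0.
apply: suppD; first by apply: wleW (wleM (@wle_phi R) s1).
by apply: suppD; [exact: wleW s0 | apply: wleW (wleM s0 s1)].
Qed.

Lemma superconformal_mul g h k : even g -> odds h ->
  (h + lphi * g) * (g + lphi * k) = g * h + lphi * (g * g - h * k).
Proof.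
move=> ge ho; rewrite mulrDl !mulrDr (even_comm h ge) -addrA; congr (_ + _).
have -> : h * (lphi * k) = - (lphi * (h * k)).
  by rewrite mulrA (odd_comm lphi ho) tau_phi mulNr mulrA mulNr.
have -> : lphi * g * (lphi * k) = 0.
  by rewrite -mulrA (mulrA g) (even_comm lphi ge) -mulrA phiphiM.
by rewrite addr0 -(mulrA lphi g g) mulrN; exact: addrC.
Qed.

(** Comparing the parts without and with phi in D u = v D v gives xi = g psi and f' = g^2 - psi
    psi'. *)
Lemma superconformal_lval u v : even u -> odds v -> vD u = v * vD v ->
  dphi v <> 0 -> superconformal (lval u, lval v).
Proof.
move=> ue vo uv nz.
pose f := u - lphi * dphi u; pose xi := dphi u; pose psi := v - lphi * dphi v; pose g := dphi v.
have fp h : dphi (h - lphi * dphi h) = 0.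
  by rewrite dphiD dphiN dphi_phiM dphi_dphi mulr0 subr0 subrr.
have xio : odds xi by have := dphi_tau u; rewrite ue /odds -/xi => {2}->; rewrite opprK.
have ge : even g.
  by have := dphi_tau v; rewrite vo dphiN => /oppr_inj.
have fe : even f by rewrite /even /f tauD tauN tauM tau_phi -/xi xio ue mulrNN.
have psio : odds psi by rewrite /odds /psi tauD tauN tauM tau_phi -/g ge vo opprD mulNr.
have fpsi : dphi psi = 0 := fp v.
have key : xi + lphi * dx f = g * psi + lphi * (g * g - psi * dx psi).
  have -> : xi + lphi * dx f = vD u.
    by rewrite /vD /f dxD dxN dx_phiM mulrDr mulrN phiphiM subr0.
  have vE : v = psi + lphi * g by rewrite subrK.
  have gp : dphi g = 0 := dphi_dphi v.
  have vDv : vD v = g + lphi * dx psi.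
    by rewrite {1}vE /vD dphiD dxD fpsi add0r dphi_phiM dx_phiM gp mulr0 subr0 mulrDr phiphiM addr0.
  by rewrite uv vDv {1}vE superconformal_mul.
have pf : pfree f := fp u.
have gp : dphi g = 0 := dphi_dphi v.
have dxi : dphi xi = 0 := dphi_dphi u.
have dxf : dphi (dx f) = 0 by rewrite -dx_dphi pf dx0.
have dpsi : dphi (dx psi) = 0 by rewrite -dx_dphi fpsi dx0.
have e2 : dx f = g * g - psi * dx psi.
  have gg : dphi (g * g - psi * dx psi) = 0.
    by rewrite dphiD dphiN !dphiM fpsi gp dpsi !mul0r !mulr0 !addr0 oppr0 addr0.
  have kl : dphi (xi + lphi * dx f) = dx f.
    by rewrite dphiD dxi add0r dphi_phiM dxf mulr0 subr0.
  rewrite -kl key dphiD (dphiM g psi) gp fpsi mul0r mulr0 addr0 add0r dphi_phiM gg.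
  by rewrite mulr0 subr0.
have e1 : xi = g * psi by have := key; rewrite e2 => /addIr.
exists (lval f), (lval g), (lval xi), (lval psi); split.
  by split; split; first [exact/phi_free_lval|exact/even_series_lval|exact/odd_series_lval].
split.
- rewrite -[smul _ (lval xi)]/(lval (lphi * xi)) -[smul _ (lval g)]/(lval (lphi * g)).
  rewrite -[lval f + _]/(lval (f + lphi * xi)) -[lval psi + _]/(lval (psi + lphi * g)).
  by rewrite !subrK.
- by rewrite e1.
- rewrite -[LHS]/(lval (g * g)) -[RHS]/(lval (dx f + psi * dx psi)).
  by rewrite e2 subrK.
rewrite -[_ + _]/(lval (g + lphi * dx psi)) => e0.
have {}e0 : g + lphi * dx psi = 0 by apply: val_inj.
have := congr1 (fun h => dphi (lphi * h)) e0.
rewrite mulrDr phiphiM addr0 mulr0 dphi0 dphi_phiM /g dphi_dphi mulr0 subr0.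
by [].
Qed.

End Sewing.

(** * Boundary conditions *)

Section Boundary.
Variable R : realType.
Local Notation lser := (lser R).
Local Notation lmon := (@lmon R).
Local Notation lphi := (@lphi R).
Local Notation lX := (lX R).
Local Notation sewop := (@sewop R).
Local Notation TA := (@TA R).
Local Notation TB := (@TB R).
Local Notation nTA := (@nTA R).
Local Notation nTB := (@nTB R).
Local Notation dil := (@dil R).
Local Notation prA := (@pr R degAM).
Local Notation prB := (@pr R degBN).
Implicit Types (f g h u v : lser) (p q m : mon) (F G T : lser -> lser).

Lemma local_prA k : local (prA k). Proof. exact: local_tw. Qed.
Lemma local_prB k : local (prB k). Proof. exact: local_tw. Qed.

Lemma prA_dil k t s f : prA k (dil t s f) = dil t s (prA k f).
Proof. exact: pr_dil. Qed.
Lemma prB_dil k t s f : prB k (dil t s f) = dil t s (prB k f).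
Proof. exact: pr_dil. Qed.
Lemma prAB j k f : prA j (prB k f) = prB k (prA j f).
Proof. by apply: lserP => m; rewrite !prE mulrCA. Qed.

Lemma pr_lexp d k T f : local T -> raises T -> (forall g, pr d k (T g) = T (pr d k g)) ->
  pr d k (lexp T f) = lexp T (pr d k f).
Proof. by move=> lT rT TP; apply: lexp_intertwine => //; exact: local_pr. Qed.

Lemma pr0_lexp d T f : local T -> raises T -> (forall g, pr d 0 (T g) = 0) ->
  pr d 0 (lexp T f) = pr d 0 f.
Proof.
move=> lT rT T0.
rewrite (lexp_intertwine (U := fun=> 0) lT rT _ (@local_pr _ d 0)) ?lexp_fix //.
- by split=> [a g h|g m _]; rewrite ?scaler0 ?addr0.
- by move=> e g _; exact: supp0.
by move=> e g _; exact: supp0.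
Qed.

(** Each application of T raises the degree d by one, so in degree one only the powers 0 and 1
    contribute. *)
Lemma pr1_lexp d T f : local T -> raises T -> (forall g, pr d 0 (T g) = 0) ->
  (forall g, pr d 1 (T g) = T (pr d 0 g)) ->
  pr d 1 (lexp T f) = pr d 1 f + T (pr d 0 f).
Proof.
move=> lT rT T0 T1; apply: lserP => m; pose N := (sdeg m).+2.
have lp := @local_pr R d 1.
rewrite (eqdeg_local lp (lexp_eqdeg rT f) (n := N)) // (local_sum lp) coef_sum.
rewrite !big_ord_recl big1 ?addr0 => [|k _].
  by rewrite !(localZ lp) /= fact0 invr1 !scale1r T1 coefD.
by rewrite (localZ lp) !lift0 !iterS T1 T0 (local0 lT) scaler0.
Qed.

Lemma prA0_sewop f : prA 0 (sewop f) = dil (-1) 0 (lexp nTB (prA 0 f)).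
Proof.
rewrite /sewop /H1op pr0_lexp; [|exact: local_nTA|exact: raises_nTA|]; last first.
  by move=> g; rewrite /nTA (localN (local_prA 0)) prA_TA0 oppr0.
rewrite prA_dil pr_lexp //; [exact: local_nTB|exact: raises_nTB|].
by move=> g; rewrite /nTB (localN (local_prA 0)) prA_TB.
Qed.

Lemma prB_lexp_nTA k f : prB k (lexp nTA f) = lexp nTA (prB k f).
Proof.
apply: pr_lexp; [exact: local_nTA|exact: raises_nTA|] => g.
by rewrite /nTA (localN (local_prB k)) prB_TA.
Qed.

Lemma prB0_sewop f : prB 0 (sewop f) = H1op (prB 0 f).
Proof.
rewrite /sewop /H1op prB_lexp_nTA prB_dil pr0_lexp //; [exact: local_nTB|exact: raises_nTB|].
by move=> g; rewrite /nTB (localN (local_prB 0)) prB_TB0 oppr0.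
Qed.

Lemma lexp_sub_supp A T f : local T -> raises T ->
  (forall k, supp A (iter k.+1 T f)) -> supp A (lexp T f - f).
Proof.
move=> lT rT TA m nz; apply: contrapT => nA; move/negP: nz; apply; apply/eqP.
rewrite coefB (lexpE rT _ (ltnSn _)) big_ord_recl fact0 invr1 mul1r addrC addKr.
by rewrite big1 // => k _; rewrite lift0 (suppP (TA k) nA) mulr0.
Qed.

Lemma wle_nTB w f : wle w f -> wle (w - 1) (nTB f).
Proof. by move=> fw; apply: suppN; apply: wle_vT => //; [exact: wle_lgB|exact: wle_lgN]. Qed.

Lemma wge_TA w f : wge w f -> wge w (TA f).
Proof. by move=> fw; apply: wge_vT => //; [exact: wge_lgA|exact: wge_lgM]. Qed.

Lemma wle_lexp_nTB w f : wle w f -> wle (w - 1) (lexp nTB f - f).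
Proof.
move=> fw; apply: lexp_sub_supp (@local_nTB R) (@raises_nTB R) _ => k.
apply: wle_nTB; elim: k => [|k IH] //=.
by apply: wleW (wle_nTB IH); lia.
Qed.

Lemma wge_lexp_TA w f : wge w f -> wge w (lexp TA f).
Proof.
move=> fw; apply: (lexp_supp (@raises_TA R) (A := fun m => w <= wt m)) => k.
by elim: k => [|k IH] //=; exact: wge_TA.
Qed.

(* The targets of the two Wiener-Hopf problems are f0 = x with w = 2 and f0 = phi with w = 1. *)
Definition base (w : int) f0 := supp (fun m => [/\ wt m = w, degAM m = 0%N & degBN m = 0%N]) f0.

Lemma base_X : base 2 (lX 1).
Proof. by apply: supp_lmon; rewrite /degAM /degBN /= enum_mset0. Qed.

Lemma base_phi : base 1 lphi.
Proof. by apply: supp_lmon; rewrite wt_mphi degAM_phi degBN_phi. Qed.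

Section Component.
Variables (w : int) (f0 f : lser).
Hypotheses (bf0 : base w f0) (fw : wge w f) (Ef : wle (w - 1) (sewop f - f0)).

Let f0ge : wge w f0. Proof. by apply: sub_supp bf0 => m [->]. Qed.
Let f0le : wle w f0. Proof. by apply: sub_supp bf0 => m [->]. Qed.
Let f0A : prA 0 f0 = f0. Proof. by apply: pr_id; apply: sub_supp bf0 => m []. Qed.
Let f0B : prB 0 f0 = f0. Proof. by apply: pr_id; apply: sub_supp bf0 => m []. Qed.
Let f0A1 : prA 1 f0 = 0. Proof. by apply: pr_eq0; apply: sub_supp bf0 => m [_ ->]. Qed.
Let f0B1 : prB 1 f0 = 0. Proof. by apply: pr_eq0; apply: sub_supp bf0 => m [_ _ ->]. Qed.

(** At A = M = 0 the operator E becomes exp(-TB) followed by the dilation. Since exp(-TB) - 1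
    strictly lowers weight, [dil 1 0 f0] solves the reduced problem, and uniqueness identifies
    it. *)
Lemma prA0_component : prA 0 f = dil 1 0 f0.
Proof.
apply/eqP; rewrite -subr_eq0; apply/eqP; apply: (WH_unique (w := w) (@leads_dil_nTB R)).
  by apply: suppB; [exact: supp_pr | exact: wge_dil].
have lF : local (fun g => dil (-1) 0 (lexp nTB g)).
  apply: (local_comp (F := dil (-1) 0) (G := lexp nTB)); first exact: local_dil.
  exact: local_lexp (@local_nTB R) (@raises_nTB R).
rewrite (localB lF) -prA0_sewop.
have -> : prA 0 (sewop f) = prA 0 (sewop f - f0) + f0 by rewrite (localB (local_prA 0)) f0A subrK.
rewrite -addrA; apply: suppD; first exact: supp_pr.
have {1}-> : f0 = dil (-1) 0 (dil 1 0 f0) by rewrite -{2}[1]opprK dilK.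
rewrite -(localB (local_dil R (-1) 0)); apply: wle_dil.
rewrite -[_ - lexp _ _]opprB; apply: suppN.
by apply: wle_lexp_nTB; exact: wle_dil.
Qed.

(** At B = N = 0 the operator E becomes [H1op], whose inverse does not lower weight; the preimage of
    f0 therefore solves the reduced problem exactly. *)
Lemma prB0_component : prB 0 f = dil 1 0 (lexp TA f0).
Proof.
apply/eqP; rewrite -subr_eq0; apply/eqP; apply: (WH_unique (w := w) (@leads_H1op R)).
  apply: suppB; first exact: supp_pr.
  by apply: wge_dil; exact: wge_lexp_TA.
rewrite (localB (@local_H1op R)) -prB0_sewop.
have -> : H1op (dil 1 0 (lexp TA f0)) = f0 by rewrite /H1op -{2}[1]opprK dilK TAK.
by rewrite -{1}f0B -(localB (local_prB 0)); exact: supp_pr.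
Qed.

Lemma prB0_sewop_component : prB 0 (sewop f) = f0.
Proof. by rewrite prB0_sewop prB0_component /H1op -{2}[1]opprK dilK TAK. Qed.

Lemma prA0_sewop_component : prA 0 (sewop f) = dil (-1) 0 (lexp nTB (dil 1 0 f0)).
Proof. by rewrite prA0_sewop prA0_component. Qed.

(** Conjugation by the dilation, which is the origin of the arguments alpha_0 x in the low order
    terms. *)
Definition TB' g := dil (-1) 0 (TB (dil 1 0 g)).
Definition bracket g := TA (TB' g) - TB' (TA g).
Definition p11 g := prA 1 (prB 1 g).

(** Bidegree (1, 1) receives contributions from the parts of f of bidegree (1, 1), (1, 0), (0, 1)
    and (0, 0). By the boundary values these are unknown, [dil 1 0 (TA f0)], zero and [dil 1 0 f0];
    the known ones assemble to the commutator. *)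
Lemma p11_sewop : p11 (sewop f) = dil (-1) 0 (p11 f) + bracket f0.
Proof.
have rw1 g : prA 1 (lexp nTA g) = prA 1 g - TA (prA 0 g).
  rewrite pr1_lexp //; [exact: local_nTA|exact: raises_nTA| |] => k.
    by rewrite /nTA (localN (local_pr R degAM 0)) prA_TA0 oppr0.
  by rewrite /nTA (localN (local_pr R degAM 1)) prA_TA.
have rw2 g : prB 1 (lexp nTB g) = prB 1 g - TB (prB 0 g).
  rewrite pr1_lexp //; [exact: local_nTB|exact: raises_nTB| |] => k.
    by rewrite /nTB (localN (local_pr R degBN 0)) prB_TB0 oppr0.
  by rewrite /nTB (localN (local_pr R degBN 1)) prB_TB.
have rw3 : prA 1 (lexp TA f0) = TA f0.
  rewrite pr1_lexp; [|exact: local_TA|exact: raises_TA|exact: prA_TA0|exact: prA_TA].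
  by rewrite -/(prA 1) -/(prA 0) f0A1 f0A add0r.
rewrite /p11 /sewop /H1op prB_lexp_nTA prB_dil rw2 rw1 !prA_dil.
rewrite !(localB (local_prA _)) !prA_TB prB0_component prA_dil rw3.
rewrite [prA 0 (prB 1 f)]prAB prA0_component prB_dil f0B1 (local0 (local_dil R 1 0)).
rewrite prA_dil pr0_lexp; [|exact: local_TA|exact: raises_TA|exact: prA_TA0].
rewrite -/(prA 0) f0A sub0r (localN (local_dil R (-1) 0)) (localN (@local_TA R)).
rewrite (localB (local_dil R (-1) 0)) /bracket /TB'.
move: (TA (dil (-1) 0 (TB (dil 1 0 f0)))) (dil (-1) 0 (TB (dil 1 0 (TA f0)))) => x y.
by rewrite opprK -addrA [- y + x]addrC.
Qed.

Lemma p11_sewop_wle : wle (w - 1) (p11 (sewop f)).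
Proof.
have -> : p11 (sewop f) = p11 (sewop f - f0).
  by rewrite /p11 (localB (local_prB 1)) f0B1 subr0.
by apply: supp_pr; apply: supp_pr.
Qed.

Definition low (w : int) : lser -> lser := tw (diag (R := R) (fun m => (wt m <= w - 1)%R%:R)).
Definition high (w : int) : lser -> lser := tw (diag (R := R) (fun m => (w <= wt m)%R%:R)).

(** In [p11_sewop] the left side has weight at most w - 1 and the dilated part of f weight at least
    w, so the bracket is split into its two complementary halves. *)
Lemma p11_sewop_low : p11 (sewop f) = low w (bracket f0).
Proof.
have e := p11_sewop; apply: lserP => m.
rewrite [RHS](_ : _ = (wt m <= w - 1)%R%:R * bracket f0 m) //.
have ge : wge w (dil (-1) 0 (p11 f)) by apply: wge_dil; apply: supp_pr; exact: supp_pr.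
have [mw|mw] := boolP (wt m <= w - 1)%R.
  by rewrite mul1r e coefD (suppP ge) ?add0r //; lia.
by rewrite mul0r (suppP p11_sewop_wle) //; apply/negP.
Qed.

Lemma p11_high : p11 f = - dil 1 0 (high w (bracket f0)).
Proof.
have e : dil (-1) 0 (p11 f) = - high w (bracket f0).
  have ge : wge w (dil (-1) 0 (p11 f)) by apply: wge_dil; apply: supp_pr; exact: supp_pr.
  apply: lserP => m; rewrite coefN [high _ _ _](_ : _ = (w <= wt m)%R%:R * bracket f0 m) //.
  have [mw|mw] := boolP (w <= wt m)%R; last first.
    by rewrite mul0r oppr0 (suppP ge) //; apply/negP.
  have := congr1 (fun g : lser => g m) p11_sewop; rewrite coefD (suppP p11_sewop_wle); last by lia.
  by move=> /esym/eqP; rewrite addr_eq0 mul1r => /eqP.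
by rewrite -[p11 f](dilK 1 0) e (localN (local_dil R 1 0)).
Qed.

End Component.

Lemma setAM0E f : setAM0 (lval f) = lval (prA 0 f).
Proof.
apply/funext => m; rewrite -[RHS]/(prA 0 f m) prE /setAM0.
by case: eqP; rewrite ?mul1r ?mul0r.
Qed.

Lemma setBN0E f : setBN0 (lval f) = lval (prB 0 f).
Proof.
apply/funext => m; rewrite -[RHS]/(prB 0 f m) prE /setBN0.
by case: eqP; rewrite ?mul1r ?mul0r.
Qed.

Lemma sol_boundary u v : sol u v ->
  boundary_conditions (lval (sewop u), lval (sewop v)) (lval u, lval v).
Proof.
move=> [u1 u2 v1 v2].
have eB f := @expopE R (fun g : series R => - opBN g) nTB f (@raises_nTB R) (@nTBE R).
have eA f := @expopE R (@opAM R) TA f (@raises_TA R) (@opAME R).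
have bE (T : series R -> series R) (a b : lser) (K : lser -> lser) : (forall f, T (lval f) = lval (K f)) ->
    both T (lval a, lval b) = (lval (K a), lval (K b)).
  by move=> TK; rewrite /both /= !TK.
have idE : idsmap R = (lval (lX 1), lval lphi) by [].
rewrite /boundary_conditions !(bE _ _ _ _ setAM0E) !(bE _ _ _ _ setBN0E) idE.
rewrite !(bE _ _ _ _ (pow2L0E (R := R) 1)) !(bE _ _ _ _ eB) !(bE _ _ _ _ eA).
rewrite !(bE _ _ _ _ (pow2L0E (R := R) _)); split.
- by rewrite (prA0_sewop_component base_X u1 u2) (prA0_sewop_component base_phi v1 v2).
- by rewrite (prB0_sewop_component base_X u1 u2) (prB0_sewop_component base_phi v1 v2).
- rewrite (prA0_component base_X u1 u2) (prA0_component base_phi v1 v2) !dil_mon.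
  rewrite -[smul _ (xpow R 1)]/(lval (lmon (-2, 0, mset0, fset0) * lX 1)).
  rewrite -[smul _ (phi R)]/(lval (lmon (-1, 0, mset0, fset0) * lphi)).
  rewrite !lmonM !msignE /oddisj ?fdisjoint0X // !inversions0l !scale1r.
  rewrite /pwm wt_mphi /mmul /ea /ex /ev /od /= !mset0D !fset0U !add0r.
  by [].
by rewrite (prB0_component base_X u1 u2) (prB0_component base_phi v1 v2).
Qed.

End Boundary.

(** * Low order terms *)

Section Brackets.
Variable R : realType.
Local Notation lser := (lser R).
Local Notation lmon := (@lmon R).
Local Notation lphi := (@lphi R).
Local Notation lX := (lX R).
Local Notation TA := (@TA R).
Local Notation TB := (@TB R).
Local Notation dil := (@dil R).
Local Notation TB' := (@TB' R).
Local Notation bracket := (@bracket R).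
Local Notation lgA := (lgA R).
Local Notation lgB := (lgB R).
Local Notation lgM := (lgM R).
Local Notation lgN := (lgN R).
Implicit Types (f g h u v k : lser) (p q m : mon) (F G T : lser -> lser) (t s a b : int).

Definition mA a : mon := (a, 0, mset0, fset0).
Definition lA a := lmon (mA a).

Lemma lA_even a : even (lA a).
Proof. by rewrite /even tau_mon cardfs0 scale1r. Qed.

Lemma dx_lA a f : dx (lA a * f) = lA a * dx f.
Proof. by rewrite dxM /lA dx_mon scale0r mul0r add0r. Qed.

Lemma lA_mulCA a f g : f * (lA a * g) = lA a * (f * g).
Proof. by rewrite mulrA -(even_comm f (lA_even a)) mulrA. Qed.

Lemma dil_shift t s s' f : dil t (s + s') f = lA (- t * s) * dil t s' f.
Proof.
rewrite -{1}[f]mul1r dilM.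
have -> : dil t s 1 = lA (- t * s) => //.
by rewrite lone dil_mon /pwm /mon1 /wt /has_phi /= /ea /ex /ev /od /= mulr0 !add0r.
Qed.

Lemma dx_dil t s f : dx (dil t s f) = dil t (s + 2) (dx f).
Proof.
apply: lserP => m; rewrite !(dxE, dilE).
have -> : pwm t s (shx 1 m) = shx 1 (pwm t (s + 2) m) => //.
by rewrite /pwm /shx -/(shx 1 m) wt_shx mulr1 -addrA [2 + s]addrC.
Qed.

Lemma dphi_dil t s f : dphi (dil t s f) = dil t (s + 1) (dphi f).
Proof.
apply: lserP => m; rewrite !(dphiE, dilE).
have [mN|mN] := boolP (has_phi m).
  by rewrite [has_phi (pwm _ _ _)]mN !mul0r.
rewrite [has_phi (pwm _ _ _)](negbTE mN).
have -> : pwm t s (addphi m) = addphi (pwm t (s + 1) m) => //.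
by rewrite /pwm wt_addphi // -addrA [1 + s]addrC.
Qed.

Lemma dil_phi t s f : dil t (-1 + s) (lphi * f) = lphi * dil t s f.
Proof.
rewrite dilM; have -> : dil t (-1) lphi = lphi => //.
by rewrite dil_mon /pwm wt_mphi subrr mulr0 addr0.
Qed.

Local Notation gB' := (dil (-1) (-2) lgB).
Local Notation gN' := (dil (-1) (-1) lgN).

Lemma dil1K s f : dil (-1) s (dil 1 s f) = f.
Proof. by rewrite -[X in dil X s (dil 1 _ _)]/(- 1) -{2}[1]opprK dilK. Qed.

Lemma dilN1K s f : dil 1 s (dil (-1) s f) = f.
Proof. exact: dilK. Qed.

(** A dilation carries superconformal fields to such fields; the shifts -2 and -1 of the
    coefficients cancel the factors picked up by d/dx and Q. *)
Lemma TB'E f : TB' f = vT gB' gN' f.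
Proof.
have l := local_dil R (-1) 0.
rewrite /TB' /TB /vT (localN l) !(localD l) (localZ l).
have -> : dil (-1) 0 (lgB * dx (dil 1 0 f)) = gB' * dx f.
  by rewrite dx_dil -[0 in LHS](addNr 2) dilM add0r dil1K.
have -> : dil (-1) 0 (lphi * dx lgB * dphi (dil 1 0 f)) = lphi * dx gB' * dphi f.
  have e : dil (-1) (-1) (lphi * dx lgB) = lphi * dx gB'.
    by rewrite dx_dil addNr -dil_phi addr0.
  by rewrite dphi_dil -[0 in LHS](addNr 1) dilM e add0r dil1K.
have -> : dil (-1) 0 (lgN * vQ (dil 1 0 f)) = gN' * vQ f => //.
have -> : vQ (dil 1 0 f) = dil 1 1 (vQ f).
  rewrite /vQ (localB (local_dil R 1 1)) dphi_dil dx_dil -dil_phi.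
  by [].
by rewrite -[0 in LHS](addNr 1) dilM dil1K.
Qed.

(** Terms with a factor phi die under phi, and the d/dphi in Q removes the phi in front of k2. The
    argument has the shape of the values of a field on x and phi in [vT_X] and [vT_phi]. *)
Lemma phi_vT g h k1 k2 : even g -> odds h -> pfree k1 -> pfree k2 ->
  lphi * vT g h (- (k1 + lphi * k2)) = lphi * (g * dx k1 + h * k2).
Proof.
move=> ge ho p1 p2; rewrite (localN (local_vT g h)) (localD (local_vT g h)).
rewrite /vT -opprD opprK.
have phih f : lphi * (h * (lphi * f)) = 0.
  by rewrite [h * _]mulrA (odd_comm lphi ho) tau_phi !mulNr mulrN -(mulrA lphi h) phiphiM oppr0.
have phig f : lphi * (g * (lphi * f)) = 0.
  by rewrite [g * _]mulrA (even_comm lphi ge) -(mulrA lphi g) phiphiM.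
have -> : vQ k1 = - (lphi * dx k1) by rewrite /vQ p1 sub0r.
have -> : vQ (lphi * k2) = k2 by rewrite /vQ dphi_phiM p2 dx_phiM phiphiM mulr0 !subr0.
rewrite p1 dphi_phiM p2 dx_phiM (mulr0 lphi) subr0 mulr0 scaler0 addr0 -(mulrA lphi (dx g)).
have gen (x y z w n : lser) : lphi * y = 0 -> lphi * z = 0 -> lphi * w = 0 ->
    lphi * (x - y + (z + w + n)) = lphi * (x + n).
  move=> y0 z0 w0; rewrite 2!mulrDr mulrN y0 oppr0 addr0 2!mulrDr z0 w0 !add0r.
  by rewrite -mulrDr.
rewrite mulrN; apply: gen => //.
by rewrite -scalerAr phiphiM scaler0.
Qed.

Lemma even_dil t s g : even g -> even (dil t s g).
Proof. by rewrite /even tau_dil => ->. Qed.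
Lemma odd_dil t s g : odds g -> odds (dil t s g).
Proof. by rewrite /odds tau_dil => ->; rewrite (localN (local_dil R t s)). Qed.
Lemma pfree_dil t s g : pfree g -> pfree (dil t s g).
Proof. by rewrite /pfree dphi_dil => ->; rewrite (local0 (local_dil R t _)). Qed.

Lemma vT_X g h : odds h -> vT g h (lX 1) = - (g + lphi * h).
Proof.
move=> ho; rewrite /vT.
have dX : dx (lX 1) = 1 by rewrite dx_mon scale1r.
have pX : dphi (lX 1) = 0 by rewrite dphi_mon scale0r.
rewrite /vQ dX pX mulr1 mulr0 scaler0 addr0 sub0r mulr1 mulrN (odd_comm lphi ho).
by rewrite tau_phi mulNr opprK.
Qed.

Lemma vT_phi g h : vT g h lphi = - (h + lphi * (2^-1 *: dx g)).
Proof.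
rewrite /vT /vQ dx_phi dphi_phi !mulr0 !mulr1 subr0 mulr1 add0r addrC.
by rewrite -scalerAr.
Qed.

Let gB'e : even gB'. Proof. exact: even_dil (@lgB_even R). Qed.
Let gN'o : odds gN'. Proof. exact: odd_dil (@lgN_odd R). Qed.
Let gB'p : pfree gB'. Proof. exact: pfree_dil (@lgB_pfree R). Qed.
Let gN'p : pfree gN'. Proof. exact: pfree_dil (@lgN_pfree R). Qed.

Lemma pfree_dx g : pfree g -> pfree (dx g).
Proof. by rewrite /pfree -dx_dphi => ->; exact: dx0. Qed.
Lemma pfreeZ c g : pfree g -> pfree (c *: g).
Proof. by rewrite /pfree dphiZ => ->; exact: scaler0. Qed.

(** The phi-free part of the commutator on x: the Lie bracket of the even fields and an odd
    contribution, doubled because g_M and g_N anticommute. On phi the analogous part is [kphi]. *)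
Definition kX := lgA * dx gB' - gB' * dx lgA + 2 *: (lgM * gN').
Definition kphi :=
  (lgA * dx gN' - 2^-1 *: (gN' * dx lgA)) + (2^-1 *: (lgM * dx gB') - gB' * dx lgM).

Lemma bracket_X : lphi * bracket (lX 1) = lphi * kX.
Proof.
rewrite /bracket !TB'E /TA !vT_X //; last exact: lgM_odd.
rewrite mulrBr !phi_vT //; [|exact: lgA_pfree|exact: lgM_pfree|exact: lgA_even|exact: lgM_odd].
rewrite -mulrBr (odd_comm lgM gN'o) lgM_odd mulNr /kX.
have gen (x y p : lser) : x + p - (y - p) = x - y + 2 *: p.
  by apply: lserP => m; rewrite !(coefD, coefN, coefZ); ring.
by rewrite gen.
Qed.

Lemma bracket_phi : lphi * bracket lphi = lphi * kphi.
Proof.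
rewrite /bracket !TB'E /TA !vT_phi.
rewrite mulrBr !phi_vT //; try (by apply: pfreeZ; apply: pfree_dx => //; exact: lgA_pfree);
  [|exact: lgM_pfree|exact: lgA_even|exact: lgM_odd].
rewrite -mulrBr -!scalerAr /kphi.
have gen (x y z w : lser) : x + z - (w + y) = x - y + (z - w).
  by rewrite opprD [- w - y]addrC addrACA.
by rewrite gen.
Qed.

End Brackets.

(** * Weight projections and the series P, Q *)

Section Projections.
Variable R : realType.
Local Notation lser := (lser R).
Local Notation lphi := (@lphi R).
Local Notation sewop := (@sewop R).
Local Notation dil := (@dil R).
Local Notation lA := (@lA R).
Local Notation lgA := (lgA R).
Local Notation lgB := (lgB R).
Local Notation lgM := (lgM R).
Local Notation lgN := (lgN R).
Local Notation gB' := (dil (-1) (-2) lgB).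
Local Notation gN' := (dil (-1) (-1) lgN).
Implicit Types (f g h u v k : lser) (p q m : mon) (F G T : lser -> lser) (t s a b : int).

Lemma diag_phi (c c' : mon -> R[i]) f :
  (forall m, ~~ has_phi m -> c' (mmul mphi m) = c m) ->
  lphi * tw (diag c) f = tw (diag c') (lphi * f).
Proof.
move=> cc; apply: (local_ext (F := fun f => lphi * tw (diag c) f)
  (G := fun f => tw (diag c') (lphi * f))); try by loc.
move=> p; rewrite diag_mon -scalerAr lmonM (localZ (local_tw _)) diag_mon msign_phi.
case: (boolP (has_phi p)) => [_|/cc ->]; first by rewrite !scale0r scaler0.
by rewrite !scale1r.
Qed.

Lemma diag_lA (c : mon -> R[i]) a f : (forall m, c (mmul (mA a) m) = c m) ->
  tw (diag c) (lA a * f) = lA a * tw (diag c) f.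
Proof.
move=> cc; apply: (local_ext (F := fun f => tw (diag c) (lA a * f))
  (G := fun f => lA a * tw (diag c) f)); try by loc.
move=> p; rewrite diag_mon -scalerAr lmonM (localZ (local_tw _)) diag_mon cc.
by rewrite !scalerA mulrC.
Qed.

Definition lminus := tw (diag (R := R) (fun m => (ex m <= 0)%R%:R)).
Definition lplus := tw (diag (R := R) (fun m => (0 < ex m)%R%:R)).

Lemma local_lminus : local lminus. Proof. exact: local_tw. Qed.
Lemma local_lplus : local lplus. Proof. exact: local_tw. Qed.

Lemma ex_mphi m : ex (mmul mphi m) = ex m.
Proof. by rewrite /mmul /ex /= add0r. Qed.

Lemma phi_lminus f : lphi * lminus f = lminus (lphi * f).
Proof. by apply: diag_phi => m _; rewrite ex_mphi. Qed.
Lemma phi_lplus f : lphi * lplus f = lplus (lphi * f).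
Proof. by apply: diag_phi => m _; rewrite ex_mphi. Qed.
(** On monomials without phi the weight is 2n, so for both values of w the condition weight at most
    w - 1 says n <= 0: the weight cut becomes the decomposition into p^- and p^+. *)
Lemma phi_low w f : w = 1 \/ w = 2 -> lphi * low w f = lminus (lphi * f).
Proof.
move=> w12; apply: diag_phi => m /negbTE mN; rewrite ex_mphi /wt mN; congr (_ _)%:R.
by case: w12 => ->; apply/idP/idP; lia.
Qed.
Lemma phi_high w f : w = 1 \/ w = 2 -> lphi * high w f = lplus (lphi * f).
Proof.
move=> w12; apply: diag_phi => m /negbTE mN; rewrite ex_mphi /wt mN; congr (_ _)%:R.
by case: w12 => ->; apply/idP/idP; lia.
Qed.

Lemma ex_mA a m : ex (mmul (mA a) m) = ex m.
Proof. by rewrite /mmul /ex /= add0r. Qed.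

Lemma lminus_lA a f : lminus (lA a * f) = lA a * lminus f.
Proof. by apply: diag_lA => m; rewrite ex_mA. Qed.
Lemma lplus_lA a f : lplus (lA a * f) = lA a * lplus f.
Proof. by apply: diag_lA => m; rewrite ex_mA. Qed.

Lemma lplus_dil t s f : lplus (dil t s f) = dil t s (lplus f).
Proof.
apply: lserP => m; rewrite dilE [LHS](_ : _ = (0 < ex m)%R%:R * dil t s f m) //.
by rewrite dilE.
Qed.

Lemma minus_partE f : minus_part (lval f) = lval (lminus f).
Proof.
apply/funext => m; rewrite -[RHS]/((ex m <= 0)%R%:R * f m) /minus_part.
by case: ifP; rewrite ?mul1r ?mul0r.
Qed.

Lemma plus_partE f : plus_part (lval f) = lval (lplus f).
Proof.
apply/funext => m; rewrite -[RHS]/((0 < ex m)%R%:R * f m) /plus_part.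
by case: ifP; rewrite ?mul1r ?mul0r.
Qed.

(** The dilation also scales phi while [rescale] does not, so the two are compared on series without
    phi. *)
Lemma rescaleE t f : pfree f -> rescale t (lval f) = lval (dil (- t) 0 f).
Proof.
move=> /pfreeP fp; apply/funext => m; rewrite -[RHS]/(dil (- t) 0 f m) dilE /pwm addr0.
have [mN|mN] := boolP (has_phi m).
  have -> : rescale t (lval f) m = f (ea m - t * (2 * ex m), ex m, ev m, od m) by [].
  by rewrite !(suppP fp) //; apply/negP; rewrite negbK.
by rewrite /rescale /wt (negbTE mN) addr0 mulNr.
Qed.

Definition lP0 :=
  lminus (lA (-2) * (lgA * dx (dil (-1) 0 lgB)) - lA (-2) * (dil (-1) 0 lgB * dx lgA))
  + 2 *: (lA (-1) * lminus (lgM * dil (-1) 0 lgN)).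

Definition lP1 :=
  lA (-1) * lminus (lgA * dx (dil (-1) 0 lgN) - 2^-1 *: (dil (-1) 0 lgN * dx lgA))
  + lA (-2) * lminus (2^-1 *: (lgM * dx (dil (-1) 0 lgB)) - dil (-1) 0 lgB * dx lgM).

Definition lQ0 :=
  lplus (lgB * dx (dil 1 0 lgA) - dil 1 0 lgA * dx lgB)
  - 2 *: (lA (-1) * lplus (dil 1 0 lgM * lgN)).

Definition lQ1 :=
  lA 1 * lplus (2^-1 *: (lgN * dx (dil 1 0 lgA)) - dil 1 0 lgA * dx lgN)
  + lplus (lgB * dx (dil 1 0 lgM) - 2^-1 *: (dil 1 0 lgM * dx lgB)).

Lemma PQE : [/\ P0 R = lval lP0, P1 R = lval lP1, Q0 R = lval lQ0 & Q1 R = lval lQ1].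
Proof.
have rB := rescaleE 1 (@lgB_pfree R); have rN := rescaleE 1 (@lgN_pfree R).
have rA := rescaleE (-1) (@lgA_pfree R); have rM := rescaleE (-1) (@lgM_pfree R).
rewrite /P0 /P1 /Q0 /Q1 !gAE !gBE !gME !gNE rB rN rA rM.
split.
- pose x := lA (-2) * (lgA * dx (dil (-1) 0 lgB)) - lA (-2) * (dil (-1) 0 lgB * dx lgA).
  pose y := lgM * dil (-1) 0 lgN.
  rewrite -[LHS]/(minus_part (lval x) + 2 *: smul (alpha R (-1)) (minus_part (lval y))).
  by rewrite !minus_partE.
- pose x := lgA * dx (dil (-1) 0 lgN) - 2^-1 *: (dil (-1) 0 lgN * dx lgA).
  pose y := 2^-1 *: (lgM * dx (dil (-1) 0 lgB)) - dil (-1) 0 lgB * dx lgM.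
  rewrite -[LHS]/(smul (alpha R (-1)) (minus_part (lval x)) + smul (alpha R (-2)) (minus_part (lval y))).
  by rewrite !minus_partE.
- pose x := lgB * dx (dil 1 0 lgA) - dil 1 0 lgA * dx lgB.
  pose y := dil 1 0 lgM * lgN.
  rewrite -[LHS]/(plus_part (lval x) - 2 *: smul (alpha R (-1)) (plus_part (lval y))).
  by rewrite !plus_partE.
pose x := 2^-1 *: (lgN * dx (dil 1 0 lgA)) - dil 1 0 lgA * dx lgN.
pose y := lgB * dx (dil 1 0 lgM) - 2^-1 *: (dil 1 0 lgM * dx lgB).
rewrite -[LHS]/(smul (alpha R 1) (plus_part (lval x)) + plus_part (lval y)).
by rewrite !plus_partE.
Qed.

Lemma gB'E : gB' = lA (-2) * dil (-1) 0 lgB.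
Proof. by rewrite -[-2 in LHS]addr0 dil_shift. Qed.
Lemma gN'E : gN' = lA (-1) * dil (-1) 0 lgN.
Proof. by rewrite -[-1 in X in dil _ X]addr0 dil_shift. Qed.

Lemma lP0E : lP0 = lminus (kX R).
Proof.
rewrite /lP0 /kX -lminus_lA -(localZ local_lminus) -(localD local_lminus).
rewrite gB'E gN'E dx_lA (lA_mulCA (-2) lgA) (lA_mulCA (-1) lgM).
by rewrite -(mulrA (lA (-2)) (dil (-1) 0 lgB)).
Qed.

Lemma lP1E : lP1 = lminus (kphi R).
Proof.
rewrite /lP1 /kphi -!lminus_lA -(localD local_lminus) !mulrBr -!scalerAr.
rewrite gB'E gN'E !dx_lA (lA_mulCA (-1) lgA) (lA_mulCA (-2) lgM).
by rewrite -(mulrA (lA (-1)) (dil (-1) 0 lgN)) -(mulrA (lA (-2)) (dil (-1) 0 lgB)).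
Qed.

Lemma dil1_gB'dx f : dil 1 0 (f * dx gB') = dil 1 0 f * dx lgB.
Proof. by rewrite -[0 in LHS]addr0 dilM dx_dil addNr dilN1K. Qed.

Lemma dil1_gB' f : dil 1 0 (gB' * dx f) = lgB * dx (dil 1 0 f).
Proof. by rewrite -[0 in LHS](addNr 2) dilM dilN1K dx_dil add0r. Qed.

Lemma dil1_shift s f : dil 1 s f = lA (- s) * dil 1 0 f.
Proof. by rewrite -{1}[s]addr0 dil_shift mulN1r. Qed.

Lemma lQ0E : lQ0 = - lplus (dil 1 0 (kX R)).
Proof.
have l := local_dil R 1 0; have lp := local_lplus.
rewrite /kX (localD l) (localB l) (localZ l) dil1_gB'dx dil1_gB'.
have -> : dil 1 0 (lgM * gN') = lA (-1) * (dil 1 0 lgM * lgN).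
  by rewrite -[0 in LHS](addrN 1) dilM dilN1K dil1_shift mulrA.
rewrite (localD lp) (localZ lp) lplus_lA opprD -(localN lp) opprB.
by [].
Qed.

Lemma lQ1E : lQ1 = - lplus (dil 1 0 (kphi R)).
Proof.
have l := local_dil R 1 0; have lp := local_lplus.
rewrite /kphi (localD l) !(localB l) !(localZ l) dil1_gB'dx dil1_gB'.
have -> : dil 1 0 (lgA * dx gN') = lA 1 * (dil 1 0 lgA * dx lgN).
  by rewrite -[0 in LHS](addNr 1) dilM dx_dil addrC dilN1K dil1_shift opprK mulrA.
have -> : dil 1 0 (gN' * dx lgA) = lA 1 * (lgN * dx (dil 1 0 lgA)).
  have e : dil 1 1 (dx lgA) = dx (dil 1 (-1) lgA) by rewrite dx_dil.
  rewrite -[0 in LHS](addNr 1) dilM dilN1K e dil1_shift opprK.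
  by rewrite dx_lA (lA_mulCA 1 lgN).
rewrite /lQ1 -lplus_lA -(localD lp) -(localN lp) mulrBr -scalerAr.
by rewrite opprD !opprB.
Qed.

Lemma sol_p11 u v : sol u v ->
  [/\ lphi * p11 (sewop u) = lphi * lP0, lphi * p11 (sewop v) = lphi * lP1,
      lphi * p11 u = lphi * lQ0 & lphi * p11 v = lphi * lQ1].
Proof.
move=> [u1 u2 v1 v2]; have bX := @base_X R; have bp := @base_phi R.
have w2 : (2 : int) = 1 \/ (2 : int) = 2 by right.
have w1 : (1 : int) = 1 \/ (1 : int) = 2 by left.
have SQ w f g : w = 1 \/ w = 2 -> lphi * f = lphi * g ->
    lphi * - dil 1 0 (high w f) = lphi * - lplus (dil 1 0 g).
  move=> w12 fg; rewrite !mulrN lplus_dil -!dil_phi phi_high // fg -phi_lplus.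
  by [].
split.
- by rewrite (p11_sewop_low bX u1 u2) phi_low // bracket_X lP0E phi_lminus.
- by rewrite (p11_sewop_low bp v1 v2) phi_low // bracket_phi lP1E phi_lminus.
- by rewrite (p11_high bX u1 u2) lQ0E; apply: SQ => //; exact: bracket_X.
by rewrite (p11_high bp v1 v2) lQ1E; apply: SQ => //; exact: bracket_phi.
Qed.

End Projections.

(** * Remainders of order three *)

Section Remainders.
Variable R : realType.
Local Notation lser := (lser R).
Local Notation lphi := (@lphi R).
Local Notation sewop := (@sewop R).
Local Notation prA := (@pr R degAM).
Local Notation prB := (@pr R degBN).
Implicit Types (f g h u v k : lser) (p q m : mon) (F : smap R).

Definition free_part : lser -> lser := tw (diag (R := R) (fun m => (~~ has_phi m)%:R)).

Lemma free_partE f m : free_part f m = (~~ has_phi m)%:R * f m. Proof. by []. Qed.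
Lemma local_free_part : local free_part. Proof. exact: local_tw. Qed.

Lemma phi_free_part f : lphi * free_part f = lphi * f.
Proof.
rewrite /free_part (@diag_phi _ _ (fun=> 1)) => [|m ->//].
by apply: lserP => m; rewrite twE mul1r.
Qed.

Lemma smul_phiE (f : series R) m : smul (phi R) f m = if has_phi m then f (rmphi m) else 0.
Proof.
rewrite /smul; have phi0 p : p != mphi -> phi R p = 0.
  by rewrite /phi /ovar /smonom -[(0, 0, mset0, _)]/mphi => /negbTE ->.
have [mN|mN] := boolP (has_phi m); last first.
  apply: fsbig1 => -[p q] /= pq; have [pe|/phi0 ->] := eqVneq p mphi; last by rewrite mulr0 mul0r.
  by rewrite -pq pe has_phi_mphi in mN.
rewrite (@fsbigE _ _ _ _ _ [:: (mphi, rmphi m)]) //.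
- rewrite big_mkcond big_seq1 mem_set; last exact: rmphiK.
  rewrite -[LHS]/(msign R mphi (rmphi m) * phi R mphi * f (rmphi m)).
  rewrite msign_phi has_phi_rmphi.
  by rewrite /phi /ovar /smonom eqxx !mul1r.
- by move=> [p q] /=; rewrite inE => /eqP[-> ->]; exact: rmphiK.
move=> [p q] /= pq; rewrite inE => nz; have [pe|/phi0 ->] := eqVneq p mphi; last by rewrite mulr0 mul0r.
rewrite pe msign_phi; have [qN|qN] := boolP (has_phi q); first by rewrite !mul0r.
by rewrite -pq pe rmphi_mphi // eqxx in nz.
Qed.

Lemma phi_coef f m : (lphi * f) m = if has_phi m then f (rmphi m) else 0.
Proof. exact: smul_phiE. Qed.

Lemma free_part_split f : f = free_part f + lphi * dphi f.
Proof.
apply: lserP => m; rewrite coefD free_partE phi_coef.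
have [mN|mN] := boolP (has_phi m); last by rewrite mul1r addr0.
by rewrite mul0r add0r dphiE has_phi_rmphi mul1r addphiE rmphiK.
Qed.

Lemma rmphi_addphi m : ~~ has_phi m -> rmphi (addphi m) = m.
Proof. by move=> mN; rewrite addphiE rmphi_mphi. Qed.

(** The decomposition a0 + phi a1 with both parts free of phi is unique, which forces the witnesses
    f, g, xi, psi. *)
Lemma superconformal_inv u v : superconformal (lval u, lval v) ->
  dphi u = dphi v * free_part v /\ dphi v * dphi v = dx (free_part u) + free_part v * dx (free_part v).
Proof.
move=> [f [g [xi [psi [[[fp _] [gp _] [xp _] [pp _]] [[eu ev] exi eg _]]]]]].
have key (a : lser) (a0 a1 : series R) : phi_free a0 -> phi_free a1 ->
    lval a = a0 + smul (phi R) a1 -> a0 = lval (free_part a) /\ a1 = lval (dphi a).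
  move=> p0 p1 e.
  have em m : a m = a0 m + smul (phi R) a1 m by rewrite -[a m]/(lval a m) e.
  have z (b : series R) m : phi_free b -> has_phi m -> b m = 0.
    by move=> pb mN; apply/eqP; apply: contraTT mN => /pb.
  split; apply/funext => m.
    rewrite -[RHS]/(free_part a m) free_partE em smul_phiE.
    have [mN|mN] := boolP (has_phi m); last by rewrite addr0 mul1r.
    by rewrite mul0r; exact: z.
  rewrite -[RHS]/(dphi a m) dphiE.
  have [mN|mN] := boolP (has_phi m); first by rewrite mul0r; exact: z.
  rewrite mul1r em smul_phiE addphiE has_phi_mphi rmphi_mphi //.
  by rewrite (z a0) ?has_phi_mphi // add0r.
have [fE xE] := key _ _ _ fp xp eu; have [pE gE] := key _ _ _ pp gp ev.
split; apply: val_inj; first by move: exi; rewrite xE gE pE.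
by move: eg; rewrite fE pE gE.
Qed.

(** A monomial of positive d1 has positive d2, since the part with d2 = 0 sits in d1 = 0. Bidegree
    (1, 1) is removed by g, so the total degree is at least three. *)
Lemma high_rest (d1 d2 : mon -> nat) f g : g = pr d1 1 (pr d2 1 f) ->
  supp (fun m => d1 m = 0%N) (pr d2 0 f) ->
  supp (fun m => [/\ f m != 0, (1 <= d1 m)%N, (1 <= d2 m)%N & (3 <= d1 m + d2 m)%N])
    (f - pr d1 0 f - g).
Proof.
move=> -> s m; rewrite !coefB !prE; have [->|fm] := eqVneq (f m) 0.
  by rewrite !mulr0 !subr0 eqxx.
have [d10|d10] := eqVneq (d1 m) 0%N; first by rewrite d10 mul1r mul0r subrr subr0 eqxx.
have d20 : d2 m <> 0%N.
  by move=> e; move/eqP: d10; apply; apply: s; rewrite prE e eqxx mul1r.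
rewrite mul0r subr0; have [d11|d11] := eqVneq (d1 m) 1%N; last by split=> //; lia.
have [d21|d21] := eqVneq (d2 m) 1%N; last by split=> //; lia.
by rewrite !mul1r subrr eqxx.
Qed.

Lemma pair_eqD (a1 a2 b1 b2 c1 c2 d1 d2 : series R) :
  a1 = b1 + c1 + d1 -> a2 = b2 + c2 + d2 ->
  (a1, a2) = (b1, b2) + (c1, c2) + (d1, d2).
Proof. by move=> -> ->. Qed.

Lemma sol_low_order u v : sol u v ->
  low_order_terms (lval (sewop u), lval (sewop v)) (lval u, lval v).
Proof.
move=> s; have [p1 p2 q1 q2] := sol_p11 s; have [ue vo] := sol_even s.
have [u1 u2 v1 v2] := s; have bX := @base_X R; have bp := @base_phi R.
have Eue : even (sewop u) by rewrite /even tau_sewop ue.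
have Evo : odds (sewop v) by rewrite /odds tau_sewop vo (localN (@local_sewop R)).
have [P0E P1E Q0E Q1E] := PQE R.
(* The remainders of the statement must be free of phi, so their [free_part] is used; multiplication
   by phi does not see the rest. *)
pose r1 f := f - prA 0 f - p11 f; pose r2 f := f - prB 0 f - p11 f.
have laur f : (forall n s, finite_set [set m | [/\ lval f m != 0, ex m = n & sew m = s]]).
  by move=> n t; apply: sub_finite_set (lvalK f t) => m [].
have ffp f : phi_free (lval (free_part f)).
  move=> m; rewrite -[lval _ m]/(free_part f m) free_partE.
  by case: (has_phi m) => //; rewrite mul0r eqxx.
have supp_ff A f : supp A f -> supp (fun m => A m /\ ~~ has_phi m) (free_part f).
  move=> fA m nz; split; last exact: ffp nz.
  by move: nz; rewrite free_partE mulf_eq0 negb_or => /andP[_ /fA].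
have supp_r A f : supp A f -> supp A (r1 f) /\ supp A (r2 f).
  by move=> fA; split; (apply: suppB; [apply: suppB => //|]); do ? exact: supp_pr;
    apply: supp_pr; exact: supp_pr.
have ev f : even f -> even_series (lval (free_part (r1 f))) /\ even_series (lval (free_part (r2 f))).
  by move=> /evenP/supp_r[a b]; split=> m nz; [exact: (supp_ff _ _ a m nz).1 | exact: (supp_ff _ _ b m nz).1].
have od f : odds f -> odd_series (lval (free_part (r1 f))) /\ odd_series (lval (free_part (r2 f))).
  by move=> /oddsP/supp_r[a b]; split=> m nz; [exact: (supp_ff _ _ a m nz).1 | exact: (supp_ff _ _ b m nz).1].
have rest1 w f0 f : base w f0 -> wge w f -> wle (w - 1) (sewop f - f0) ->
    supp (fun m => [/\ wt m <= w - 1, (1 <= degAM m)%N, (1 <= degBN m)%N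
       & (3 <= degAM m + degBN m)%N]) (r1 (sewop f)).
  move=> bf fw Ef; apply: sub_supp (@high_rest degAM degBN (sewop f) _ erefl _); last first.
    by rewrite (prB0_sewop_component bf fw Ef); apply: sub_supp bf => m [].
  move=> m [nz a b c]; split=> //; apply: (Ef m); rewrite coefB.
  by rewrite (suppP bf) ?subr0 // => -[_ e _]; rewrite e in a.
have rest2 w f0 f : base w f0 -> wge w f -> wle (w - 1) (sewop f - f0) ->
    supp (fun m => [/\ w <= wt m, (1 <= degAM m)%N, (1 <= degBN m)%N
       & (3 <= degAM m + degBN m)%N]) (r2 f).
  move=> bf fw Ef; apply: sub_supp (@high_rest degBN degAM f _ (prAB _ _ _) _); last first.
    rewrite (prA0_component bf fw Ef); apply: dil_supp => [m//|].
    by apply: sub_supp bf => m [].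
  by move=> m [nz a b c]; split=> //; [exact: fw | rewrite addnC].
have step (a c e : lser) : lphi * p11 a = lphi * e ->
    smul (phi R) (lval a) = smul (phi R) (lval c) + smul (phi R) (lval e)
      + smul (phi R) (lval (free_part (a - c - p11 a))).
  move=> pe; rewrite -[LHS]/(lval (lphi * a)).
  rewrite -[RHS]/(lval (lphi * c + lphi * e + lphi * free_part (a - c - p11 a))).
  by rewrite phi_free_part -pe -!mulrDr -addrA [p11 a + _]addrC subrK addrC subrK.
split.
  exists (lval (free_part (r1 (sewop u))), lval (free_part (r1 (sewop v)))).
  have ru := supp_ff _ _ (rest1 _ _ _ bX u1 u2); have rv := supp_ff _ _ (rest1 _ _ _ bp v1 v2).
  split.
  - split; last exact: (ev _ Eue).1.
    split; first by split; [exact: ffp | exact: laur].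
    by move=> m /ru[[]]; rewrite /wt => a _ _ _ /negbTE b; rewrite b in a; lia.
  - split; last exact: (od _ Evo).1.
    split; first by split; [exact: ffp | exact: laur].
    by move=> m /rv[[]]; rewrite /wt => a _ _ _ /negbTE b; rewrite b in a; lia.
  - by move=> m /ru[[]].
  - by move=> m /rv[[]].
  rewrite /both P0E P1E !setAM0E; apply: pair_eqD; exact: step.
exists (lval (free_part (r2 u)), lval (free_part (r2 v))).
have ru := supp_ff _ _ (rest2 _ _ _ bX u1 u2); have rv := supp_ff _ _ (rest2 _ _ _ bp v1 v2).
split.
- split; last exact: (ev _ ue).2.
  split; first by split; [exact: ffp | exact: laur].
  by move=> m /ru[[]]; rewrite /wt => a _ _ _ /negbTE b; rewrite b in a; lia.
- split; last exact: (od _ vo).2.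
  split; first by split; [exact: ffp | exact: laur].
  by move=> m /rv[[]]; rewrite /wt => a _ _ _ /negbTE b; rewrite b in a; lia.
- by move=> m /ru[[]].
- by move=> m /rv[[]].
rewrite /both Q0E Q1E !setBN0E; apply: pair_eqD; exact: step.
Qed.

End Remainders.

(** * Uniqueness *)

Section Uniqueness.
Variable R : realType.
Local Notation lser := (lser R).
Local Notation lphi := (@lphi R).
Local Notation lX := (lX R).
Local Notation sewop := (@sewop R).
Local Notation prA := (@pr R degAM).
Local Notation prB := (@pr R degBN).
Implicit Types (f g h u v k : lser) (p q m : mon) (F : smap R).

Lemma sol_spaces u v : sol u v ->
  [/\ space1 (lval (sewop u)), space1 (lval (sewop v)), space2 (lval u) & space2 (lval v)].
Proof.
move=> [u1 u2 v1 v2]; have wb m : 2 * ex m <= wt m <= 2 * ex m + 1.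
  by rewrite /wt; case: (has_phi m); lia.
have s1 w f0 f : base w f0 -> w <= 2 -> wle (w - 1) (sewop f - f0) -> space1 (lval (sewop f)).
  move=> bf w2 Ef; split; first exact: lvalK.
  move=> m nz; have {}nz : sewop f m != 0 by [].
  have /suppP := Ef; have := wb m; have [f0m|/bf[]] := eqVneq (f0 m) 0; last by lia.
  move=> /andP[a b] h; rewrite leNgt; apply/negP => c.
  have /h : ~ wt m <= w - 1 by lia.
  by rewrite coefB f0m subr0 => e; rewrite e eqxx in nz.
split.
- exact: s1 (@base_X R) _ u2.
- exact: s1 (@base_phi R) _ v2.
- split; first exact: lvalK; move=> m /u1; rewrite /wt; case: (has_phi m) => /=; lia.
split; first exact: lvalK; move=> m /v1; rewrite /wt; case: (has_phi m) => /=; lia.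
Qed.

Lemma dphi_neq0 f m : ~~ has_phi m -> f (addphi m) != 0 -> dphi f <> 0.
Proof. by move=> mN /eqP nz e; apply: nz; rewrite -[RHS](coef0 R m) -e dphiE mN mul1r. Qed.

Lemma sol_superconformal u v : sol u v ->
  superconformal (lval (sewop u), lval (sewop v)) /\ superconformal (lval u, lval v).
Proof.
move=> s; have [ue vo] := sol_even s; have O := sol_Omega s.
have [u1 u2 v1 v2] := s; split; apply: superconformal_lval => //.
- by rewrite /even tau_sewop ue.
- by rewrite /odds tau_sewop vo (localN (@local_sewop R)).
- by rewrite !vD_sewop O sewop1M.
- apply: (@dphi_neq0 _ mon1) => //.
  have e := prB0_sewop_component (@base_phi R) v1 v2.
  have := congr1 (fun g : lser => g (addphi mon1)) e; rewrite prE.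
  have -> : addphi mon1 = mphi by rewrite addphiE mmulm1.
  rewrite degBN_phi mul1r => ->; rewrite lmonE eqxx.
  exact: oner_neq0.
(* The monomial alpha_0^{-1/2}: the boundary value of v at A = M = 0 is alpha_0^{-1/2} phi. *)
pose m := (-1, 0, mset0, fset0) : mon.
apply: (@dphi_neq0 _ m) => //.
have e := prA0_component (@base_phi R) v1 v2.
have := congr1 (fun g : lser => g (addphi m)) e; rewrite prE degAM_addphi.
rewrite [degAM m](_ : _ = 0%N) ?mul1r; last by rewrite /degAM /= enum_mset0.
move=> ->; rewrite dil_mon lmonE [pwm _ _ _](_ : _ = addphi m) ?eqxx ?oner_neq0 //.
by rewrite /pwm wt_mphi addphiE /mmul /m /= mset0D fsetU0.
Qed.

(* In degree d, twice h is the bounded series minus h^2, which only involves lower degrees. *)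
Lemma sqrt_wle h : ordge 1 h -> wle (-2) ((1 + h) * (1 + h) - 1) -> wle (-2) h.
Proof.
move=> h1; have -> : (1 + h) * (1 + h) - 1 = h + h + h * h.
  by rewrite mulrDl mul1r mulrDr mulr1 addrC -addrA addKr addrA.
move=> hw; have hE : h = 2^-1 *: ((h + h + h * h) - h * h).
  apply: double_inj; rewrite -scalerDl addrK.
  have -> : (2^-1 + 2^-1 : R[i]) = 1 by field; rewrite ?pnatr_eq0.
  by rewrite scale1r.
have hn n : supp (fun m => (sdeg m < n)%N -> wt m <= -2) h.
  elim: n => [|n IH]; first by move=> m _.
  rewrite hE; apply: suppZ; apply: suppB; first by apply: sub_supp hw => m.
  have IH' : supp (fun m => ((sdeg m < n)%N -> wt m <= -2) /\ (1 <= sdeg m)%N) h.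
    by move=> m nz; split; [exact: IH | exact: h1].
  apply: (suppM IH' IH') => p q d [a a'] [b b']; rewrite sdeg_mmul // wt_mmul // => pq.
  have := a (ltac:(lia)); have := b (ltac:(lia)); lia.
by move=> m nz; apply: (hn (sdeg m).+1).
Qed.

Lemma sol_of_conditions u v : space2 (lval u) -> space2 (lval v) ->
  superconformal (lval (sewop u), lval (sewop v)) -> superconformal (lval u, lval v) ->
  boundary_conditions (lval (sewop u), lval (sewop v)) (lval u, lval v) ->
  low_order_terms (lval (sewop u), lval (sewop v)) (lval u, lval v) -> sol u v.
Proof.
move=> [_ u2] [_ v2] /superconformal_inv[Au Ag] /superconformal_inv[au ag].
move=> [bA bB _ _] [[[r1 r2] [[[_ r1n] _] [[_ r2n] _] _ _ lo]] _].
have [P0E P1E _ _] := PQE R.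
pose A := sewop u; pose B := sewop v.
have eB f := @expopE R (fun g : series R => - opBN g) (@nTB R) f (@raises_nTB R) (@nTBE R).
pose opB (g : series R) : series R := - opBN g.
have A0 : prA 0 A = dil (-1) 0 (lexp (@nTB R) (dil 1 0 (lX 1))).
  have : setAM0 (lval A) = pow2L0 (-1) (expop opB (pow2L0 1 (lval (lX 1)))) := congr1 fst bA.
  by rewrite setAM0E pow2L0E eB pow2L0E => e; exact: val_inj.
have B0 : prA 0 B = dil (-1) 0 (lexp (@nTB R) (dil 1 0 lphi)).
  have : setAM0 (lval B) = pow2L0 (-1) (expop opB (pow2L0 1 (lval lphi))) := congr1 snd bA.
  by rewrite setAM0E pow2L0E eB pow2L0E => e; exact: val_inj.
have BB : prB 0 B = lphi.
  have : setBN0 (lval B) = lval lphi := congr1 snd bB.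
  by rewrite setBN0E => e; exact: val_inj.
have low0 w f0 : base w f0 -> wle (w - 1) (dil (-1) 0 (lexp (@nTB R) (dil 1 0 f0)) - f0).
  move=> bf; have f0le : wle w f0 by apply: sub_supp bf => m [->].
  rewrite -{2}[f0](dil1K 0) -(localB (local_dil R (-1) 0)); apply: wle_dil.
  by apply: wle_lexp_nTB; exact: wle_dil.
(* At positive powers of x neither the P term nor the remainder contributes, so there the phi-free
   part of f equals its boundary value, whose distance to f0 has weight at most w - 1. *)
have ffle (f f0 P : lser) (r : series R) (w : int) : base w f0 -> w <= 2 ->
    wle (w - 1) (prA 0 f - f0) -> (forall m, r m != 0 -> ex m <= 0) ->
    smul (phi R) (lval f) = smul (phi R) (setAM0 (lval f)) + smul (phi R) (lval (lminus P)) + smul (phi R) r ->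
    wle 0 (free_part (f - f0)).
  move=> bf w2 fw rn e m; rewrite free_partE; have [mN|mN] := boolP (has_phi m).
    by rewrite mul0r eqxx.
  rewrite mul1r; have := congr1 (fun g : series R => g (addphi m)) e.
  rewrite setAM0E -[RHS]/(smul (phi R) (lval (prA 0 f)) (addphi m) +
    smul (phi R) (lval (lminus P)) (addphi m) + smul (phi R) r (addphi m)).
  rewrite !smul_phiE rmphi_addphi // addphiE has_phi_mphi => {}e.
  have fE : f m = prA 0 f m + lminus P m + r m by [].
  rewrite coefB fE /wt (negbTE mN) => nz; have [m0|m0] := boolP (ex m <= 0); first by lia.
  move/negP: nz; case; apply/eqP.
  have -> : lminus P m = 0 by rewrite -[LHS]/((ex m <= 0)%R%:R * P m) (negbTE m0) mul0r.
  have -> : r m = 0 by apply/eqP; apply: contraNT m0; exact: rn.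
  rewrite !addr0 -coefB; apply: (suppP fw); rewrite /wt (negbTE mN); lia.
have A1 : wle 0 (free_part (A - lX 1)).
  apply: (ffle _ _ (kX R) r1 2 (@base_X R)) => //; first by rewrite A0; exact: low0 (@base_X R).
  by rewrite -lP0E -P0E; exact: (congr1 fst lo).
have B1 : wle 0 (free_part (B - lphi)).
  apply: (ffle _ _ (kphi R) r2 1 (@base_phi R)) => //; first by rewrite B0; exact: low0 (@base_phi R).
  by rewrite -lP1E -P1E; exact: (congr1 snd lo).
have ffphi : free_part lphi = 0.
  apply: lserP => m; rewrite free_partE lmonE coef0; case: eqP => [->|_]; last by rewrite mulr0.
  by rewrite /has_phi /= inE mul0r.
have ffX : free_part (lX 1) = lX 1.
  apply: lserP => m; rewrite free_partE lmonE; case: eqP => [->|_]; last by rewrite mulr0.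
  by rewrite mul1r.
rewrite (localB (@local_free_part R)) ffX in A1.
rewrite (localB (@local_free_part R)) ffphi subr0 in B1.
pose h := dphi B - 1.
have gE : dphi B = 1 + h by rewrite /h addrC subrK.
have hw : wle (-2) h.
  apply: sqrt_wle.
    move=> m; rewrite coefB dphiE lt0n => nz; apply/negP => /eqP m0; move/negP: nz; case.
    (* At B = N = 0 the component is phi, so its coefficient g is 1 there and h starts in sewing
       degree one. *)
    have mB : degBN m = 0%N by move: m0; rewrite /sdeg; lia.
    have [mN|mN] := boolP (has_phi m).
      rewrite mul0r sub0r oppr_eq0 lone lmonE; have [e|_] := eqVneq m mon1 => //.
      by rewrite e in mN.
    rewrite mul1r; have := congr1 (fun g : lser => g (addphi m)) BB.
    rewrite prE degBN_addphi mB mul1r => ->; rewrite lmonE lone lmonE addphiE subr_eq0.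
    have -> : (mmul mphi m == mphi) = (m == mon1) => //.
    apply/eqP/eqP => [e|->]; last exact: mmulm1.
    by rewrite -[m]rmphi_mphi // e -[mphi]mmulm1 rmphi_mphi.
  rewrite -gE Ag -/A -/B.
  have -> : free_part A = lX 1 + (free_part A - lX 1) by rewrite addrC subrK.
  rewrite dxD; have -> : dx (lX 1) = 1 by rewrite dx_mon scale1r.
  rewrite addrC -addrA addKr; apply: suppD; first by apply: wleW (wle_dx A1).
  by apply: wleW (wleM B1 (wle_dx B1)).
have s2 f : space2 (lval f) -> wge 1 f /\ wge 2 (free_part f).
  move=> [_ fs]; split=> m.
    by move=> nz; have := fs m nz; rewrite /wt; case: (has_phi m); lia.
  rewrite free_partE mulf_eq0 negb_or => /andP[a nz]; have := fs m nz.
  have mN : ~~ has_phi m by move: a; rewrite pnatr_eq0 eqb0 negbK.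
  by rewrite (negbTE mN) /wt (negbTE mN); lia.
have [v1 v1'] := s2 v (conj (lvalK v) v2); have [_ u1'] := s2 u (conj (lvalK u) u2).
split=> //.
(* The space condition alone allows weight 1 for the part of u containing phi; xi = g psi, with psi
   of weight at least 2, improves this to 2. *)
- rewrite [u]free_part_split; apply: suppD => //.
  apply: wgeW (wge_phiM _); last first.
    by rewrite au; apply: (wgeM (wge_dphi v1) v1').
  by [].
- rewrite [sewop u - _]free_part_split (localB (@local_free_part R)) ffX; apply: suppD; first exact: wleW A1.
  have -> : dphi (sewop u - lX 1) = dphi A.
    by rewrite dphiD dphiN [dphi (lX 1)]dphi_mon scale0r subr0.
  rewrite Au -/B gE mulrDl mul1r; apply: wleW (wle_phiM (w := 0) _) => //.
  by apply: suppD => //; apply: wleW (wleM hw B1).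
rewrite [sewop v - _]free_part_split (localB (@local_free_part R)) ffphi subr0; apply: suppD => //.
rewrite dphiD dphiN dphi_phi -/B -/h.
by apply: wleW (wle_phiM hw).
Qed.

End Uniqueness.

Theorem theorem3p26 (R : realType) :
  exists! F : smap R * smap R,
    [/\ superconformal F.1 /\ superconformal F.2,
        [/\ space1 F.1.1, space1 F.1.2, space2 F.2.1 & space2 F.2.2],
        boundary_conditions F.1 F.2,
        low_order_terms F.1 F.2
      & sewing_equation F.1 F.2].
Proof.
have [u [v s]] := sol_exists R; have [e1 e2 e3 e4] := sol_spaces s.
exists ((lval (sewop u), lval (sewop v)), (lval u, lval v)); split.
  split; [exact: sol_superconformal | by [] | exact: sol_boundary | exact: sol_low_order |].
  by apply/sewing_equationP.
move=> [F1 [a b]] /= [[sc1 sc2] [_ _ sa sb] bc lo sew].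
have [u' aE] : exists u', a = lval u' by exists (mkl sa.1).
have [v' bE] : exists v', b = lval v' by exists (mkl sb.1).
move: sc2 sa sb bc lo sew; rewrite aE bE => sc2 sa sb bc lo /sewing_equationP[_ F1E].
(* The first map is now E applied to the second, so only the second remains to be identified. *)
rewrite F1E in sc1 bc lo *.
have s' : sol u' v' by exact: sol_of_conditions.
by have [-> ->] := sol_unique s s'.
Qed.
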